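(* Let $X$ be a quasiprojective variety defined over $\mathbb{C}$ and let $\Phi: X \to X$ be an automorphism. Then for each $\alpha \in X(\mathbb{C})$ and each (closed) subvariety $V \subset X$, the intersection $V(\mathbb{C}) \cap \overline{\mathcal{O}}_{\Phi}(\alpha)$ is a union of at most finitely many points and at most finitely many full orbits of the form $\overline{\mathcal{O}}_{\Phi^k}(\Phi^{\ell}(\alpha))$, for some positive integers $k$ and $\ell$.
   Context: For an automorphism $\Psi: X \to X$ and $\beta \in X(\mathbb{C})$, the full orbit of $\beta$ is $\overline{\mathcal{O}}_{\Psi}(\beta) = \{\Psi^n(\beta) : n \in \mathbb{Z}\}$, where $\Psi^n$ for negative $n$ denotes the iterate of $\Psi^{-1}$. *)

(* Defs.v *)
From HB Require Import structures.
From mathcomp Require Import all_boot all_order all_algebra.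
From mathcomp Require Import classical_sets functions cardinality reals.
From mathcomp Require Import complex mpoly.

Set Implicit Arguments.
Unset Strict Implicit.
Unset Printing Implicit Defensive.

Import GRing.Theory.
Local Open Scope ring_scope.
Local Open Scope classical_set_scope.

(* The projective space P^n(K), as the set of lines through 0 in K^(n+1). *)
Definition proj (K : fieldType) (n : nat) : Type :=
  {L : {vspace 'rV[K]_n.+1} | \dim L == 1%N}.

Definition homog_coord (K : fieldType) (n : nat) (v : 'rV[K]_n.+1)
    (x : proj K n) : Prop :=
  v \in val x /\ v != 0.

Definition ev (K : fieldType) (n : nat) (p : {mpoly K[n.+1]})
    (v : 'rV[K]_n.+1) : K :=
  p.@[fun i => v 0 i].

Definition zero_locus (K : fieldType) (n : nat) (S : set {mpoly K[n.+1]}) :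
    set (proj K n) :=
  [set x | forall p v, S p -> homog_coord v x -> ev p v = 0].

Definition zariski_closed (K : fieldType) (n : nat) (A : set (proj K n)) :
    Prop :=
  exists S : set {mpoly K[n.+1]},
    (forall p, S p -> exists d : nat, p \is d.-homog) /\ A = zero_locus S.

(* Varieties are identified with their sets of K-points (K algebraically closed
   in the application) and are not required to be irreducible. *)
Definition quasiprojective (K : fieldType) (n : nat) (X : set (proj K n)) :
    Prop :=
  exists A B : set (proj K n),
    [/\ zariski_closed A, zariski_closed B & X = A `\` B].

Section Subspace.
Variables (K : fieldType) (n : nat) (X : set (proj K n)).

(* Below, [X] is also the type of its points; subsets of [X] have type
   [set X] and carry the topology induced from P^n. *)
Definition closed_in (V : set X) : Prop :=
  exists2 A : set (proj K n), zariski_closed A & V = [set x | A (val x)].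

Definition open_in (U : set X) : Prop := closed_in (~` U).

(* [f] is a total function, but only its values on [U] matter. *)
Definition regular_on (U : set X) (f : X -> K) : Prop :=
  forall x, U x ->
    exists (W : set X) (d : nat) (g h : {mpoly K[n.+1]}),
      [/\ open_in W, W x, W `<=` U, g \is d.-homog /\ h \is d.-homog &
          forall y v, W y -> homog_coord v (val y) ->
            ev h v != 0 /\ f y = ev g v / ev h v].

End Subspace.

(* A morphism is a Zariski-continuous map pulling regular functions on open
   sets back to regular functions. *)
Definition morphism (K : fieldType) (m n : nat) (X : set (proj K m))
    (Y : set (proj K n)) (phi : X -> Y) : Prop :=
  (forall U : set Y, open_in U -> open_in (phi @^-1` U)) /\
  (forall (U : set Y) (f : Y -> K), open_in U -> regular_on U f ->
     regular_on (phi @^-1` U) (f \o phi)).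

(* [Phi] is an automorphism of [X] with inverse [Phi']. *)
Definition automorphism (K : fieldType) (n : nat) (X : set (proj K n))
    (Phi Phi' : X -> X) : Prop :=
  [/\ morphism Phi, morphism Phi', cancel Phi Phi' & cancel Phi' Phi].

(* The integer iterate of a bijection [f] with inverse [g];
   [Negz m] denotes the integer -(m+1). *)
Definition iterz (T : Type) (f g : T -> T) (z : int) (x : T) : T :=
  match z with
  | Posz m => iter m f x
  | Negz m => iter m.+1 g x
  end.

Definition full_orbit (T : Type) (f g : T -> T) (x : T) : set T :=
  [set iterz f g z x | z in [set: int]].

(* Main.v *)
(** The coordinates of the orbit and the coefficients of all equations lie in a
    finitely generated ring A of complex numbers. For each nonzero f in A
    there are an odd prime p and a valuation ring O of C containing A, with p
    a non-unit and f not infinitely p-divisible in O, such that the residues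
    mod p of elements of A[1/p] in O are finite in number, bounded
    independently of f: place a transcendence basis of A at an integer point
    chosen for f (a generic nearby point being supplied by an ultrafilter),
    extend the resulting valuation to C by Zorn's lemma, and use that A is
    algebraic of bounded degree over the basis.

    By the Nullstellensatz, the local homogeneous formulas for Phi and its
    inverse have good reduction along the whole orbit, so some bounded power
    of Phi fixes residue classes, where it is a polynomial map H in y = (x -
    x0)/p that is affine mod p. After a further bounded power, composition
    with H is an operator T on O[y] with T^2 = T mod p, hence (T - 1)^j T^j =
    0 mod p^j. Starting the orbit far enough to the left, Newton's forward
    formula writes each equation of V along an arithmetic progression as a sum
    of c_i binom(n, i) with c_i in p^i O; after dividing by prod (n - n_i)
    over zeros n_1, ..., n_2h, each value is divisible by p^h. So infinitely
    many zeros in a progression force the equation to vanish on all of it,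
    with a period that does not depend on f. *)

Require Import Defs.
From HB Require Import structures.
From mathcomp Require Import all_boot all_order all_algebra.
From mathcomp Require Import boolp classical_sets functions cardinality reals.
From mathcomp Require Import filter complex mpoly.
From mathcomp Require Import ring lra zify.

Set Implicit Arguments.
Unset Strict Implicit.
Unset Printing Implicit Defensive.

Import Order.TTheory GRing.Theory Num.Theory.
Local Open Scope classical_set_scope.
Local Open Scope ring_scope.

Local Notation widen := (widen_ord (leqnSn _)).

(** * Valuation rings *)

(** The usual argument embeds the data in the p-adic integers and interpolates the orbit by analytic
    functions. Here [O] need not be complete. It only has to decide which values are units, which is
    all that the local formulas ask for; its residue field may be infinite, so finiteness is claimed
    only for a subring [L]. The affine map modulo p is not known to be bijective, and among the
    powers of a self-map of a finite set one can only promise an idempotent: hence T^2 = T mod p in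
    place of T = 1, and the factor T^j, which costs j backward steps of the orbit. No limit is
    taken: 2j zeros already force divisibility by p^j, for a j at which [O] excludes that f is so
    divisible.

    The modulus must be common to all residue classes of times, so it has to be chosen before f.
    Only [O] varies with f; p, [L] and the number of residues are fixed by the data, and factorials
    of the resulting state counts serve every orbit. *)

Lemma subring_closed_pack (K : fieldType) (S : {pred K}) :
  subring_closed S -> exists O : subringClosed K, O =i S.
Proof.
move=> h.
pose i := GRing.isSubringClosed.Build K S h.
pose O : subringClosed K := HB.pack_for (subringClosed K) S i.
by exists O.
Qed.

Section Adjoin.
Variables (K : fieldType) (O : subringClosed K) (y : K).

Definition adjoin : {pred K} :=
  [pred x | `[< exists2 f, f \is a polyOver O & x = f.[y] >]].

Lemma adjoinP x :
  reflect (exists2 f, f \is a polyOver O & x = f.[y]) (x \in adjoin).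
Proof. exact: asboolP. Qed.

Lemma adjoin_subring_closed : subring_closed adjoin.
Proof.
split.
- by apply/adjoinP; exists 1; rewrite ?rpred1 ?hornerC.
- move=> _ _ /adjoinP[f fO ->] /adjoinP[g gO ->]; apply/adjoinP.
  by exists (f - g); rewrite ?rpredB ?hornerE.
- move=> _ _ /adjoinP[f fO ->] /adjoinP[g gO ->]; apply/adjoinP.
  by exists (f * g); rewrite ?rpredM ?hornerE.
Qed.

Lemma sub_adjoin : {subset O <= adjoin}.
Proof.
by move=> x xO; apply/adjoinP; exists x%:P; rewrite ?polyOverC ?hornerC.
Qed.

Lemma mem_adjoin : y \in adjoin.
Proof. by apply/adjoinP; exists 'X; rewrite ?polyOverX ?hornerX. Qed.

End Adjoin.

Section MaximalSubring.
Variables (K : fieldType) (q : K).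

Lemma maximal_subring (R0 : subringClosed K) : q^-1 \notin R0 ->
  exists O : subringClosed K,
    [/\ {subset R0 <= O}, q^-1 \notin O &
      forall O' : subringClosed K, {subset O <= O'} -> q^-1 \notin O' ->
        {subset O' <= O}].
Proof.
move=> nq; pose good (S : set K) :=
  [/\ {subset R0 <= mem S}, q^-1 \notin S & subring_closed (mem S)].
(* Zorn is applied to sets with [R0] joined to them, so that even the union of the empty chain is
   admissible. *)
have [F FP Ft|A [AP Amax]] :=
    @Zorn_bigcup K (fun S : set K => good (S `|` [set` R0])%classic).
  have RU : {subset R0 <= mem (\bigcup_(X in F) X `|` [set` R0])%classic}.
    by move=> x xR; rewrite inE; right.
  have two x y : x \in mem (\bigcup_(X in F) X `|` [set` R0])%classic ->
      y \in mem (\bigcup_(X in F) X `|` [set` R0])%classic ->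
      exists S : set K, [/\ (S `<=` \bigcup_(X in F) X `|` [set` R0])%classic,
         S x, S y & subring_closed (mem S)].
    rewrite !inE => -[[X FX Xx]|Rx] [[Y FY Yy]|Ry].
    - have [XY|YX] := Ft _ _ FX FY.
        exists (Y `|` [set` R0])%classic; split; [|by left; exact: XY|by left|by case: (FP _ FY)].
        by move=> z [Yz|Rz]; [left; exists Y|right].
      exists (X `|` [set` R0])%classic; split; [|by left|by left; exact: YX|by case: (FP _ FX)].
      by move=> z [Yz|Rz]; [left; exists X|right].
    - exists (X `|` [set` R0])%classic; split; [|by left|by right|by case: (FP _ FX)].
      by move=> z [Yz|Rz]; [left; exists X|right].
    - exists (Y `|` [set` R0])%classic; split; [|by right|by left|by case: (FP _ FY)].
      by move=> z [Yz|Rz]; [left; exists Y|right].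
    - exists [set` R0]; split => //.
      by split=> [|x' y'|x' y']; rewrite !inE /=; [exact: rpred1|exact: rpredB|exact: rpredM].
  split; first exact: RU.
  - rewrite notin_setE => -[[X FX Xq]|Rq]; last by move: Rq; rewrite /= (negbTE nq).
    by have [_ + _] := FP _ FX; rewrite notin_setE; apply; left.
  - split; first by apply: RU; exact: rpred1.
      move=> x y xU yU; have [S [SU Sx Sy [_ SB _]]] := two _ _ xU yU.
      by rewrite inE; apply: SU; have := SB x y; rewrite !inE; exact.
    move=> x y xU yU; have [S [SU Sx Sy [_ _ SM]]] := two _ _ xU yU.
    by rewrite inE; apply: SU; have := SM x y; rewrite !inE; exact.
have [R0A nqA /subring_closed_pack[O OE]] := AP.
exists O; split=> [x /R0A||O' OO' nq']; rewrite ?OE //.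
move=> x xO'; apply: contrapT => xO.
apply: (Amax [set` O']); first split.
- by move=> z Az; apply: OO'; rewrite OE inE; left.
- by move=> Z; apply: xO; rewrite OE inE; left; exact: Z.
have -> : ([set` O'] `|` [set` R0] = [set` O'])%classic.
  apply/seteqP; split=> z /=; last by left.
  by move=> [//|/R0A]; rewrite -OE => /OO'.
split=> [z /R0A||]; first by rewrite -OE => /OO'; rewrite inE.
  by rewrite notin_setE; exact/negP.
by split=> [|x' y'|x' y']; rewrite !inE /=; [exact: rpred1|exact: rpredB|exact: rpredM].
Qed.

(** Chevalley's extension theorem. In a ring [O] maximal among those avoiding [q^-1], an element [y]
    outside satisfies [q * f.[y] = 1] for some [f] over [O], since [O[y]] contains [q^-1]. If both
    [x] and [x^-1] were outside, two such relations could be shortened against each other without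
    end. *)
Lemma dominating_valring (R0 : subringClosed K) :
  q != 0 -> q \in R0 -> q^-1 \notin R0 ->
  exists O : subringClosed K,
    [/\ {subset R0 <= O}, q^-1 \notin O & forall x, x \in O \/ x^-1 \in O].
Proof.
move=> q0 qR nq; have [O [R0O nqO Omax]] := maximal_subring nq.
exists O; split=> //; have qO := R0O _ qR.
have qdiv b : b \in O -> q * b != 1.
  move=> bO; apply: contraNneq nqO => qb1.
  by rewrite -[q^-1]mulr1 -qb1 mulrA mulVf ?mul1r.
have ext y : y \notin O -> exists2 f, f \is a polyOver O & q * f.[y] = 1.
  move=> yO; have [O' O'E] := subring_closed_pack (adjoin_subring_closed O y).
  have : ~ {subset O' <= O}.
    by move=> /(_ y); rewrite O'E mem_adjoin (negbTE yO) => /(_ isT).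
  have [/[swap] _|qO' /(_ (Omax _ _ qO'))] := boolP (q^-1 \in O'); last first.
    by case=> //; move=> x xO; rewrite O'E sub_adjoin.
  by rewrite O'E => /adjoinP[f fO fE]; exists f; rewrite -?fE ?divff.
(* [q] lies in the Jacobson radical: if [u^-1] were outside [O], clearing denominators in its
   relation would give [q * h = u ^ k]; but [u ^ k] is again 1 modulo [q], and [q] would be a
   unit. *)
have unitO b : b \in O -> (1 - q * b)^-1 \in O.
  move=> bO; apply: contraT => /ext[f fO].
  set u := 1 - q * b => fu.
  have u0 : u != 0 by rewrite subr_eq0 eq_sym qdiv.
  have uO : u \in O by rewrite rpredB ?rpred1 ?rpredM.
  have [h hO hE] : exists2 h, h \in O & f.[u^-1] * u ^+ size f = h.
    exists (\sum_(i < size f) f`_i * u ^+ (size f - i)).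
      by apply: rpred_sum => i _; rewrite rpredM ?rpredX ?(polyOverP fO).
    rewrite horner_coef mulr_suml; apply: eq_bigr => i _.
    by rewrite exprVn -mulrA; congr (_ * _); rewrite mulrC -expfB_cond ?(negbTE u0) ?add0n 1?ltnW.
  have [b' b'O b'E] : exists2 b', b' \in O & u ^+ size f = 1 - q * b'.
    elim: (size f) => [|n [b' b'O b'E]]; first by exists 0; rewrite ?rpred0 ?mulr0 ?subr0.
    exists (b + b' - q * b * b'); first by rewrite !(rpredB, rpredD, rpredM).
    by rewrite exprS b'E /u; ring.
  have := qdiv (h + b') (rpredD hO b'O).
  by rewrite -hE mulrDr mulrA fu mul1r b'E subrK eqxx.
suff main n (x : K) (f g : {poly K}) : (size f + size g <= n)%N ->
    x != 0 -> f \is a polyOver O -> g \is a polyOver O ->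
    q * f.[x] = 1 -> q * g.[x^-1] = 1 -> False.
  move=> x; have [->|x0] := eqVneq x 0; first by left; rewrite rpred0.
  have [xO|/ext[f fO fx]] := boolP (x \in O); first by left.
  have [xO|/ext[g gO gx]] := boolP (x^-1 \in O); first by right.
  by case: (main _ _ _ _ (leqnn _) x0 fO gO fx gx).
elim: n x f g => [|n IHn] x f g.
  rewrite leqn0 addn_eq0 size_poly_eq0 => /andP[/eqP-> _] _ _ _.
  by rewrite horner0 mulr0 => /eqP; rewrite eq_sym oner_eq0.
wlog sgf : x f g / (size g <= size f)%N.
  move=> W; have [sgf|sfg] := leqP (size g) (size f); first exact: W sgf.
  move=> sn x0 fO gO fx gx; apply: (W x^-1 g f (ltnW sfg)); rewrite ?invr_eq0 ?invrK //.
  by rewrite addnC.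
move=> sn x0 fO gO fx gx.
have g0 : g != 0.
  by apply/eqP => g0; move: gx; rewrite g0 horner0 mulr0 => /eqP; rewrite eq_sym oner_eq0.
have sg : (0 < size g)%N by rewrite size_poly_gt0.
have f0 : (0 < size f)%N by exact: leq_trans sgf.
set m := (size f).-1; have sf : size f = m.+1 by rewrite prednK.
have gm : ((size g).-1 <= m)%N by rewrite -ltnS prednK // -sf.
set v := (1 - q * g`_0)^-1.
have vO : v \in O by apply/unitO/(polyOverP gO).
have u0 : 1 - q * g`_0 != 0 by rewrite subr_eq0 eq_sym qdiv ?(polyOverP gO).
(* Multiplying [q * g.[x^-1] = 1] by [x ^ m] expresses [x ^ m] as [v * q] times a combination of
   lower powers of [x]; substituting it for the leading monomial of [f] keeps the value and lowers
   the size. *)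
pose h := f - (f`_m)%:P * 'X^m + (f`_m * v * q) *: \sum_(1 <= j < size g) g`_j *: 'X^(m - j).
have hx : h.[x] = f.[x].
  rewrite /h !hornerE -[RHS]addr0 -addrA; congr (_ + _).
  rewrite horner_sum; apply/eqP; rewrite addrC subr_eq0; apply/eqP.
  rewrite -!mulrA; congr (_ * _).
  have -> : \sum_(1 <= j < size g) (g`_j *: 'X^(m - j)).[x] =
            x ^+ m * (g.[x^-1] - g`_0).
    rewrite horner_coef -(prednK sg) big_ord_recl expr0 mulr1 [X in _ * X]addrAC subrr add0r mulr_sumr.
    rewrite big_add1 big_mkord; apply: eq_bigr => i _.
    rewrite !hornerE /= -mulrA mulrCA exprVn /bump leq0n add1n; congr (_ * _).
    rewrite -expfB_cond ?(negbTE x0) ?add0n //; exact: leq_trans (ltn_ord i) gm.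
  have -> : q * (x ^+ m * (g.[x^-1] - g`_0)) = x ^+ m * (1 - q * g`_0).
    by rewrite -gx; ring.
  by rewrite mulrCA mulVf ?mulr1.
have hO : h \is a polyOver O.
  rewrite rpredD ?rpredB ?rpredM ?polyOverC ?rpredX ?polyOverX ?(polyOverP fO) //.
  rewrite polyOverZ ?rpredM ?(polyOverP fO) // rpred_sum // => j _.
  by rewrite polyOverZ ?rpredX ?polyOverX ?(polyOverP gO).
have sh : (size h <= m)%N.
  apply/leq_sizeP => j mj; rewrite /h coefD coefB coefCM coefXn coefZ coef_sum big_nat big1.
    case: ltngtP mj => // [mj _|-> _]; rewrite ?mulr1 ?mulr0 ?subrr ?addr0 //.
    by rewrite nth_default ?subr0 ?sf.
  move=> i /andP[i1 isg]; rewrite coefZ coefXn.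
  have im : (i <= m)%N by rewrite -ltnS -sf (leq_trans isg).
  have -> : (j == m - i)%N = false.
    by rewrite gtn_eqF // (leq_trans _ mj) // ltn_subrL i1 (leq_trans i1 im).
  by rewrite mulr0.
apply: (IHn x h g) => //; last by rewrite hx.
by rewrite -ltnS (leq_trans _ sn) // sf addSn ltnS leq_add2r.
Qed.

End MaximalSubring.

(** * Multivariate integer polynomials *)

Lemma muni_inj n (R : nzRingType) : injective (@muni n R).
Proof.
move=> p q /eqP; rewrite -subr_eq0 -raddfB /= => /eqP h; apply/eqP; rewrite -subr_eq0.
move: (p - q) h => {p q}p h; apply: contraT; rewrite -msupp_eq0.
case E: (msupp p) => [//|m0 s] _; have m0p : m0 \in msupp p by rewrite E mem_head.
pose m1 := [multinom m0 (widen i) | i < n].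
have := congr1 (fun u : {poly {mpoly R[n]}} => u`_(m0 ord_max)@_m1) h.
rewrite muniE coef_sum raddf_sum coef0 mcoeff0 /=.
have term m : (p@_m *: 'X_[[multinom m (widen i) | i < n]] *:
    'X^(m ord_max) : {poly {mpoly R[n]}})`_(m0 ord_max)@_m1 = p@_m * (m == m0)%:R.
  rewrite coefZ coefXn; have [->|nm] := eqVneq m m0.
    by rewrite eqxx !mulr1 mcoeffZ mcoeffX eqxx mulr1.
  case: eqP => [e|_]; last by rewrite !mulr0 mcoeff0.
  rewrite !mulr1 mcoeffZ mcoeffX; case: eqP => [e'|_] //.
  case/eqP: nm; apply/mnmP => i; have [j|] := unliftP ord_max i; last by move=> ->.
  move=> ->; move/mnmP: e' => /(_ j); rewrite !mnmE.
  by rewrite (_ : lift _ _ = widen j) //; apply: val_inj; exact: lift_max.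
under eq_bigr do rewrite term.
rewrite (bigD1_seq m0) ?msupp_uniq //= eqxx mulr1 big1 ?addr0 => [p0|m /negbTE->].
  by rewrite mcoeff_msupp p0 eqxx in m0p.
by rewrite mulr0.
Qed.

Section MmapMuni.
Variables (n : nat) (R : nzRingType) (S : comNzRingType).
Variables (f : {rmorphism R -> S}) (h : 'I_n.+1 -> S).

Lemma mmap_muni p :
  mmap f h p = (map_poly (mmap f (h \o widen)) (muni p)).[h ord_max].
Proof.
rewrite muniE raddf_sum horner_sum [LHS]/mmap; apply: eq_bigr => m _.
rewrite /= map_polyZ /= map_polyXn !hornerE mmapZ mmapX -mulrA; congr (_ * _).
rewrite /mmap1 big_ord_recr /=; congr (_ * _); apply: eq_bigr => i _.
by rewrite mnmE.
Qed.

End MmapMuni.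

(** Induction on the variables: the leading coefficient in the last variable is nonzero at a
    suitable point, and the univariate polynomial left has fewer roots than the [size u] terms of
    the progression that are tried. *)
Lemma mpoly_nonvanishing n (N : int) (c0 : 'I_n -> int) (P : {mpoly int[n]}) :
  N != 0 -> P != 0 ->
  exists c : 'I_n -> int, (forall i, (N %| c i - c0 i)%Z) /\ P.@[c] != 0.
Proof.
move=> N0; elim: n => [|n IHn] in c0 P *.
  rewrite [P]nvar0_mpolyC mpolyC_eq0 => P0; exists c0; split; first by case.
  by rewrite mevalC.
move=> P0; have uP : muni P != 0 by rewrite -(raddf0 (@muni n _)) (inj_eq (@muni_inj _ _)).
have /(IHn (c0 \o widen))[c [cc0 lc0]] : lead_coef (muni P) != 0 by rewrite lead_coef_eq0.
set u := map_poly (meval c) (muni P).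
have u0 : u != 0.
  apply: contraNneq lc0 => /(congr1 (fun v : {poly int} => v`_(size (muni P)).-1)).
  by rewrite coef0 coef_map => <-.
pose rs := [seq c0 ord_max + N * (i%:Z) | i <- iota 0 (size u)].
have [x xrs ux] : exists2 x, x \in rs & ~~ root u x.
  apply/hasP; rewrite has_predC; apply: contraTN isT => /max_poly_roots.
  move=> /(_ u0); rewrite /rs size_map size_iota ltnn; apply.
  rewrite map_inj_uniq ?iota_uniq // => i j /addrI/(mulfI N0).
  by case.
exists (fun i => if unlift ord_max i is Some j then c j else x); split=> [i|].
  case: unliftP => [j ->|->].
    have -> : lift ord_max j = widen j by apply: val_inj; exact: lift_max.
    exact: cc0.
  by case/mapP: xrs => i' _ ->; rewrite addrC addKr dvdz_mulr.
rewrite [_.@[_]](mmap_muni idfun) unlift_none.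
have -> : map_poly (mmap idfun ((fun i : 'I_n.+1 =>
    if unlift ord_max i is Some j then c j else x) \o widen)) (muni P) = u.
  apply: eq_map_poly => q; apply: meval_eq => j /=.
  by rewrite (_ : widen j = lift ord_max j) ?liftK //; apply: val_inj; rewrite [RHS]lift_max.
exact: ux.
Qed.

(** * Generic p-adic places of a field of rational functions *)

Lemma meval_cong n (N : int) (c c' : 'I_n -> int) (P : {mpoly int[n]}) :
  (forall i, (N %| c i - c' i)%Z) -> (N %| P.@[c] - P.@[c'])%Z.
Proof.
move=> cc'; have -> : (N %| P.@[c] - P.@[c'])%Z = (P.@[c] == P.@[c'] %[mod N])%Z.
  by rewrite eqz_mod_dvd.
elim/mpolyind: P => [|a m P _ _ /eqP IH]; first by rewrite !meval0.
apply/eqP; rewrite !mevalD -(modzDm (_.@[c])) IH modzDm; apply/eqP.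
rewrite eqz_mod_dvd opprD addrACA subrr addr0 !mevalZ !mevalX -mulrBr dvdz_mull //.
rewrite -eqz_mod_dvd; elim/big_rec2: _ => // i x y _ /eqP e.
apply/eqP; rewrite -modzMmr e modzMmr -modzMml.
have /eqP -> : (c i ^+ m i == c' i ^+ m i %[mod N])%Z.
  elim: (m i) => // k /eqP IHk; rewrite !exprS -modzMmr IHk modzMmr -modzMml.
  by have := cc' i; rewrite -eqz_mod_dvd => /eqP ->; rewrite modzMml.
by rewrite modzMml.
Qed.

(* [a / b] lies in the localization of [int] at [p] *)
Definition pfrac (p : nat) (a b : int) : Prop :=
  exists u v : int, ~~ (p %| v)%Z /\ a * v = b * u.

Section Pfrac.
Variable p : nat.
Hypothesis pp : prime p.

Lemma dvdz_prime_mul (a b : int) :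
  (p %| a * b)%Z = (p %| a)%Z || (p %| b)%Z.
Proof. by rewrite !dvdzE abszM /= Euclid_dvdM. Qed.

Lemma int_pfactor (a : int) : a != 0 ->
  exists (i : nat) (a' : int), ~~ (p %| a')%Z /\ a = (p ^ i)%:Z * a'.
Proof.
move=> a0; have a0' : (0 < `|a|)%N by rewrite absz_gt0.
have dv : ((p ^ logn p `|a|)%N %| a)%Z by rewrite dvdzE /= pfactor_dvdnn.
exists (logn p `|a|), (a %/ (p ^ logn p `|a|)%N)%Z; split; last first.
  by rewrite mulrC divzK.
apply/negP => /dvdzP[q e].
have : (p ^ (logn p `|a|).+1 %| `|a|)%N.
  have : ((p ^ (logn p `|a|).+1)%N %| a)%Z.
    by rewrite -[X in (_ %| X)%Z](divzK dv) e -mulrA -PoszM -expnS dvdz_mull.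
  by rewrite dvdzE.
by rewrite pfactor_dvdn // ltnn.
Qed.

(** The localization at [p] is a discrete valuation ring with uniformizer [p]: if [a / b] is not
    integral, then [b / a] is not only integral but divisible by [p]. *)
Lemma pfrac_or (a b : int) : a != 0 -> b != 0 ->
  pfrac p a b \/ pfrac p b (p%:Z * a).
Proof.
move=> /int_pfactor[i [a' [pa ->]]] /int_pfactor[j [b' [pb ->]]].
have [ji|ij] := leqP j i.
  left; exists ((p ^ (i - j))%:Z * a'), b'; split=> //.
  by rewrite -(subnK ji) expnD PoszM addnK; ring.
right; exists ((p ^ (j - i.+1))%:Z * b'), a'; split=> //.
by rewrite -(subnK ij) expnD expnSr addnK !PoszM; ring.
Qed.

Lemma pfracB a b a' b' : pfrac p a b -> pfrac p a' b' ->
  pfrac p (a * b' - a' * b) (b * b').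
Proof.
move=> [u [v [pv e]]] [u' [v' [pv' e']]].
exists (u * v' - u' * v), (v * v'); rewrite dvdz_prime_mul negb_or pv pv'.
split=> //; transitivity (a * v * (b' * v') - a' * v' * (b * v)); first ring.
by rewrite e e'; ring.
Qed.

Lemma pfracM a b a' b' : pfrac p a b -> pfrac p a' b' ->
  pfrac p (a * a') (b * b').
Proof.
move=> [u [v [pv e]]] [u' [v' [pv' e']]].
exists (u * u'), (v * v'); rewrite dvdz_prime_mul negb_or pv pv'.
split=> //; transitivity (a * v * (a' * v')); first ring.
by rewrite e e'; ring.
Qed.

Lemma pfrac_cross a b a' b' : b' != 0 -> b != 0 ->
  a * b' = a' * b -> pfrac p a' b' -> pfrac p a b.
Proof.
move=> b'0 b0 e [u [v [pv e']]]; exists u, v; split=> //.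
by apply: (mulfI b'0); rewrite mulrA [b' * a]mulrC e mulrAC e'; ring.
Qed.

Lemma pfrac1 a : pfrac p a 1.
Proof.
exists a, 1; rewrite mulr1 mul1r; split=> //.
by rewrite dvdzE /= dvdn1; case: p pp => [|[]].
Qed.

Lemma pfrac_residue a b : pfrac p a b ->
  exists n : 'I_p, pfrac p (a - n%:Z * b) (p%:Z * b).
Proof.
move=> [u [v [pv e]]].
have pv' : coprimez p v by rewrite coprimezE prime_coprime // -[X in (X %| _)%N]/(`|p%:Z|%N) -dvdzE.
(* [l] inverts [v] modulo [p], so the residue of [a / b = u / v] is that of [u * l]. *)
have [k [l kl]] := Bezoutz p v.
have p0 : p%:Z != 0 by rewrite -lt0n prime_gt0.
have nlt : (`|(u * l %% p%:Z)%Z| < p)%N.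
  by have := modz_ge0 (u * l) p0; have := ltz_mod (u * l) p0; lia.
exists (Ordinal nlt) => /=.
have eabs : `|(u * l %% p%:Z)%Z|%N%:Z = (u * l %% p%:Z)%Z.
  by rewrite gez0_abs // modz_ge0.
rewrite eabs; set r := (_ %% _)%Z.
have := divz_eq (u * l) p%:Z; rewrite -/r; set q := (_ %/ _)%Z => er.
have pg : k * p%:Z + l * v = 1 by rewrite kl; exact/eqP.
exists (u * k + q * v), v; split=> //.
have -> : (a - r * b) * v = b * (u - r * v) by rewrite mulrBl e; ring.
have -> : r = u * l - q * p%:Z by rewrite er addrAC subrr add0r.
have -> : u - (u * l - q * p%:Z) * v = u * (1 - l * v) + q * p%:Z * v by ring.
by rewrite -pg addrK; ring.
Qed.

End Pfrac.

(** The sets of points in the given class where some nonzero [P] does not vanish form a filter base: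
    two of them contain the one for the product, and none is empty. *)
Lemma generic_ultrafilter n (N : int) (c0 : 'I_n -> int) : N != 0 ->
  exists2 U : set_system ('I_n -> int), UltraFilter U &
    U [set c | forall i, (N %| c i - c0 i)%Z] /\
    forall P : {mpoly int[n]}, P != 0 -> U [set c | P.@[c] != 0].
Proof.
move=> N0; pose D := [set P : {mpoly int[n]} | P != 0].
pose B (P : {mpoly int[n]}) :=
  [set c : 'I_n -> int | (forall i, (N %| c i - c0 i)%Z) /\ P.@[c] != 0].
have PF : ProperFilter (filter_from D B).
  apply: filter_from_proper => [|P P0].
    apply: filter_from_filter => [|P Q P0 Q0].
      by exists 1; exact: oner_neq0.
    exists (P * Q); first by rewrite /D /= mulf_neq0.
    by move=> c [cc0]; rewrite mevalM mulf_eq0 negb_or => /andP[].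
  by have [c cP] := mpoly_nonvanishing c0 N0 P0; exists c.
have [U [UF sU]] := ultraFilterLemma PF; exists U => //; split=> [|P P0].
  by apply: sU; exists 1 => [|c []//]; exact: oner_neq0.
by apply: sU; exists P => // c [].
Qed.

Section PlaceOnRationalFunctions.
Variables (K : numFieldType) (s : nat) (t : 'I_s -> K).
Notation ev P := (mmap (intr : int -> K) t P).
Hypothesis tfree : forall P : {mpoly int[s]}, ev P = 0 -> P = 0.

Definition ratfun (x : K) : Prop :=
  exists P Q : {mpoly int[s]}, Q != 0 /\ x = ev P / ev Q.

Lemma ev_neq0 P : P != 0 -> ev P != 0.
Proof. by apply: contra_neq => /tfree. Qed.

Lemma ev_inj P Q : ev P = ev Q -> P = Q.
Proof. by move=> e; apply/eqP; rewrite -subr_eq0; apply/eqP/tfree; rewrite rmorphB /= e subrr. Qed.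

Variables (p : nat) (m : nat) (c0 : 'I_s -> int).
Hypothesis pp : prime p.
Let N : int := (p ^ m.+1)%N.

(* The ultrafilter plays the role of a single generic p-adic point near [c0]. *)
Lemma place_subring :
  exists O : subringClosed K,
  [/\ forall P, ev P \in O,
      forall Q, ~~ (p %| Q.@[c0])%Z -> (ev Q)^-1 \in O,
      p%:R^-1 \notin O,
      forall x, ratfun x -> x \in O \/ x^-1 / p%:R \in O &
      (forall x, x \in O -> exists n : nat, (x - n%:R) / p%:R \in O) /\
      (forall e, ~~ (N %| e.@[c0])%Z -> ev e / p%:R ^+ m.+1 \notin O)].
Proof.
have p0 : p != 0%N by rewrite -lt0n prime_gt0.
have N0 : N != 0 by rewrite /N -lt0n expn_gt0 prime_gt0.
have pK : p%:R != 0 :> K by rewrite pnatr_eq0.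
have pZ : p%:Z != 0 by [].
have [U UF [Uc U0]] := generic_ultrafilter c0 N0.
have Uimp (A B : set ('I_s -> int)) : U A -> (forall c, A c -> B c) -> U B.
  by move=> UA AB; apply: filterS UA.
have UI (A B : set ('I_s -> int)) : U A -> U B -> U (A `&` B) by exact: filterI.
have Ufalse (A : set ('I_s -> int)) : U A -> (forall c, A c -> False) -> False.
  by move=> UA AF; have [c /AF] := @filter_ex _ U _ _ UA.
pose OF : {pred K} := [pred x | `[< exists P Q : {mpoly int[s]},
  [/\ Q != 0, x = ev P / ev Q & U [set c | pfrac p P.@[c] Q.@[c]]] >]].
have OFP x : reflect (exists P Q : {mpoly int[s]},
  [/\ Q != 0, x = ev P / ev Q & U [set c | pfrac p P.@[c] Q.@[c]]]) (x \in OF).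
  exact: asboolP.
(* Membership does not depend on the fraction: equal fractions have the same cross products as
   polynomials, and both denominators are nonzero at almost every [c]. *)
have OFrep P Q : Q != 0 -> ev P / ev Q \in OF -> U [set c | pfrac p P.@[c] Q.@[c]].
  move=> Q0 /OFP[P' [Q' [Q'0 e h]]].
  apply: Uimp (UI _ _ h (UI _ _ (U0 _ Q0) (U0 _ Q'0))) _ => c [/= hc [Qc Qc']].
  apply: pfrac_cross hc => //; rewrite -!mevalM; congr meval.
  apply: ev_inj; rewrite !rmorphM; apply/eqP.
  by rewrite -eqr_div ?ev_neq0 //; apply/eqP.
have OFsub : subring_closed OF.
  split.
  - apply/OFP; exists 1, 1; split; rewrite ?oner_neq0 ?rmorph1 ?divr1 //.
    apply: Uimp filterT _ => c _ /=; rewrite meval1; exact: pfrac1.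
  - move=> x y /OFP[P [Q [Q0 -> h]]] /OFP[P' [Q' [Q'0 -> h']]]; apply/OFP.
    exists (P * Q' - P' * Q), (Q * Q'); split; first by rewrite mulf_neq0.
      rewrite rmorphB !rmorphM /= mulrBl; congr (_ - _).
        by rewrite -mulf_div divff ?mulr1 ?ev_neq0.
      by rewrite [ev Q * _]mulrC -mulf_div divff ?mulr1 ?ev_neq0.
    apply: Uimp (UI _ _ h h') _ => c [/= hc hc'].
    by rewrite mevalB !mevalM; exact: pfracB.
  - move=> x y /OFP[P [Q [Q0 -> h]]] /OFP[P' [Q' [Q'0 -> h']]]; apply/OFP.
    exists (P * P'), (Q * Q'); split; first by rewrite mulf_neq0.
      by rewrite !rmorphM /= mulf_div.
    apply: Uimp (UI _ _ h h') _ => c [/= hc hc'].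
    by rewrite !mevalM; exact: pfracM.
have [O OE] := subring_closed_pack OFsub.
have evnat n : ev (n%:R) = n%:R by rewrite rmorph_nat.
have evp : ev (p%:R) != 0 by rewrite evnat.
have natm n c : (n%:R : {mpoly int[s]}).@[c] = n%:Z by rewrite rmorph_nat natz.
have pm0 : (p%:R : {mpoly int[s]}) != 0 by apply: contraNneq evp => ->; rewrite rmorph0.
exists O; split=> [P|Q pQ||x [P [Q [Q0 ->]]]|]; first last.
- split=> [x|e Ne].
    rewrite OE => /OFP[P [Q [Q0 -> h]]].
    (* Almost every [c] has one of [p] residues; an ultrafilter selects one member of a finite
       cover, so a single residue [n] is shared by almost all [c]. *)
    have : exists n : 'I_p, U [set c | pfrac p (P.@[c] - n%:Z * Q.@[c]) (p%:Z * Q.@[c])].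
      apply: contrapT => /forallNP nU.
      have nU' : U [set c | forall n : 'I_p, ~ pfrac p (P.@[c] - n%:Z * Q.@[c]) (p%:Z * Q.@[c])].
        apply: filter_forall => n.
        by have [/nU|] := in_ultra_setVsetC [set c | pfrac p (P.@[c] - n%:Z * Q.@[c]) (p%:Z * Q.@[c])] UF.
      by apply: Ufalse (UI _ _ h nU') _ => c [/= /(pfrac_residue pp)[n hn] /(_ n)].
    move=> [n hn]; exists n; rewrite OE; apply/OFP.
    exists (P - n%:R * Q), (p%:R * Q); split; first by rewrite mulf_neq0.
      rewrite rmorphB !rmorphM /= !evnat; field.
      by rewrite pK ev_neq0.
    by apply: Uimp hn _ => c; rewrite /= mevalB !mevalM !natm.
  have Q0 : (p%:R ^+ m.+1 : {mpoly int[s]}) != 0 by rewrite expf_neq0.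
  have eQ : ev (p%:R ^+ m.+1) = p%:R ^+ m.+1 by rewrite rmorphXn /= evnat.
  rewrite OE -eQ; apply/negP => /(OFrep _ _ Q0) h.
  apply: Ufalse (UI _ _ h Uc) _ => c [[u [v [pv euv]]] cc0].
  move: euv; rewrite rmorphXn /= natm => euv; case/negP: Ne.
  have Nec : (N %| e.@[c])%Z.
    rewrite -(@Gauss_dvdzl _ _ v); first by rewrite euv -[p%:Z]natz -natrX natz dvdz_mulr.
    by rewrite coprimezE coprimeXl // prime_coprime // -[X in (X %| _)%N]/(`|p%:Z|%N) -dvdzE.
  by rewrite -(subKr e.@[c] e.@[c0]) rpredB //; exact: meval_cong.
- have [->|P0] := eqVneq P 0; first by left; rewrite rmorph0 mul0r rpred0.
  have [h|h] := in_ultra_setVsetC [set c | pfrac p P.@[c] Q.@[c]] UF.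
    by left; rewrite OE; apply/OFP; exists P, Q.
  right; rewrite OE; apply/OFP; exists Q, (p%:R * P); split.
  - by rewrite mulf_neq0.
  - by rewrite rmorphM /= evnat invf_div; field; rewrite pK ev_neq0.
  apply: Uimp (UI _ _ h (UI _ _ (U0 _ P0) (U0 _ Q0))) _ => c [/= nh [Pc Qc]].
  by have [/nh//|] := pfrac_or pp Pc Qc; rewrite mevalM natm.
- have -> : p%:R^-1 = ev 1 / ev p%:R by rewrite rmorph1 evnat mul1r.
  rewrite OE.
  apply/negP => /(OFrep _ _ pm0) h; apply: Ufalse h _ => c [u [v [pv]]].
  by rewrite meval1 natm mul1r => e; rewrite e dvdz_mulr in pv.
- have Q0 : Q != 0 by apply: contraNneq pQ => ->; rewrite meval0 dvdz0.
  rewrite OE; apply/OFP; exists 1, Q; split => //; first by rewrite rmorph1 mul1r.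
  apply: Uimp Uc _ => c cc0; exists 1, Q.@[c]; rewrite meval1 mul1r mulr1; split=> //.
  apply: contra pQ => pQ; rewrite -(subKr Q.@[c] Q.@[c0]) rpredB //.
  apply: dvdz_trans (meval_cong Q cc0).
  by rewrite /N expnS PoszM dvdz_mulr.
- rewrite OE; apply/OFP; exists P, 1; rewrite oner_neq0 rmorph1 divr1; split=> //.
  by apply: Uimp filterT _ => c _ /=; rewrite meval1; exact: pfrac1.
Qed.

(** Extending the place from rational functions to [K] adds no rational function: if [x] were new,
    then [x^-1 / p] would be in the old ring, and multiplying by [x] would put [p^-1] into the new
    one. *)
Lemma valring_near : exists O : subringClosed K,
  [/\ forall x, x \in O \/ x^-1 \in O,
      forall P, ev P \in O,
      forall Q, ~~ (p %| Q.@[c0])%Z -> (ev Q)^-1 \in O,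
      p%:R^-1 \notin O &
      (forall x, ratfun x -> x \in O -> exists n : nat, (x - n%:R) / p%:R \in O) /\
      (forall e, ~~ (N %| e.@[c0])%Z -> ev e / p%:R ^+ m.+1 \notin O)].
Proof.
have pK : p%:R != 0 :> K by rewrite pnatr_eq0 -lt0n prime_gt0.
have [O1 [evO invO npO valO [resO nO]]] := place_subring.
have [O [sO npO' vO]] := dominating_valring pK (rpred_nat O1 p) npO.
have OO1 x : ratfun x -> x \in O -> x \in O1.
  move=> rx xO; have [//|xO1] := valO _ rx.
  have [->|x0] := eqVneq x 0; first exact: rpred0.
  case/negP: npO'; have := rpredM xO (sO _ xO1).
  by rewrite mulrA divff ?mul1r.
exists O; split=> //; first by move=> P; apply: sO.
  by move=> Q /invO /sO.
split=> [x rx /(OO1 _ rx)/resO[n hn]|e /nO]; first by exists n; apply: sO.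
apply: contra; apply: OO1; exists e, (p%:R ^+ m.+1).
split; last by rewrite rmorphXn /= rmorph_nat.
rewrite expf_neq0 //; apply: contra_neq pK => e0.
by rewrite -(rmorph_nat (mmap (intr : int -> K) t)) e0 rmorph0.
Qed.

End PlaceOnRationalFunctions.

(** * Finite extensions and good reduction *)

Lemma divring_closed_pack (K : fieldType) (S : {pred K}) :
  divring_closed S -> exists F : divringClosed K, F =i S.
Proof.
move=> h.
pose i := GRing.isDivringClosed.Build K S h.
pose F : divringClosed K := HB.pack_for (divringClosed K) S i.
by exists F.
Qed.

Section FiniteSpan.
Variables (K : fieldType) (F : divringClosed K).

(** Gaussian elimination on the first column; the coefficient [q] of the pivot row is then forced by
    that column. All divisions stay in [F]. *)
Lemma linear_dependence D n (c : 'I_n -> 'I_D -> K) :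
  (D < n)%N -> (forall i j, c i j \in F) ->
  exists r : 'I_n -> K, [/\ forall i, r i \in F, exists k, r k != 0 &
    forall j, \sum_i r i * c i j = 0].
Proof.
elim: D n c => [|D IHD] [//|n] c Dn cF.
  exists (fun=> 1); split=> [i||[]//]; first exact: rpred1.
  by exists ord0; rewrite oner_neq0.
have [/existsP[i0 ci0]|] := boolP [exists i, c i ord0 != 0]; last first.
  rewrite negb_exists => /forallP c0.
  have [|r [rF rn0 r0]] := IHD _ (fun i j => c i (lift ord0 j)) (ltnW Dn); first by [].
  exists r; split=> // j; have [j' ->|->] := unliftP ord0 j; first exact: r0.
  by rewrite big1 // => i _; move: (c0 i); rewrite negbK => /eqP->; rewrite mulr0.
pose c' (i : 'I_n) (j : 'I_D) :=
  c (lift i0 i) (lift ord0 j) - c (lift i0 i) ord0 / c i0 ord0 * c i0 (lift ord0 j).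
have [|i j|r [rF [k rk] r0]] := IHD n c'; first by [].
  by rewrite rpredB ?rpredM ?rpredV.
pose q := - \sum_i r i * (c (lift i0 i) ord0 / c i0 ord0).
have qF : q \in F by rewrite rpredN rpred_sum // => i _; rewrite !rpredM ?rpredV.
exists (fun i => oapp r q (unlift i0 i)); split=> [i||j].
- by case: (unlift i0 i) => [i'|] /=.
- by exists (lift i0 k); rewrite liftK.
rewrite (bigD1_ord i0) //= unlift_none /=.
under eq_bigr do rewrite liftK /=.
have [j' ->|->] := unliftP ord0 j; last first.
  rewrite /q mulNr mulr_suml addrC -sumrB big1 // => i _.
  by rewrite -!mulrA mulVf // mulr1 subrr.
rewrite -[RHS](r0 j') /q mulNr mulr_suml addrC -sumrB; apply: eq_bigr => i _.
by rewrite /c' mulrBr !mulrA.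
Qed.

Definition span (I : finType) (w : I -> K) : {pred K} :=
  [pred x | `[< exists2 c : I -> K, forall i, c i \in F & x = \sum_i c i * w i >]].

Lemma spanP (I : finType) (w : I -> K) x :
  reflect (exists2 c : I -> K, forall i, c i \in F & x = \sum_i c i * w i)
          (x \in span w).
Proof. exact: asboolP. Qed.

Lemma span_zmod (I : finType) (w : I -> K) : zmod_closed (span w).
Proof.
split=> [|_ _ /spanP[c cF ->] /spanP[d dF ->]]; apply/spanP.
  by exists (fun=> 0) => [i|]; rewrite ?rpred0 // big1 // => i _; rewrite mul0r.
exists (fun i => c i - d i) => [i|]; first by rewrite rpredB.
by rewrite -sumrB; apply: eq_bigr => i _; rewrite mulrBl.
Qed.

HB.instance Definition _ (I : finType) (w : I -> K) :=
  GRing.isZmodClosed.Build K (span w) (span_zmod w).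

Lemma span_scale (I : finType) (w : I -> K) b x :
  b \in F -> x \in span w -> b * x \in span w.
Proof.
move=> bF /spanP[c cF ->]; apply/spanP; exists (fun i => b * c i) => [i|].
  by rewrite rpredM.
by rewrite mulr_sumr; apply: eq_bigr => i _; rewrite mulrA.
Qed.

Lemma span_dependence (I : finType) (w : I -> K) n (x : 'I_n -> K) :
  (#|I| < n)%N -> (forall i, x i \in span w) ->
  exists r : 'I_n -> K, [/\ forall i, r i \in F, exists k, r k != 0 &
    \sum_i r i * x i = 0].
Proof.
move=> In xw; have /choice[c cP] : forall i, exists c : I -> K,
    (forall i, c i \in F) /\ x i = \sum_i c i * w i.
  by move=> i; have /spanP[c cF e] := xw i; exists c.
have [|r [rF rk r0]] := @linear_dependence _ _ (fun i j => c i (enum_val j)) In.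
  by move=> i j; case: (cP i).
exists r; split=> //.
under eq_bigr do rewrite (proj2 (cP _)) mulr_sumr.
rewrite exchange_big /= (reindex _ (onW_bij _ (@enum_val_bij I))) /= big1 // => j _.
by under eq_bigr do rewrite mulrA; rewrite -mulr_suml r0 mul0r.
Qed.

Definition algebraic_over (x : K) : Prop :=
  exists2 g : {poly K}, g \is a polyOver F & g != 0 /\ root g x.

(** The products [w i * x ^ k] with [k] below the degree [e] of a monic equation of [x] span a ring,
    because the equation rewrites [x ^ e]. Keeping a finite spanning family rather than a field
    degree gives a count, [#|I|], that later bounds residues. *)
Lemma span_adjoin (I : finType) (w : I -> K) x :
  algebraic_over x -> subring_closed (span w) -> 
  exists (J : finType) (v : J -> K),
    [/\ subring_closed (span v), {subset span w <= span v} & x \in span v].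
Proof.
move=> [g0 g0F [g00 rg0]] wsub; have [W WE] := subring_closed_pack wsub.
pose g := (lead_coef g0)^-1 *: g0.
have gF : g \is a polyOver F by rewrite polyOverZ ?rpredV ?(polyOverP g0F).
have gm : g \is monic by rewrite monicE lead_coefZ mulVf ?lead_coef_eq0.
have rg : root g x by rewrite rootZ ?invr_eq0 ?lead_coef_eq0.
set e := (size g).-1.
have se : size g = e.+1 by rewrite prednK // size_poly_gt0 monic_neq0.
have e0 : (0 < e)%N.
  rewrite lt0n; apply: contraTneq rg => e0.
  have /size_poly1P[c c0 ->] : size g == 1%N by rewrite se e0.
  by rewrite rootC.
have xe : x ^+ e = - \sum_(k < e) g`_k * x ^+ k.
  apply/eqP; rewrite -addr_eq0 addrC; move/rootP: rg.
  rewrite horner_coef se big_ord_recr /=.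
  have -> : g`_e = 1 by move: gm; rewrite monicE /lead_coef => /eqP.
  by rewrite mul1r => ->.
pose v (j : I * 'I_e) := w j.1 * x ^+ j.2.
have spanv y : reflect (exists2 z : 'I_e -> K, forall k, z k \in W & y = \sum_k z k * x ^+ k)
                 (y \in span v).
  apply: (iffP (spanP _ _)) => [[c cF ->]|[z zW ->]].
    exists (fun k => \sum_i c (i, k) * w i) => [k|].
      by rewrite WE; apply/spanP; exists (fun i => c (i, k)).
    rewrite (eq_bigr (fun k => \sum_i c (i, k) * v (i, k))); last first.
      by move=> k _; rewrite mulr_suml; apply: eq_bigr => i _; rewrite mulrA.
    by rewrite exchange_big pair_bigA /=; apply: eq_bigr => -[].
  have /choice[c cP] : forall k, exists c : I -> K,
      (forall i, c i \in F) /\ z k = \sum_i c i * w i.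
    by move=> k; have := zW k; rewrite WE => /spanP[c cF e']; exists c.
  exists (fun j => c j.2 j.1) => [j|]; first by case: (cP j.2).
  rewrite -(pair_bigA _ (fun i k => c k i * (w i * x ^+ k))) /= exchange_big.
  apply: eq_bigr => k _; rewrite (proj2 (cP k)) mulr_suml.
  by apply: eq_bigr => i _; rewrite mulrA.
have Wspan z k : z \in W -> (k < e)%N -> z * x ^+ k \in span v.
  move=> zW ke; apply/spanv; exists (fun i => if i == Ordinal ke then z else 0) => [i|].
    by case: ifP => // _; rewrite rpred0.
  rewrite (bigD1 (Ordinal ke)) //= eqxx big1 ?addr0 // => i /negbTE->.
  by rewrite mul0r.
have FW b : b \in F -> b \in W.
  have := rpred1 W; rewrite !WE => W1 bF.
  by rewrite -[b]mulr1 span_scale.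
have powW k z : z \in W -> z * x ^+ k \in span v.
  elim: k z => [|k IHk] z zW; first exact: Wspan.
  have /spanv[y yW ykE] := IHk _ zW.
  rewrite exprSr mulrA ykE mulr_suml rpred_sum // => i _.
  rewrite -mulrA -exprSr; have [ie|ei] := ltnP i.+1 e; first exact: Wspan.
  have -> : i.+1 = e by have := ltn_ord i; lia.
  rewrite xe mulrN rpredN mulr_sumr rpred_sum // => j _.
  by rewrite mulrA Wspan // rpredM // FW // (polyOverP gF).
exists (I * 'I_e)%type, v; split=> [|y yw|]; first last.
- by rewrite -[x]mul1r -[X in _ * X]expr1 powW ?rpred1.
- by rewrite -[y]mulr1 -(expr0 x) powW // WE.
split; first by rewrite -[1]mulr1 -[X in _ * X](expr0 x) powW ?rpred1.
  exact: rpredB.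
move=> y z /spanv[y' y'W ->] /spanv[z' z'W ->].
rewrite mulr_suml rpred_sum // => i _; rewrite mulr_sumr rpred_sum // => j _.
by rewrite mulrACA -exprD powW ?rpredM.
Qed.

Lemma algebraic_span (a : seq K) : (forall x, x \in a -> algebraic_over x) ->
  exists (J : finType) (v : J -> K),
    [/\ subring_closed (span v), {subset F <= span v} & {subset a <= span v}].
Proof.
elim: a => [|x a IHa] alg.
  have spanF : span (fun _ : unit => 1) =i F.
    move=> y; apply/spanP/idP => [[c cF ->]|yF].
      by rewrite rpred_sum // => i _; rewrite mulr1.
    by exists (fun=> y) => //; rewrite big_const card_unit /= addr0 mulr1.
  exists unit, (fun=> 1); split=> // [|y]; last by rewrite spanF.
  by split=> [|y z|y z]; rewrite !spanF; [exact: rpred1|exact: rpredB|exact: rpredM].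
have [|J [v [vs Fv av]]] := IHa; first by move=> y ya; apply: alg; rewrite inE ya orbT.
have [J' [v' [vs' Fv' xv']]] := span_adjoin (alg x (mem_head _ _)) vs.
exists J', v'; split=> // y; first by move=> /Fv /Fv'.
by rewrite inE => /orP[/eqP->|/av /Fv'].
Qed.

End FiniteSpan.

(** * Units, integrality and residues modulo p in a valuation ring *)

Section ValuationRing.
Variables (K : fieldType) (O : subringClosed K).
Hypothesis valO : forall x, x \in O \/ x^-1 \in O.

(** If [x] is outside, [x^-1] is inside, and dividing the equation by [x ^ n] writes [x] through
    powers of [x^-1]. An invertible leading coefficient does the work of a monic equation. *)
Lemma valring_integral (g : {poly K}) x :
  g \is a polyOver O -> g != 0 -> (lead_coef g)^-1 \in O -> root g x -> x \in O.
Proof.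
move=> gO g0 lO rg; apply: contraT => xO.
have x0 : x != 0 by apply: contraNneq xO => ->; exact: rpred0.
have yO : x^-1 \in O by case: (valO x) xO => // ->.
have l0 : lead_coef g != 0 by rewrite lead_coef_eq0.
case E: (size g) => [|[|n]].
- by move/eqP: E; rewrite size_poly_eq0 (negbTE g0).
- by move: rg l0; rewrite /root horner_coef E big_ord1 mulr1 lead_coefE E => ->.
case/negP: xO; suff -> : x = - ((lead_coef g)^-1 * \sum_(i < n.+1) g`_i * x^-1 ^+ (n - i)).
  by rewrite rpredN rpredM // rpred_sum // => i _; rewrite rpredM ?rpredX ?(polyOverP gO).
apply: (mulfI l0); rewrite mulrN mulrA divff // mul1r.
have xn0 : x ^+ n != 0 by rewrite expf_neq0.
apply: (mulIf xn0); apply/eqP; rewrite mulNr -addr_eq0 addrC.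
move: rg; rewrite /root horner_coef E big_ord_recr /= lead_coefE E /= -mulrA -exprS.
congr (_ + _ == 0); rewrite mulr_suml; apply: eq_bigr => i _.
rewrite -mulrA exprVn; congr (_ * _).
have le_in : (i <= n)%N by rewrite -ltnS.
by rewrite mulrC -expfB_cond ?(negbTE x0) ?add0n ?leq_subr // subKn.
Qed.

Lemma valring_max (s : seq K) : s != [::] -> (forall x, x \in s -> x != 0) ->
  exists2 y, y \in s & forall x, x \in s -> x / y \in O.
Proof.
elim: s => // x s IHs _ s0; have [->|s1] := eqVneq s [::].
  exists x; first exact: mem_head.
  by move=> z; rewrite inE => /eqP->; rewrite divff ?rpred1 // s0 ?mem_head.
have [|y ys yP] := IHs s1; first by move=> z zs; rewrite s0 // inE zs orbT.
have y0 : y != 0 by rewrite s0 // inE ys orbT.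
have x0 : x != 0 by rewrite s0 // mem_head.
have [xy|yx] := valO (x / y).
  by exists y => [|z]; rewrite inE ?ys ?orbT // => /orP[/eqP->|/yP].
exists x; first exact: mem_head.
move=> z; rewrite inE => /orP[/eqP->|/yP zy]; first by rewrite divff ?rpred1.
have -> : z / x = (z / y) * (x / y)^-1 by field; rewrite x0 y0.
exact: rpredM.
Qed.

Variable p : nat.
Hypothesis pp : prime p.
Hypothesis pO : p%:R^-1 \notin O.
Hypothesis pK : p%:R != 0 :> K.

Lemma valring_divp_int (z : int) : z%:~R / p%:R \in O -> (p %| z)%Z.
Proof.
apply: contraLR => pz; apply: contra pO => zO.
have [k [l]] := Bezoutz p z.
have -> : gcdz p z = 1.
  by apply/eqP; rewrite -/(coprimez _ _) coprimezE prime_coprime // -[X in (X %| _)%N]/(`|p%:Z|%N) -dvdzE.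
move=> e; have -> : p%:R^-1 = k%:~R + l%:~R * (z%:~R / p%:R) :> K.
  apply: (mulIf pK); rewrite mulVf // mulrDl -(mulrA l%:~R) mulfVK //.
  by rewrite -[p%:R]/(p%:~R) -!intrM -intrD e.
by apply: rpredD; last apply: rpredM zO; exact: rpred_int.
Qed.

Variables (F : divringClosed K) (I : finType) (w : I -> K).
Hypothesis FO : forall x, x \in F -> x \in O -> exists n : nat, (x - n%:R) / p%:R \in O.
Hypothesis spanring : subring_closed (span F w).

(** Dividing a linear relation over [F] by its coefficient of least valuation puts all coefficients
    in [O] and makes one of them 1; each is then congruent to a natural number, since [F] has prime
    residue field. *)
Lemma valring_residue_dependence n (x : 'I_n -> K) :
  (#|I| < n)%N -> (forall i, x i \in O /\ x i \in span F w) ->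
  exists c : 'I_n -> int, (\sum_i (c i)%:~R * x i) / p%:R \in O /\ exists k, c k = 1.
Proof.
move=> In xO; have [r [rF [k0 rk0] r0]] := span_dependence In (fun i => proj2 (xO i)).
have [k rk rkO] : exists2 k, r k != 0 & forall i, r i != 0 -> r i / r k \in O.
  have [y] : exists2 y, y \in [seq r i | i <- enum 'I_n & r i != 0] &
      forall x, x \in [seq r i | i <- enum 'I_n & r i != 0] -> x / y \in O.
    apply: valring_max => [|y /mapP[i + ->]]; last by rewrite mem_filter => /andP[].
    suff : r k0 \in [seq r i | i <- enum 'I_n & r i != 0] by case: [seq _ | _ <- _ & _].
    by rewrite map_f // mem_filter rk0 mem_enum.
  case/mapP=> k; rewrite mem_filter => /andP[rk _] -> {y} rkO.
  by exists k => // i ri; apply: rkO; rewrite map_f // mem_filter ri mem_enum.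
have rO i : r i / r k \in O.
  have [->|ri] := eqVneq (r i) 0; first by rewrite mul0r rpred0.
  exact: rkO.
have /choice[m mP] : forall i, exists m : nat, (r i / r k - m%:R) / p%:R \in O.
  by move=> i; apply: FO; rewrite ?rpred_div.
exists (fun i => if i == k then 1 else (m i)%:Z); split; last by exists k; rewrite eqxx.
have -> : (\sum_i (if i == k then 1 else (m i)%:Z)%:~R * x i) / p%:R =
   - \sum_i (if i == k then 0 else (r i / r k - (m i)%:R) / p%:R) * x i.
  transitivity ((\sum_i (if i == k then 1 else (m i)%:Z)%:~R * x i - (\sum_i r i * x i) / r k) / p%:R).
    by rewrite r0 mul0r subr0.
  rewrite [(\sum_i r i * x i) / _]mulr_suml -sumrB mulr_suml -sumrN.
  apply: eq_bigr => i _; case: eqP => [->|_]; field; rewrite ?pK ?rk //.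
rewrite rpredN rpred_sum // => i _; rewrite rpredM //; last by case: (xO i).
by case: eqP => _; rewrite ?rpred0.
Qed.

(** The residues of the span form a vector space over the prime field of dimension at most [#|I|];
    [chi] records coordinates in a maximal independent family. A colouring stands in for the
    quotient ring, and its number of colours does not mention [O]. *)
Lemma valring_coloring : exists chi : K -> 'I_(p ^ #|I|),
  forall x y, x \in O -> x \in span F w -> y \in O -> y \in span F w ->
    chi x = chi y <-> (x - y) / p%:R \in O.
Proof.
have [W WE] := subring_closed_pack spanring.
pose indep n := `[< exists x : 'I_n -> K, (forall i, x i \in O /\ x i \in span F w) /\
  forall c : 'I_n -> int, (\sum_i (c i)%:~R * x i) / p%:R \in O -> forall i, (p %| c i)%Z >].
have indep0 : indep 0%N by apply/asboolP; exists (fun=> 0); split=> [[]|c _ []].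
have indepD n : indep n -> (n <= #|I|)%N.
  move=> /asboolP[x [xO xi]]; rewrite leqNgt; apply/negP => In.
  have [c [/xi cO [k ck]]] := valring_residue_dependence In xO.
  by have := cO k; rewrite ck dvdzE /= dvdn1 => /eqP p1; have := prime_gt1 pp; rewrite p1.
have exP : exists n, indep n by exists 0%N.
have [e /asboolP[x [xO xi]] emax] := ex_maxnP exP indepD.
have eD : (e <= #|I|)%N by apply: indepD; apply/asboolP; exists x.
have repr y : y \in O -> y \in span F w -> exists f : {ffun 'I_e -> 'I_p},
    (y - \sum_i (f i)%:R * x i) / p%:R \in O.
  move=> yO yw.
  pose x' (i : 'I_e.+1) := oapp x y (unlift ord0 i).
  have sumx' (c : 'I_e.+1 -> int) : \sum_i (c i)%:~R * x' i =
      (c ord0)%:~R * y + \sum_i (c (lift ord0 i))%:~R * x i.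
    rewrite big_ord_recl /x' unlift_none; congr (_ + _).
    by apply: eq_bigr => i _; rewrite liftK.
  have : ~ indep e.+1 by move=> /emax; rewrite ltnn.
  move=> ni; have [c [cO [i0 ci0]]] : exists c : 'I_e.+1 -> int,
      (\sum_i (c i)%:~R * x' i) / p%:R \in O /\ exists i, ~~ (p %| c i)%Z.
    apply: contrapT => nc; apply: ni; apply/asboolP; exists x'; split=> [i|c cO i].
      by rewrite /x'; case: (unlift ord0 i).
    by apply: contrapT => /negP ci; apply: nc; exists c; split=> //; exists i.
  rewrite sumx' in cO.
  (* The new element must occur with a coefficient prime to [p]; otherwise the relation would be one
     among the independent [x i]. *)
  have c0 : ~~ (p %| c ord0)%Z.
    apply/negP => c0; have c'O : (\sum_i (c (lift ord0 i))%:~R * x i) / p%:R \in O.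
      have /dvdzP[q qE] := c0.
      rewrite -[X in X / _](addKr ((c ord0)%:~R * y)) mulrDl rpredD // qE mulNr rpredN.
      by rewrite intrM mulrAC -[p%:~R]/(p%:R) mulfK // rpredM ?rpred_int.
    by have [j e'|e'] := unliftP ord0 i0; rewrite e' ?c0 ?(xi _ c'O) in ci0.
  have [k [l]] := Bezoutz p (c ord0).
  have -> : gcdz p (c ord0) = 1.
    by apply/eqP; rewrite -/(coprimez _ _) coprimezE prime_coprime // -[X in (X %| _)%N]/(`|p%:Z|%N) -dvdzE.
  move=> kl; pose d i := - (l * c (lift ord0 i)).
  have p0 : p%:Z != 0 by rewrite -lt0n prime_gt0.
  have nlt z : (`|(z %% p%:Z)%Z| < p)%N.
    by have := modz_ge0 z p0; have := ltz_mod z p0; lia.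
  exists [ffun i => Ordinal (nlt (d i))].
  have -> : (y - \sum_i ([ffun i => Ordinal (nlt (d i))] i)%:R * x i) / p%:R =
     k%:~R * y + l%:~R * (((c ord0)%:~R * y + \sum_i (c (lift ord0 i))%:~R * x i) / p%:R)
     + \sum_i (d i %/ p)%Z%:~R * x i.
    have sumf : \sum_i ([ffun i => Ordinal (nlt (d i))] i)%:R * x i =
        - (l%:~R * \sum_i (c (lift ord0 i))%:~R * x i) - (\sum_i (d i %/ p)%Z%:~R * x i) * p%:R.
      rewrite mulr_sumr mulr_suml -sumrN -sumrB; apply: eq_bigr => i _.
      rewrite ffunE /= -[(`|_|%N)%:R]/((`|(d i %% p%:Z)%Z|%N%:Z)%:~R) gez0_abs ?modz_ge0 //.
      have -> : (d i %% p)%Z = d i - (d i %/ p)%Z * p.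
        by rewrite [X in _ = X - _](divz_eq (d i) p) addrAC subrr add0r.
      by rewrite rmorphB rmorphM /= /d rmorphN rmorphM /= -[p%:~R]/(p%:R); ring.
    have kl' : k%:~R * p%:R + l%:~R * (c ord0)%:~R = 1 :> K.
      by rewrite -[p%:R]/(p%:~R) -!intrM -intrD kl.
    apply: (mulIf pK); rewrite mulfVK // sumf mulrDl mulrDl -(mulrA l%:~R) mulfVK //.
    have yE : y = (k%:~R * p%:R + l%:~R * (c ord0)%:~R) * y by rewrite kl' mul1r.
    by rewrite [y in LHS]yE; ring.
  apply: rpredD; last first.
    by apply: rpred_sum => i _; apply: rpredM; [exact: rpred_int|case: (xO i)].
  by apply: rpredD; apply: rpredM => //; exact: rpred_int.
pose dist (f : {ffun 'I_e -> 'I_p}) y := (y - \sum_i (f i)%:R * x i) / p%:R \in O.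
have p_gt0 : (0 < p)%N by rewrite prime_gt0.
pose f0 : {ffun 'I_e -> 'I_p} := [ffun=> Ordinal p_gt0].
have funiq f g y z : dist f y -> dist g z -> (y - z) / p%:R \in O -> f = g.
  move=> fy gz yz; apply/ffunP => i.
  have : (\sum_i ((f i)%:Z - (g i)%:Z)%:~R * x i) / p%:R \in O.
    have -> : (\sum_i ((f i)%:Z - (g i)%:Z)%:~R * x i) / p%:R =
       (y - z) / p%:R - (y - \sum_i (f i)%:R * x i) / p%:R + (z - \sum_i (g i)%:R * x i) / p%:R.
      have -> : \sum_i ((f i)%:Z - (g i)%:Z)%:~R * x i = \sum_i (f i)%:R * x i - \sum_i (g i)%:R * x i.
        by rewrite -sumrB; apply: eq_bigr => j _; rewrite intrB mulrBl.
      by field.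
    by rewrite rpredD ?rpredB.
  move=> /xi/(_ i); rewrite -eqz_mod_dvd !modz_small ?lez_nat ?ltz_nat ?ltn_ord //.
  move=> /eqP [e']; exact: val_inj.
have cardff : (#|{ffun 'I_e -> 'I_p}| <= p ^ #|I|)%N.
  by rewrite card_ffun !card_ord leq_pexp2l.
(* [f0] is only the default where no coordinates exist, which does not happen on the elements that
   the claim concerns. *)
pose phi y : {ffun 'I_e -> 'I_p} := xget f0 [set f | dist f y].
have phiP y : y \in O -> y \in span F w -> dist (phi y) y.
  by move=> yO yw; have [f fy] := repr _ yO yw; rewrite /phi; case: xgetP => // /(_ f).
exists (fun y => widen_ord cardff (enum_rank (phi y))) => y z yO yw zO zw.
split=> [/(congr1 val)/= /val_inj/enum_rank_inj e'|yz].
  have -> : (y - z) / p%:R = (y - \sum_i (phi y i)%:R * x i) / p%:R - (z - \sum_i (phi z i)%:R * x i) / p%:R.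
    by rewrite e' -mulrBl opprB addrA subrK.
  by apply: rpredB; exact: phiP.
by congr widen_ord; congr enum_rank; apply: funiq yz; apply: phiP.
Qed.

End ValuationRing.

(** * Transcendence bases and the choice of the prime and of the place *)

Section Reduction.
Variable K : numFieldType.

Definition alg_free s (t : 'I_s -> K) : Prop :=
  forall P : {mpoly int[s]}, mmap (intr : int -> K) t P = 0 -> P = 0.

(** A free family drawn from [a] of the largest possible length; freeness makes it injective, so the
    length is bounded. Appending any [x] of [a] creates a relation, which is read as a polynomial in
    the last variable. *)
Lemma transcendence_basis (a : seq K) :
  exists s (t : 'I_s -> K), alg_free t /\
    forall x, x \in a -> exists2 g : {poly {mpoly int[s]}},
      g != 0 & root (map_poly (mmap (intr : int -> K) t) g) x.
Proof.
pose good s := `[< exists t : 'I_s -> K, (forall i, t i \in a) /\ alg_free t >].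
have good0 : good 0%N.
  apply/asboolP; exists (fun=> 0); split=> [[]//|P].
  rewrite [P]nvar0_mpolyC mmapC => /eqP.
  by rewrite intr_eq0 => /eqP->; rewrite mpolyC0.
have goodb s : good s -> (s <= size a)%N.
  move=> /asboolP[t [ta tf]].
  rewrite -[s]size_enum_ord -(size_map t); apply: uniq_leq_size; last first.
    by move=> _ /mapP[i _ ->].
  rewrite map_inj_uniq ?enum_uniq // => i j tij.
  have /eqP : 'X_i - 'X_j = 0 :> {mpoly int[s]}.
    by apply: tf; rewrite rmorphB /= !mmapX !mmap1U tij subrr.
  rewrite subr_eq0 => /eqP /(congr1 (mcoeff U_(i)%MM)).
  rewrite !mcoeffX eqxx; case: eqP => // e _.
  by apply/eqP; rewrite eq_sym -eq_mnm1 e.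
have exP : exists s, good s by exists 0%N.
have [s /asboolP[t [ta tf]] smax] := ex_maxnP exP goodb.
exists s, t; split=> // x xa.
pose t' (i : 'I_s.+1) := oapp t x (unlift ord_max i).
have [P [P0 Pt]] : exists P : {mpoly int[s.+1]}, P != 0 /\ mmap (intr : int -> K) t' P = 0.
  apply: contrapT => nP; suff /smax : good s.+1 by rewrite ltnn.
  apply/asboolP; exists t'; split=> [i|P Pt].
    by rewrite /t'; case: (unlift _ i).
  by apply: contrapT => /eqP P0; apply: nP; exists P.
exists (muni P); first by rewrite -(raddf0 (@muni s _)) (inj_eq (@muni_inj _ _)).
rewrite /root; move: Pt; rewrite mmap_muni /t' unlift_none /= => Pt.
rewrite -[X in _ == X]Pt; apply/eqP; congr (_.[_]).
apply: eq_map_poly => q; congr mmap; apply/funext => i /=.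
rewrite (_ : widen_ord _ i = lift ord_max i) ?liftK //.
by apply: val_inj; rewrite [RHS]lift_max.
Qed.

Section RationalFunctions.
Variables (s : nat) (t : 'I_s -> K).
Hypothesis tfree : alg_free t.
Notation ev P := (mmap (intr : int -> K) t P).

Lemma ratfun_divring_closed : divring_closed [pred x | `[< ratfun t x >]].
Proof.
split=> [|x y /asboolP[P [Q [Q0 ->]]] /asboolP[P' [Q' [Q'0 ->]]]|
          x y /asboolP[P [Q [Q0 ->]]] /asboolP[P' [Q' [Q'0 ->]]]]; apply/asboolP.
- by exists 1, 1; rewrite oner_neq0 rmorph1 divr1.
- exists (P * Q' - P' * Q), (Q * Q'); rewrite mulf_neq0 //; split=> //.
  rewrite rmorphB !rmorphM /=; field.
  by rewrite !(ev_neq0 tfree).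
- have [->|P'0] := eqVneq P' 0.
    by exists 0, 1; rewrite oner_neq0 rmorph0 !mul0r invr0 mulr0.
  exists (P * Q'), (Q * P'); rewrite mulf_neq0 //; split=> //.
  by rewrite !rmorphM /= invf_div mulf_div.
Qed.

Lemma ratfun_common_denominator n (r : 'I_n -> K) : (forall i, ratfun t (r i)) ->
  exists2 S, S != 0 & forall i, exists P, ev S * r i = ev P.
Proof.
move=> /choice[P /choice[Q PQ]]; exists (\prod_i Q i).
  by apply/prodf_neq0 => i _; case: (PQ i).
move=> i; exists (P i * \prod_(j | j != i) Q j).
have [Qi ->] := PQ i; rewrite (bigD1 i) //= !rmorphM /=.
by rewrite mulrC mulrA mulfVK ?(ev_neq0 tfree).
Qed.

End RationalFunctions.

(** Cancelling powers of [f] from its equation leaves a nonzero constant term, a multiple of [f]. A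
    bound on how often [p] divides this coefficient therefore bounds the same for [f]. *)
Lemma lowest_coef (T : K -> Prop) (h : {poly K}) f :
  f != 0 -> h != 0 -> (forall i, T h`_i) -> root h f ->
  exists e (q : {poly K}), [/\ e != 0, T e, forall i, T q`_i & e = - (f * q.[f])].
Proof.
move=> f0; elim/poly_ind: h => [|h c IHh]; first by rewrite eqxx.
have [->|c0] := eqVneq c 0.
  rewrite addr0 => h0 Th rh; apply: IHh.
  - by apply: contra_neq h0 => ->; rewrite mul0r.
  - by move=> i; have := Th i.+1; rewrite coefMX.
  - by move: rh; rewrite /root hornerMX mulf_eq0 (negbTE f0) orbF.
move=> _ Th rh; exists c, h; split=> // [|i|].
- by have := Th 0%N; rewrite coefD coefMX coefC add0r.
- by have := Th i.+1; rewrite coefD coefMX coefC addr0.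
- by move: rh; rewrite /root hornerD hornerMX hornerC mulrC addrC addr_eq0 => /eqP.
Qed.

(** Phrased as membership in every subring containing [a], so that integrality in a ring constructed
    later is a mere instantiation. *)
Definition subring_gen (a : seq K) (x : K) : Prop :=
  forall S : subringClosed K, {subset a <= S} -> x \in S.

(** [p] is chosen once, to avoid the leading coefficients of the equations of [a] at one integer
    point [c0]. For each [f] only the point moves: to some [c] congruent to [c0] modulo [p] at which
    a nonzero multiple [e] of [f] in the polynomial ring has a nonzero value. The integer [e(c)]
    then limits the powers of [p] dividing [f]. *)
Lemma good_reduction (a : seq K) : exists (B : nat) (L : subringClosed K) (p : nat),
  [/\ prime p, (2 < p)%N, {subset a <= L}, p%:R^-1 \in L &
  forall f, subring_gen a f -> f != 0 ->
  exists (O : subringClosed K) (chi : K -> 'I_B),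
  [/\ {subset a <= O}, forall x, x \in O \/ x^-1 \in O, p%:R^-1 \notin O,
      forall x y, x \in O -> x \in L -> y \in O -> y \in L ->
        chi x = chi y <-> (x - y) / p%:R \in O &
      exists j, f / p%:R ^+ j \notin O]].
Proof.
have [s [t [tf ta]]] := transcendence_basis a.
set ev := mmap (intr : int -> K) t in ta.
have [F FE] := divring_closed_pack (ratfun_divring_closed tf).
have Frat x : x \in F -> ratfun t x by rewrite FE => /asboolP.
have ratF x : ratfun t x -> x \in F by rewrite FE => ?; apply/asboolP.
have evF P : ev P \in F.
  by apply: ratF; exists P, 1; rewrite oner_neq0 rmorph1 divr1.
have ev0 P : P != 0 -> ev P != 0 by exact: ev_neq0.
have aalg x : x \in a -> algebraic_over F x.
  move=> /ta[g g0 rg]; exists (map_poly ev g) => //; last split=> //.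
    by apply/polyOverP => i; rewrite coef_map_id0 ?evF // /ev rmorph0.
  by rewrite map_poly_eq0_id0 ?ev0 ?lead_coef_eq0.
have [I [w [wsub Fw aw]]] := algebraic_span aalg.
have [L LE] := subring_closed_pack wsub.
have /choice[g gP] : forall x, exists g : {poly {mpoly int[s]}},
    x \in a -> g != 0 /\ root (map_poly ev g) x.
  move=> x; have [/ta[g g0 rg]|_] := boolP (x \in a); first by exists g.
  by exists 0.
(* If [p] does not divide the value of [G], every leading coefficient becomes a unit, and the
   elements of [a] become integral over [O]. *)
pose G := \prod_(x <- a) lead_coef (g x).
have G0 : G != 0.
  by rewrite prodf_seq_neq0; apply/allP => x xa /=; rewrite lead_coef_eq0; case: (gP x xa).
have [c0 [_ Gc0]] := mpoly_nonvanishing (fun=> 0) (oner_neq0 int) G0.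
have [p pgt pp] := prime_above (maxn 2 `|G.@[c0]|).
move: pgt; rewrite gtn_max => /andP[p2 pG].
have pGc0 : ~~ (p %| G.@[c0])%Z.
  rewrite dvdzE /=; apply: contraL pG => /dvdn_leq; rewrite absz_gt0 Gc0 -leqNgt.
  by apply.
have pK : p%:R != 0 :> K by rewrite pnatr_eq0 -lt0n prime_gt0.
exists (p ^ #|I|)%N, L, p; split=> // [x xa||f fa f0].
- by rewrite LE aw.
- by rewrite LE Fw // rpredV rpred_nat.
have fL : f \in L by apply: fa => x xa; rewrite LE aw.
(* The first [#|I|.+1] powers of [f] lie in a space spanned by [#|I|] elements. *)
have [r [rF [k rk] r0]] : exists r : 'I_(#|I|.+1) -> K, [/\ forall i, r i \in F,
    exists k, r k != 0 & \sum_i r i * f ^+ i = 0].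
  by apply: (@span_dependence _ _ _ w _ (fun i => f ^+ i)) => // i; rewrite -LE rpredX.
have [S S0 /choice[R RE]] := ratfun_common_denominator tf (fun i => Frat _ (rF i)).
have Rk : R k != 0.
  apply: contra_neq rk => Rk; apply: (mulfI (ev0 _ S0)).
  by rewrite mulr0 [LHS]RE Rk rmorph0.
have R0 : \sum_i ev (R i) * f ^+ i = 0.
  transitivity (ev S * \sum_i r i * f ^+ i); last by rewrite r0 mulr0.
  by rewrite mulr_sumr; apply: eq_bigr => i _; rewrite mulrA RE.
have [x0 [q [e0 [e x0E] qE eE]]] : exists x (q : {poly K}), [/\ x != 0,
    exists P, x = ev P, forall i, exists P, q`_i = ev P & x = - (f * q.[f])].
  apply: (@lowest_coef (fun x => exists P, x = ev P)
                       (\poly_(i < #|I|.+1) ev (R (inord i))) f f0) => [|i|].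
  - apply: contra_neq (ev0 _ Rk) => /(congr1 (fun h : {poly K} => h`_k)).
    by rewrite coef0 coef_poly ltn_ord inord_val.
  - rewrite coef_poly; case: ifP => _; first by eexists.
    by exists 0; rewrite /ev rmorph0.
  - rewrite /root horner_poly; apply/eqP; rewrite -[RHS]R0.
    by apply: eq_bigr => i _; rewrite inord_val.
rewrite {x0}x0E in e0 eE.
have {}e0 : e != 0 by apply: contra_neq e0 => ->; rewrite /ev rmorph0.
have p0 : p%:Z != 0 by rewrite -lt0n prime_gt0.
have [c [cc0 ec]] := mpoly_nonvanishing c0 p0 e0.
have [O [valO evO invO pO [resO nO]]] := valring_near tf `|e.@[c]| c pp.
have aO : {subset a <= O}.
  move=> x xa; have [gx0 rgx] := gP x xa.
  apply: (valring_integral valO _ _ _ rgx).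
  - by apply/polyOverP => i; rewrite coef_map_id0 ?evO // /ev rmorph0.
  - by rewrite map_poly_eq0_id0 ?ev0 ?lead_coef_eq0.
  rewrite lead_coef_map_id0 ?ev0 ?lead_coef_eq0 // ?/ev ?rmorph0 //; apply: invO.
  have : ~~ (p %| G.@[c])%Z.
    apply: contra pGc0 => pGc; rewrite -(subKr G.@[c] G.@[c0]) rpredB //; exact: meval_cong.
  rewrite /G (big_rem x xa) /= mevalM; apply: contra => ?; exact: dvdz_mulr.
have [chi chiP] := valring_coloring valO pp pO pK (fun x xF => resO x (Frat x xF)) wsub.
exists O, chi; split=> // [x y xO xL yO yL|]; first by apply: chiP => //; rewrite -LE.
(* This power of [p] exceeds the absolute value of [e(c)], so it cannot divide it. *)
exists `|e.@[c]|.+1; have /nO : ~~ ((p ^ `|e.@[c]|.+1)%N %| e.@[c])%Z.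
  apply/negP; rewrite dvdzE /= => /dvdn_leq; rewrite absz_gt0 ec => /(_ isT).
  by rewrite leqNgt (ltn_trans _ (ltn_expl _ (prime_gt1 pp))).
apply: contra => fO; rewrite -/ev eE mulNr mulrAC rpredN rpredM //.
apply: rpred_horner; last exact: fa.
by apply/polyOverP => i; have [P ->] := qE i; exact: evO.
Qed.

End Reduction.

(** * p-adic interpolation *)

(** Legendre's formula bounds the exponent by [n / (p - 1)]. This is the reason for an odd [p]: half
    of [n] is left over. The induction carries the tail [n %/ p ^ N] along. *)
Lemma double_logn_fact p n : prime p -> (2 < p)%N -> (2 * logn p n`! <= n)%N.
Proof.
move=> pp p2; rewrite logn_fact //.
suff main N : (2 * (\sum_(1 <= k < N.+1) n %/ p ^ k) + n %/ p ^ N <= n)%N.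
  exact: leq_trans (leq_addr _ _) (main n).
elim: N => [|N IHN]; first by rewrite big_geq // muln0 expn0 divn1.
rewrite big_nat_recr //= expnSr divnMA.
have := leq_trunc_div (n %/ p ^ N) p; move: (n %/ p ^ N)%N IHN => a IHN.
have : (a %/ p * 3 <= a %/ p * p)%N by rewrite leq_mul2l p2 orbT.
lia.
Qed.

Lemma monic_euclid (K : fieldType) (O : subringClosed K) (f m : {poly K}) :
  m \is monic -> m \is a polyOver O -> f \is a polyOver O ->
  exists q r, [/\ q \is a polyOver O, r \is a polyOver O, f = q * m + r &
    (size r < size m)%N].
Proof.
move=> mm mO; have [k] := ubnP (size f); elim: k f => // k IHk f sf fO.
have [sfm|smf] := ltnP (size f) (size m).
  by exists 0, f; rewrite rpred0 mul0r add0r.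
have m0 : (0 < size m)%N by rewrite size_poly_gt0 monic_neq0.
pose a := lead_coef f *: 'X^(size f - size m).
have aO : a \is a polyOver O by rewrite polyOverZ ?rpredX ?polyOverX ?(polyOverP fO).
have [||q [r [qO rO e sr]]] := IHk (f - a * m).
- have f0 : f != 0 by rewrite -size_poly_gt0 (leq_trans m0).
  have sf1 : (size (f - a * m)%R < size f)%N.
    rewrite -[X in (_ < X)%N]prednK ?(leq_trans m0) // ltnS.
    apply/leq_sizeP => j; rewrite leq_eqVlt => /orP[/eqP<-|].
      rewrite coefB /a -scalerAl coefZ coefXnM ltnNge.
      have -> : (size f - size m <= (size f).-1)%N by lia.
      have -> : ((size f).-1 - (size f - size m) = (size m).-1)%N by lia.
      by rewrite /= -!lead_coefE (monicP mm) mulr1 subrr.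
    rewrite prednK ?(leq_trans m0) // => sj.
    rewrite coefB nth_default // /a -scalerAl coefZ coefXnM ltnNge.
    have -> : (size f - size m <= j)%N by lia.
    by rewrite /= nth_default ?mulr0 ?subr0 // -[X in (X <= _)%N](subKn smf) leq_sub2r.
  exact: leq_trans sf1 _.
- by rewrite rpredB ?rpredM.
exists (q + a), r; split; rewrite ?rpredD //.
by rewrite mulrDl addrAC -e subrK.
Qed.

Section Interpolation.
Variables (K : numFieldType) (O : subringClosed K) (p : nat).
Hypothesis valO : forall x, x \in O \/ x^-1 \in O.
Hypotheses (pp : prime p) (p2 : (2 < p)%N) (pO : p%:R^-1 \notin O).

Let pK : p%:R != 0 :> K.
Proof. by rewrite pnatr_eq0 -lt0n prime_gt0. Qed.

(** From [k * p + l * u = 1] follows [u^-1 = k * (p / u) + l], and [p / u] is in [O] because [u / p]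
    is not. *)
Lemma valring_inv_nat u : ~~ (p %| u)%N -> (u%:R : K)^-1 \in O.
Proof.
move=> pu; have u0 : u%:R != 0 :> K by rewrite pnatr_eq0; apply: contraNneq pu => ->; rewrite dvdn0.
have [k [l]] := Bezoutz p u.
have -> : gcdz p u = 1.
  by apply/eqP; rewrite -/(coprimez _ _) coprimezE /= prime_coprime.
move=> kl; have [up|] := valO (u%:R / p%:R).
  by have := @valring_divp_int K O p pp pO pK u up; rewrite dvdzE /= (negbTE pu).
rewrite invf_div => pu'.
have -> : (u%:R : K)^-1 = k%:~R * (p%:R / u%:R) + l%:~R.
  apply: (mulIf u0); rewrite mulVf // mulrDl -mulrA mulfVK //.
  by rewrite -[p%:R]/(p%:~R) -[u%:R]/(u%:~R) -!intrM -intrD kl.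
by apply: rpredD; [apply: rpredM pu'; exact: rpred_int|exact: rpred_int].
Qed.

(** Of the [i] factors [p] in [c], at most half are spent on the factorial, and the other half
    covers [p ^ h]. *)
Lemma divp_fact i h (c : K) : (2 * h <= i)%N -> c / p%:R ^+ i \in O ->
  c / i`!%:R / p%:R ^+ h \in O.
Proof.
move=> hi cO; have := double_logn_fact i pp p2.
have [u pu] := pfactor_coprime pp (fact_gt0 i).
move: (logn _ _) => e fE ei.
have u0 : u%:R != 0 :> K.
  rewrite pnatr_eq0; apply: contraTneq pu => ->; rewrite /coprime gcdn0; apply/eqP.
  by have := prime_gt1 pp; lia.
have [d iE] : exists d, i = (d + e + h)%N by exists (i - e - h)%N; lia.
rewrite fE natrM natrX.
have -> : c / (u%:R * p%:R ^+ e) / p%:R ^+ h = c / p%:R ^+ i * p%:R ^+ d / u%:R.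
  by rewrite iE !exprD; field; rewrite ?expf_neq0 ?pK ?u0.
rewrite rpredM ?valring_inv_nat //; first by rewrite rpredM ?rpredX ?rpred_nat.
by rewrite -prime_coprime.
Qed.

Definition ffpoly i : {poly K} := \prod_(k < i) ('X - k%:R%:P).

Lemma ffpolyE i n : (ffpoly i).[n%:R] = (n ^_ i)%:R.
Proof.
rewrite /ffpoly horner_prod; elim: i => [|i IHi]; first by rewrite big_ord0.
rewrite big_ord_recr /= IHi !hornerE ffactnSr natrM.
have [ni|lt_ni] := leqP i n; first by rewrite natrB.
by rewrite ffact_small ?mul0r.
Qed.

Lemma ffpolyO i : ffpoly i \is a polyOver O.
Proof. by apply: rpred_prod => k _; rewrite polyOverXsubC rpred_nat. Qed.

Lemma size_ffpoly i : size (ffpoly i) = i.+1.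
Proof. by rewrite size_prod_XsubC /index_enum -enumT size_enum_ord. Qed.

(** The interpolating polynomial is cut at degree [2 * h]: the upper part is [p ^ h] times an
    integral [R]. Dividing [R] by the monic polynomial [m] of the zeros leaves [P1 + p ^ h * r], of
    degree below [2 * h] with [2 * h] roots, hence zero. So [P = p ^ h * q * m] with [q]
    integral. *)
Lemma interpolation_zeros (w c : nat -> K) M h (s : seq nat) :
  (forall n, (n <= M)%N -> w n = \sum_(i < M.+1) c i *+ 'C(n, i)) ->
  (forall i, (i <= M)%N -> c i / p%:R ^+ i \in O) ->
  uniq s -> size s = (2 * h)%N -> (forall n, n \in s -> (n <= M)%N /\ w n = 0) ->
  forall n, (n <= M)%N -> w n / p%:R ^+ h \in O.
Proof.
move=> wE cO us ss sw n nM.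
pose P : {poly K} := \sum_(i < M.+1) (c i / i`!%:R) *: ffpoly i.
have PE k : (k <= M)%N -> P.[k%:R] = w k.
  move=> kM; rewrite wE // horner_sum; apply: eq_bigr => i _.
  rewrite hornerZ ffpolyE -bin_ffact natrM -mulrA [_^-1 * _]mulrC mulfK ?mulr_natr //.
  by rewrite pnatr_eq0 -lt0n fact_gt0.
pose m : {poly K} := \prod_(z <- [seq x%:R | x <- s]) ('X - z%:P).
have mm : m \is monic by exact: monic_prod_XsubC.
have mO : m \is a polyOver O.
  by rewrite /m big_map; apply: rpred_prod => x _; rewrite polyOverXsubC rpred_nat.
have sm : size m = (2 * h).+1 by rewrite size_prod_XsubC size_map ss.
pose R : {poly K} := \sum_(i < M.+1 | (2 * h <= i)%N) (c i / i`!%:R / p%:R ^+ h) *: ffpoly i.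
have RO : R \is a polyOver O.
  apply: rpred_sum => i hi; rewrite polyOverZ ?ffpolyO // divp_fact // cO //.
  by rewrite -ltnS.
have [q [r [qO rO RE sr]]] := monic_euclid mm mO RO.
pose P1 : {poly K} := \sum_(i < M.+1 | (i < 2 * h)%N) (c i / i`!%:R) *: ffpoly i.
have PR : P = P1 + p%:R ^+ h *: R.
  rewrite /P (bigID (fun i : 'I_M.+1 => (i < 2 * h)%N)) /=; congr (_ + _).
  rewrite scaler_sumr; apply: eq_big => i; first by rewrite -leqNgt.
  by move=> _; rewrite scalerA [p%:R ^+ h * _]mulrC divfK // expf_neq0.
have T0 : P1 + p%:R ^+ h *: r = 0.
  apply/eqP; apply: contraTT (leqnn (2 * h)) => T0; rewrite -ltnNge.
  have := @max_poly_roots _ _ [seq x%:R | x <- s] T0; rewrite size_map ss => lt_s.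
  apply: leq_trans (lt_s _ _) _.
  - apply/allP => _ /mapP[x xs ->]; have [xM wx] := sw x xs.
    have mx : m.[x%:R] = 0 by apply/eqP; rewrite -/(root _ _) root_prod_XsubC map_f.
    have -> : P1 + p%:R ^+ h *: r = P - p%:R ^+ h *: (q * m).
      by rewrite PR RE scalerDr; ring.
    by rewrite /root hornerD hornerN hornerZ hornerM mx !mulr0 subr0 PE // wx.
  - by rewrite map_inj_uniq // => x y /eqP; rewrite eqr_nat => /eqP.
  rewrite (leq_trans (size_polyD _ _)) // geq_max; apply/andP; split.
    apply: (leq_trans (size_sum _ _ _)); apply/bigmax_leqP => i hi.
    by rewrite (leq_trans (size_scale_leq _ _)) // size_ffpoly.
  by rewrite (leq_trans (size_scale_leq _ _)) // -ltnS -sm.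
have Pq : P = p%:R ^+ h *: (q * m).
  by rewrite PR RE scalerDr addrCA T0 addr0.
rewrite -PE // Pq hornerZ mulrC mulKf ?expf_neq0 //.
by rewrite rpred_horner ?rpredM ?rpred_nat.
Qed.

End Interpolation.

Lemma mpolyOver_meval (K : fieldType) (O : subringClosed K) n (u : {mpoly K[n]}) (v : 'I_n -> K) :
  u \is a mpolyOver n O -> (forall i, v i \in O) -> u.@[v] \in O.
Proof. by move=> uO vO; rewrite rpred_mhorner //; apply/forallP. Qed.

Lemma mpolyOver_comp (K : fieldType) (O : subringClosed K) n k (u : {mpoly K[n]})
    (lq : n.-tuple {mpoly K[k]}) :
  u \is a mpolyOver n O -> (forall i, tnth lq i \is a mpolyOver k O) ->
  u \mPo lq \is a mpolyOver k O.
Proof.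
move=> uO lO; rewrite comp_mpolyEX rpred_sum // => m _.
rewrite mpolyOverZ ?(mpolyOverP _ uO) // comp_mpolyX rpred_prod // => i _.
by rewrite rpredX.
Qed.

(** The binomial expansion of the power of [1 + (T - 1)]. Summing to a fixed [M] changes nothing and
    makes the coefficients independent of [i]. *)
Lemma newton_forward (V : zmodType) (T : V -> V) v i M : (i <= M)%N ->
  {morph T : x y / x - y} ->
  iter i T v = \sum_(k < M.+1) iter k (fun x => T x - x) v *+ 'C(i, k).
Proof.
move=> iM Tm; pose D x := T x - x.
have T0 : T 0 = 0 by rewrite -[X in T X](subrr 0) Tm subrr.
have TN x : T (- x) = - T x by rewrite -[- x]add0r Tm T0 add0r.
have TD x y : T (x + y) = T x + T y by rewrite -[y in LHS]opprK Tm TN opprK.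
have TS n (F : nat -> V) : T (\sum_(k < n) F k) = \sum_(k < n) T (F k).
  by elim: n => [|n IHn]; rewrite ?big_ord0 ?T0 // !big_ord_recr /= TD IHn.
have TMn x n : T (x *+ n) = T x *+ n by elim: n => [|n IHn]; rewrite ?mulr0n ?T0 // !mulrS TD IHn.
have -> : iter i T v = \sum_(k < i.+1) iter k D v *+ 'C(i, k).
  elim: i {iM} => [|i IHi]; first by rewrite big_ord1.
  rewrite iterS IHi (TS _ (fun k => iter k D v *+ 'C(i, k))).
  have TI k : T (iter k D v) = iter k.+1 D v + iter k D v by rewrite iterS [D _]/D subrK.
  under eq_bigr => k _ do rewrite TMn TI mulrnDl.
  rewrite big_split /= [in RHS]big_ord_recl bin0.
  under [X in _ = _ + X]eq_bigr => k _ do rewrite lift0 binS mulrnDr.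
  rewrite [in RHS]big_split /= addrA [RHS]addrC; congr (_ + _).
  rewrite big_ord_recl bin0 [X in _ = _ + X]big_ord_recr /= bin_small // mulr0n addr0.
  by [].
rewrite [RHS](bigID (fun k : 'I_M.+1 => (k < i.+1)%N)) /= [X in _ + X]big1 ?addr0.
  by rewrite (@big_ord_widen _ _ _ i.+1 M.+1 (fun k => iter k D v *+ 'C(i, k))). 
by move=> k; rewrite -leqNgt => ik; rewrite bin_small.
Qed.

Section IdempotentModP.
Variables (K : numFieldType) (O : subringClosed K) (p : nat).
Hypothesis valO : forall x, x \in O \/ x^-1 \in O.
Hypotheses (pp : prime p) (p2 : (2 < p)%N) (pO : p%:R^-1 \notin O).
Variables (n : nat) (H : n.-tuple {mpoly K[n]}).
Hypothesis HO : forall i, tnth H i \is a mpolyOver n O.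
Hypothesis Hidem : forall i,
  p%:R^-1 *: (tnth H i \mPo H - tnth H i) \is a mpolyOver n O.

Let pK : p%:R != 0 :> K.
Proof. by rewrite pnatr_eq0 -lt0n prime_gt0. Qed.

Let T (u : {mpoly K[n]}) := u \mPo H.
Let S (u : {mpoly K[n]}) := T (T u) - T u.

Let TZ a u : T (a *: u) = a *: T u.
Proof. exact: comp_mpolyZ. Qed.
Let TB u v : T (u - v) = T u - T v.
Proof. exact: comp_mpolyB. Qed.
Let TO u : u \is a mpolyOver n O -> T u \is a mpolyOver n O.
Proof. by move=> uO; apply: mpolyOver_comp. Qed.

(** [S] obeys a twisted Leibniz rule, [S (a * b) = S a * T (T b) + T a * S b], so divisibility by
    [p] passes from the variables to all monomials. *)
Lemma idem_step u : u \is a mpolyOver n O -> p%:R^-1 *: S u \is a mpolyOver n O.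
Proof.
move=> uO; rewrite [u]mpolyE.
have SD a b : S (a + b) = S a + S b.
  by rewrite /S /T !comp_mpolyD opprD addrACA.
have SZ a b : S (a *: b) = a *: S b.
  by rewrite /S !TZ scalerBr.
have -> (r : seq 'X_{1..n}) F : S (\sum_(m <- r) F m) = \sum_(m <- r) S (F m).
  elim: r => [|m r IHr]; first by rewrite !big_nil /S /T !comp_mpoly0 subrr.
  by rewrite !big_cons SD IHr.
rewrite scaler_sumr rpred_sum // => m _.
rewrite SZ scalerA mulrC -scalerA mpolyOverZ ?(mpolyOverP _ uO) // {u uO}.
pose good a := a \is a mpolyOver n O /\ p%:R^-1 *: S a \is a mpolyOver n O.
have goodM a b : good a -> good b -> good (a * b).
  move=> [aO Sa] [bO Sb]; split; first by rewrite rpredM.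
  have -> : p%:R^-1 *: S (a * b) = (p%:R^-1 *: S a) * T (T b) + T a * (p%:R^-1 *: S b).
    by rewrite /S /T !rmorphM /= -scalerAl -scalerAr -scalerDr; congr (_ *: _); ring.
  by rewrite rpredD ?rpredM ?TO.
have good1 : good 1.
  by split; [exact: rpred1|rewrite /S /T !rmorph1 subrr scaler0 rpred0].
have goodX i : good 'X_i.
  split; first exact: mpolyOverX.
  by rewrite /S /T comp_mpolyXU -tnth_nth; exact: Hidem.
suff [] : good 'X_[m] by [].
rewrite mpolyXE_id; elim/big_ind: _ => [|a b|i _]; [exact: good1|exact: goodM|].
elim: (m i) => [|k IHk]; first exact: good1.
by rewrite exprS; apply: goodM IHk; exact: goodX.
Qed.

Lemma idem_iter u j : u \is a mpolyOver n O ->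
  (p%:R ^+ j)^-1 *: iter j S u \is a mpolyOver n O.
Proof.
move=> uO; elim: j => [|j IHj]; first by rewrite expr0 invr1 scale1r.
have := idem_step IHj; rewrite /S !TZ -scalerBr scalerA.
by rewrite exprS invfM iterS.
Qed.

(** [T] commutes with [T - 1], so each factor [T - 1] can be paired with one [T] into [S], which
    gains a factor [p]. There must be at least as many [T] as differences. *)
Lemma difference_iter u j0 j : (j <= j0)%N -> u \is a mpolyOver n O ->
  (p%:R ^+ j)^-1 *: iter j (fun x => T x - x) (iter j0 T u) \is a mpolyOver n O.
Proof.
move=> jj0 uO.
have -> : iter j (fun x => T x - x) (iter j0 T u) = iter j S (iter (j0 - j) T u).
  elim: j jj0 => [|j IHj] jj0; first by rewrite subn0.
  rewrite iterS IHj ?(ltnW jj0) //.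
  have -> : (j0 - j = (j0 - j.+1).+1)%N by move: jj0; lia.
  rewrite iterS; set v := iter _ T u.
  have ST k : iter k S (T v) = T (iter k S v).
    by elim: k => // k IHk; rewrite !iterS IHk /S !TB.
  by rewrite ST.
by apply: idem_iter; elim: (j0 - j)%N => // k IHk; rewrite iterS TO.
Qed.

Lemma iter_meval u y k :
  (iter k T u).@[y] = u.@[iter k (fun v i => (tnth H i).@[v]) y].
Proof.
elim: k y => // k IHk y; rewrite iterS iterSr -IHk.
exact: comp_mpoly_meval.
Qed.

Lemma idempotent_zeros u y N0 M h (s : seq nat) :
  u \is a mpolyOver n O -> (forall i, y i \in O) -> (M <= N0)%N ->
  uniq s -> size s = (2 * h)%N ->
  (forall k, k \in s -> (k <= M)%N /\
     u.@[iter (N0 + k) (fun v i => (tnth H i).@[v]) y] = 0) ->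
  forall k, (k <= M)%N ->
    u.@[iter (N0 + k) (fun v i => (tnth H i).@[v]) y] / p%:R ^+ h \in O.
Proof.
move=> uO yO MN us ss sz.
(* Newton coefficients of the values after [N0] steps; the [N0] applications of [T] already made
   suffice for all differences of order up to [M]. *)
pose c j := (iter j (fun x => T x - x) (iter N0 T u)).@[y].
apply: (interpolation_zeros valO pp p2 pO (c := c) _ _ us ss sz) => [k kM|j jM].
  rewrite -iter_meval addnC iterD (@newton_forward _ T _ _ _ kM) ?raddf_sum; last exact: TB.
  by apply: eq_bigr => j _; rewrite raddfMn.
have := difference_iter (leq_trans jM MN) uO.
by move=> /mpolyOver_meval/(_ yO); rewrite mevalZ mulrC.
Qed.

End IdempotentModP.

(** * Orbits modulo p *)

Lemma comp_mpolyA (K : comNzRingType) n k l (u : {mpoly K[n]})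
    (t : n.-tuple {mpoly K[k]}) (r : k.-tuple {mpoly K[l]}) :
  (u \mPo t) \mPo r = u \mPo [tuple tnth t i \mPo r | i < n].
Proof.
rewrite [u \mPo t]comp_mpolyEX [RHS]comp_mpolyEX raddf_sum /=; apply: eq_bigr => m _.
rewrite comp_mpolyZ !comp_mpolyX rmorph_prod /=; congr (_ *: _).
by apply: eq_bigr => i _; rewrite rmorphXn /= tnth_mktuple.
Qed.

Section EventuallyPeriodic.
Variables (T : finType) (e : nat -> T).
Hypothesis edet : forall i j, e i = e j -> e i.+1 = e j.+1.

Lemma deterministic_shift i j s : e i = e j -> e (i + s)%N = e (j + s)%N.
Proof. by move=> eij; elim: s => [|s IHs]; rewrite ?addn0 // !addnS; exact: edet. Qed.

(** Both the preperiod and the period are at most [#|T|]; its factorial exceeds the one and is a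
    multiple of the other, for every deterministic sequence in [T] at once. *)
Lemma eventually_periodic k s :
  e (k.+1 * (#|T|)`! + s)%N = e ((#|T|)`! + s)%N.
Proof.
have [i [j [ij jT eij]]] : exists i j, [/\ (i < j)%N, (j <= #|T|)%N & e i = e j].
  pose f (i : 'I_(#|T|.+1)) := e i.
  have : ~~ injectiveb f.
    apply/negP => /injectiveP /leq_card; apply/negP.
    by rewrite card_ord -ltnNge.
  move=> /injectivePn[i [j nij fij]].
  have [ij|ji|/val_inj ij] := ltngtP i j; last by rewrite ij eqxx in nij.
    by exists i, j; split=> //; rewrite -ltnS.
  by exists j, i; split=> //; rewrite -ltnS.
have per m q : (i <= m)%N -> e (m + q * (j - i))%N = e m.
  move=> im; elim: q => [|q IHq]; first by rewrite addn0.
  have := deterministic_shift (m - i + q * (j - i)) eij.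
  have -> : (i + (m - i + q * (j - i)) = m + q * (j - i))%N by lia.
  have -> : (j + (m - i + q * (j - i)) = m + q.+1 * (j - i))%N.
    by rewrite mulSn; lia.
  by move=> <-.
have [q qE] : exists q, (#|T|)`! = (q * (j - i))%N.
  have : (j - i %| (#|T|)`!)%N by apply: dvdn_fact; lia.
  by move/dvdnP.
have iT : (i <= (#|T|)`!)%N.
  apply: leq_trans (ltnW (leq_trans ij jT)) _; have := fact_gt0 #|T|.
  by case: #|T| => // m _; rewrite factS leq_pmulr ?fact_gt0.
have -> : (k.+1 * (#|T|)`! + s = (#|T|)`! + s + (k * q) * (j - i))%N.
  by rewrite mulSn -mulnA -qE addnAC.
by rewrite per // (leq_trans iT) ?leq_addr.
Qed.

End EventuallyPeriodic.

Section Dynamics.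
Variables (K : numFieldType) (O E : subringClosed K) (p B : nat) (chi : K -> 'I_B).
Hypothesis pp : prime p.
Hypothesis EO : {subset E <= O}.
Hypothesis chiP : forall x y, x \in E -> y \in E ->
  chi x = chi y <-> (x - y) / p%:R \in O.
Variable n : nat.

Let pK : p%:R != 0 :> K.
Proof. by rewrite pnatr_eq0 -lt0n prime_gt0. Qed.

(** The coordinate on the residue disc of [x]: composing with it restricts a polynomial to that
    disc. *)
Definition disc (x : 'I_n -> K) : n.-tuple {mpoly K[n]} :=
  [tuple (x i)%:MP + p%:R *: 'X_i | i < n].

(** Expansions of this shape are stable under sums and products, so derivatives are never mentioned.
    The linear coefficients are kept in [E], where residues are finitely many; for the remainder [O]
    is enough. *)
Lemma disc_taylor (x : 'I_n -> K) (u : {mpoly K[n]}) :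
  (forall i, x i \in E) -> u \is a mpolyOver n E ->
  exists2 b : 'I_n -> K, forall i, b i \in E &
    exists2 r, r \is a mpolyOver n O &
      u \mPo disc x = (u.@[x])%:MP + p%:R *: \sum_i b i *: 'X_i + p%:R ^+ 2 *: r.
Proof.
move=> xE uE; pose good (u : {mpoly K[n]}) := u.@[x] \in E /\
  exists2 b : 'I_n -> K, forall i, b i \in E &
    exists2 r, r \is a mpolyOver n O &
      u \mPo disc x = (u.@[x])%:MP + p%:R *: \sum_i b i *: 'X_i + p%:R ^+ 2 *: r.
have goodC c : c \in E -> good c%:MP.
  move=> cE; rewrite /good mevalC; split=> //; exists (fun=> 0) => [i|]; first exact: rpred0.
  exists 0; first exact: rpred0.
  rewrite comp_mpolyC big1 => [|i _]; last by rewrite scale0r.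
  by rewrite !scaler0 !addr0.
have goodX i : good 'X_i.
  rewrite /good mevalXU; split=> //; exists (fun j => (j == i)%:R) => [j|].
    exact: rpred_nat.
  exists 0; first exact: rpred0.
  rewrite comp_mpolyXU -tnth_nth tnth_mktuple scaler0 addr0 (bigD1 i) //= eqxx scale1r.
  by rewrite big1 ?addr0 // => j /negbTE->; rewrite scale0r.
have goodD a b : good a -> good b -> good (a + b).
  move=> [aE [b1 b1E [r1 r1O e1]]] [bE [b2 b2E [r2 r2O e2]]]; rewrite /good mevalD.
  split; first by rewrite rpredD.
  exists (fun i => b1 i + b2 i) => [i|]; first by rewrite rpredD.
  exists (r1 + r2); first by rewrite rpredD.
  rewrite comp_mpolyD e1 e2 mpolyCD.
  have -> : \sum_i (b1 i + b2 i) *: 'X_i = \sum_i b1 i *: 'X_i + \sum_i b2 i *: 'X_i :> {mpoly K[n]}.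
    by rewrite -big_split; apply: eq_bigr => i _; rewrite scalerDl.
  by rewrite !scalerDr; ring.
have goodM a b : good a -> good b -> good (a * b).
  move=> [aE [b1 b1E [r1 r1O e1]]] [bE [b2 b2E [r2 r2O e2]]]; rewrite /good mevalM.
  split; first by rewrite rpredM.
  exists (fun i => a.@[x] * b2 i + b.@[x] * b1 i) => [i|]; first by rewrite rpredD ?rpredM.
  have sO (c : 'I_n -> K) : (forall i, c i \in E) ->
      \sum_i c i *: 'X_i \is a mpolyOver n O.
    by move=> cE; apply: rpred_sum => i _; rewrite mpolyOverZ ?mpolyOverX ?EO.
  exists ((\sum_i b1 i *: 'X_i) * (\sum_i b2 i *: 'X_i)
     + (a.@[x])%:MP * r2 + (b.@[x])%:MP * r1
     + p%:R *: ((\sum_i b1 i *: 'X_i) * r2 + (\sum_i b2 i *: 'X_i) * r1)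
     + p%:R ^+ 2 *: (r1 * r2)).
    by rewrite !(rpredD, rpredM, sO, mpolyOverZ) ?mpolyOverC ?rpredX ?rpred_nat ?EO.
  rewrite rmorphM /= e1 e2 mpolyCM.
  have -> : \sum_i (a.@[x] * b2 i + b.@[x] * b1 i) *: 'X_i =
      (a.@[x])%:MP * (\sum_i b2 i *: 'X_i) + (b.@[x])%:MP * (\sum_i b1 i *: 'X_i) :> {mpoly K[n]}.
    rewrite !mulr_sumr -big_split /=; apply: eq_bigr => i _.
    by rewrite scalerDl !mul_mpolyC !scalerA.
  rewrite -!mul_mpolyC !rmorphXn /=; ring.
suff [] : good u by [].
rewrite [u]mpolyE; elim/big_ind: _ => [|a b|m _]; [exact: (goodC 0 (rpred0 E))|exact: goodD|].
rewrite -mul_mpolyC; apply: (goodM _ _).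
  by apply: goodC; rewrite (mpolyOverP _ uE).
rewrite mpolyXE_id; elim/big_ind: _ => [|a b|i _]; [exact: (goodC 1 (rpred1 E))|exact: goodM|].
elim: (m i) => [|k IHk]; first exact: (goodC 1 (rpred1 E)).
by rewrite exprS; exact: goodM.
Qed.

Lemma disc_meval x u (y : 'I_n -> K) :
  (u \mPo disc x).@[y] = u.@[fun i => x i + p%:R * y i].
Proof.
rewrite comp_mpoly_meval; apply: meval_eq => i.
by rewrite tnth_mktuple mevalD mevalC mevalZ mevalXU.
Qed.

Lemma meval_cong_modp u (x y : 'I_n -> K) :
  u \is a mpolyOver n E -> (forall i, x i \in E) ->
  (forall i, (y i - x i) / p%:R \in O) -> (u.@[y] - u.@[x]) / p%:R \in O.
Proof.
move=> uE xE xy; have [b bE [r rO e]] := disc_taylor xE uE.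
have -> : u.@[y] = (u \mPo disc x).@[fun i => (y i - x i) / p%:R].
  rewrite disc_meval; apply: meval_eq => i.
  by rewrite mulrC divfK // addrC subrK.
set z := fun i => _; rewrite e !mevalD mevalC !mevalZ.
set S := (\sum_i _).@[z].
have -> : (u.@[x] + p%:R * S + p%:R ^+ 2 * r.@[z] - u.@[x]) / p%:R = S + p%:R * r.@[z].
  by field.
apply: rpredD; last by rewrite rpredM ?rpred_nat // mpolyOver_meval.
rewrite /S raddf_sum rpred_sum // => i _ /=.
by rewrite mevalZ mevalXU; apply: rpredM; [exact/EO/bE|exact: xy].
Qed.

Definition affine (a : 'M[K]_n) (b : 'I_n -> K) i : {mpoly K[n]} :=
  (b i)%:MP + \sum_j a i j *: 'X_j.

Definition modp (u v : {mpoly K[n]}) := p%:R^-1 *: (u - v) \is a mpolyOver n O.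

Lemma modp_trans v u w : modp u v -> modp v w -> modp u w.
Proof.
by rewrite /modp => uv vw; rewrite -(subrK v u) -addrA scalerDr rpredD.
Qed.

Lemma modp_sym u v : modp u v -> modp v u.
Proof. by rewrite /modp => uv; rewrite -opprB scalerN rpredN. Qed.

Lemma modp_comp u v (t : n.-tuple {mpoly K[n]}) :
  (forall i, tnth t i \is a mpolyOver n O) -> modp u v -> modp (u \mPo t) (v \mPo t).
Proof.
by move=> tO uv; rewrite /modp -comp_mpolyB -comp_mpolyZ mpolyOver_comp.
Qed.

Lemma affineO (a : 'M[K]_n) b i : (forall i j, a i j \in E) -> (forall i, b i \in E) ->
  affine a b i \is a mpolyOver n O.
Proof.
move=> aE bE; rewrite rpredD ?mpolyOverC ?EO ?rpred_sum // => j _.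
by rewrite mpolyOverZ ?mpolyOverX ?EO.
Qed.

Lemma affine_comp (a : 'M[K]_n) b (a' : 'M[K]_n) b' (t : n.-tuple {mpoly K[n]}) i :
  (forall i j, a i j \in E) -> (forall i, modp (tnth t i) (affine a' b' i)) ->
  modp (affine a b i \mPo t) (affine (a *m a') (fun i => b i + \sum_j a i j * b' j) i).
Proof.
move=> aE ht; rewrite /modp.
have -> : affine a b i \mPo t - affine (a *m a') (fun i => b i + \sum_j a i j * b' j) i =
   \sum_j a i j *: (tnth t j - affine a' b' j).
  have -> : affine a b i \mPo t = (b i)%:MP + \sum_j a i j *: tnth t j.
    rewrite /affine comp_mpolyD comp_mpolyC raddf_sum; congr (_ + _).
    by apply: eq_bigr => j _; rewrite /= comp_mpolyZ comp_mpolyXU -tnth_nth.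
  have -> : \sum_j a i j *: (tnth t j - affine a' b' j) =
     \sum_j a i j *: tnth t j - \sum_j a i j *: affine a' b' j.
    by rewrite -sumrB; apply: eq_bigr => j _; rewrite scalerBr.
  suff -> : affine (a *m a') (fun i => b i + \sum_j a i j * b' j) i =
     (b i)%:MP + \sum_j a i j *: affine a' b' j by rewrite opprD addrACA subrr add0r.
  rewrite /affine mpolyCD -addrA; congr (_ + _).
  under [RHS]eq_bigr do rewrite scalerDr.
  rewrite big_split /=; congr (_ + _).
    by rewrite raddf_sum; apply: eq_bigr => j _; rewrite /= mpolyCM mul_mpolyC.
  under [RHS]eq_bigr do rewrite scaler_sumr.
  rewrite exchange_big; apply: eq_bigr => k _; rewrite mxE scaler_suml.
  by apply: eq_bigr => j _; rewrite scalerA.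
rewrite scaler_sumr rpred_sum // => j _.
rewrite scalerA mulrC -scalerA mpolyOverZ ?EO //; exact: ht.
Qed.

Lemma affine_modp (a b : 'M[K]_n) (c d : 'I_n -> K) i :
  (forall i j, (a i j - b i j) / p%:R \in O) -> (forall i, (c i - d i) / p%:R \in O) ->
  modp (affine a c i) (affine b d i).
Proof.
move=> ab cd; rewrite /modp /affine opprD addrACA -mpolyCB -sumrB scalerDr.
rewrite scaler_sumr rpredD ?rpred_sum // => [|j _].
  by rewrite -mul_mpolyC -mpolyCM mpolyOverC mulrC.
by rewrite -scalerBl scalerA mulrC mpolyOverZ ?mpolyOverX.
Qed.

(** Bounds the number of affine self-maps modulo [p]: one colour per matrix entry and per coordinate
    of the translation. *)
Definition affine_states : nat :=
  #|{: {ffun 'I_n * 'I_n -> 'I_B} * {ffun 'I_n -> 'I_B}}|.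

Fixpoint iter_comp (H : n.-tuple {mpoly K[n]}) j : n.-tuple {mpoly K[n]} :=
  if j is j'.+1 then [tuple tnth (iter_comp H j') i \mPo H | i < n]
  else [tuple 'X_i | i < n].

Lemma iter_comp_meval H j v i :
  (tnth (iter_comp H j) i).@[v] = iter j (fun v i => (tnth H i).@[v]) v i.
Proof.
elim: j v i => [|j IHj] v i; first by rewrite tnth_mktuple mevalXU.
by rewrite tnth_mktuple comp_mpoly_meval IHj iterSr.
Qed.

Lemma iter_compD H j k i :
  tnth (iter_comp H (j + k)) i = tnth (iter_comp H j) i \mPo iter_comp H k.
Proof.
elim: k i => [|k IHk] i; first by rewrite addn0 /= comp_mpoly_id.
by rewrite addnS /= tnth_mktuple IHk comp_mpolyA.
Qed.

Lemma iter_compO H j i : (forall i, tnth H i \is a mpolyOver n O) ->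
  tnth (iter_comp H j) i \is a mpolyOver n O.
Proof.
move=> HO; elim: j i => [|j IHj] i /=; rewrite tnth_mktuple; first exact: mpolyOverX.
exact: mpolyOver_comp.
Qed.

(** Modulo [p] the powers of [H] are affine maps, and the class of each determines the next. This
    gives a deterministic sequence in a finite set, in which the power [N!] and its square agree. *)
Lemma affine_idempotent (H : n.-tuple {mpoly K[n]}) (a : 'M[K]_n) b :
  (forall i, tnth H i \is a mpolyOver n O) ->
  (forall i j, a i j \in E) -> (forall i, b i \in E) ->
  (forall i, modp (tnth H i) (affine a b i)) ->
  let H' := iter_comp H (affine_states)`! in
  forall i, modp (tnth H' i \mPo H') (tnth H' i).
Proof.
move=> HO aE bE Hab H' i; rewrite -iter_compD.
pose st j := iter j (fun ab : 'M[K]_n * ('I_n -> K) =>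
  (ab.1 *m a, fun i => ab.2 i + \sum_j ab.1 i j * b j)) (1%:M, fun=> 0).
have stE j : (forall i k, (st j).1 i k \in E) /\ (forall i, (st j).2 i \in E).
  elim: j => [|j [IH1 IH2]] /=.
    by split=> [i' k|i']; rewrite ?rpred0 // mxE rpred_nat.
  split=> [i' k|i'].
    by rewrite mxE rpred_sum // => l _; rewrite rpredM.
  by rewrite rpredD // rpred_sum // => l _; rewrite rpredM.
have stH j i' : modp (tnth (iter_comp H j) i') (affine (st j).1 (st j).2 i').
  elim: j i' => [|j IHj] i'.
    rewrite tnth_mktuple /modp /affine add0r (bigD1 i') //= mxE eqxx scale1r big1 ?addr0.
      by rewrite subrr scaler0 rpred0.
    by move=> k ki; rewrite mxE eq_sym (negbTE ki) scale0r.
  rewrite tnth_mktuple; apply: modp_trans (modp_comp HO (IHj i')) _.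
  by apply: affine_comp => // i1 k; case: (stE j).
pose e j := ([ffun ik : 'I_n * 'I_n => chi ((st j).1 ik.1 ik.2)], [ffun i => chi ((st j).2 i)]).
have eP j k : e j = e k <-> (forall i l, ((st j).1 i l - (st k).1 i l) / p%:R \in O) /\
    (forall i, ((st j).2 i - (st k).2 i) / p%:R \in O).
  have [s1 s2] := stE j; have [s3 s4] := stE k.
  split=> [[/ffunP e1 /ffunP e2]|[e1 e2]].
    split=> [i' l|i']; first by apply/chiP => //; have := e1 (i', l); rewrite !ffunE.
    by apply/chiP => //; have := e2 i'; rewrite !ffunE.
  by congr (_, _); apply/ffunP => x; rewrite !ffunE; apply/chiP.
have edet j k : e j = e k -> e j.+1 = e k.+1.
  move=> /eP[e1 e2]; apply/eP; split=> [i' l|i'] /=.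
    rewrite !mxE -sumrB mulr_suml rpred_sum // => m _.
    by rewrite -mulrBl mulrAC; apply: rpredM; [exact: e1|exact: EO].
  rewrite opprD addrACA -sumrB mulrDl rpredD // mulr_suml rpred_sum // => m _.
  by rewrite -mulrBl mulrAC; apply: rpredM; [exact: e1|exact: EO].
(* With [k = 1] and [s = 0] the statement compares the exponents [2 * N!] and [N!]. *)
have := @eventually_periodic _ e edet 1 0; rewrite !addn0 mul2n -addnn => /eP[e1 e2].
apply: modp_trans (stH _ i) _; apply: modp_trans _ (modp_sym (stH _ i)).
exact: affine_modp.
Qed.

End Dynamics.

Lemma valring_unit_cong (K : fieldType) (O : subringClosed K) (p u x : K) :
  (forall x, x \in O \/ x^-1 \in O) -> p != 0 -> p^-1 \notin O ->
  u^-1 \in O -> u != 0 -> (x - u) / p \in O -> x^-1 \in O.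
Proof.
move=> valO p0 pO uO u0 xu.
have [->|x0] := eqVneq x 0; first by rewrite invr0 rpred0.
have [xp|] := valO (x / p).
  case/negP: pO; have -> : p^-1 = u^-1 * (x / p - (x - u) / p) by field; rewrite ?u0 ?p0.
  by rewrite rpredM ?rpredB.
rewrite invf_div => px.
have -> : x^-1 = u^-1 * (1 - (x - u) / p * (p / x)) by field; rewrite u0 x0 p0.
by rewrite rpredM ?rpredB ?rpred1 // rpredM.
Qed.

(** * Orbits whose points all have a chart function with unit value *)

Section GoodOrbit.
Variables (K : numFieldType) (O E : subringClosed K) (p B : nat) (chi : K -> 'I_B).
Hypothesis valO : forall x, x \in O \/ x^-1 \in O.
Hypotheses (pp : prime p) (p2 : (2 < p)%N) (pO : p%:R^-1 \notin O).
Hypothesis EO : {subset E <= O}.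
Hypothesis Ediv : forall x, x \in E -> x / p%:R \in O -> x / p%:R \in E.
Hypothesis chiP : forall x y, x \in E -> y \in E ->
  chi x = chi y <-> (x - y) / p%:R \in O.
Variables (n : nat) (I : Type) (s : I -> {mpoly K[n]}) (g : I -> n.-tuple {mpoly K[n]}).
Hypothesis sE : forall l, s l \is a mpolyOver n E.
Hypothesis gE : forall l i, tnth (g l) i \is a mpolyOver n E.
Variable Good : ('I_n -> K) -> Prop.

Let pK : p%:R != 0 :> K.
Proof. by rewrite pnatr_eq0 -lt0n prime_gt0. Qed.

Let step l (v : 'I_n -> K) := fun i => (tnth (g l) i).@[v].

Hypothesis GoodE : forall v, Good v -> forall i, v i \in E.
Hypothesis GoodI : forall v, Good v -> exists l, (s l).@[v] != 0 /\ (s l).@[v]^-1 \in O.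
Hypothesis GoodS : forall v l, Good v -> (s l).@[v] != 0 -> (s l).@[v]^-1 \in O -> Good (step l v).

Definition orbit_states : nat := #|{: {ffun 'I_n -> 'I_B}}|.

(** The first factor brings the orbit back to one residue disc, the second makes the return map
    idempotent modulo [p]. *)
Definition orbit_period : nat := ((orbit_states)`! * (affine_states B n)`!)%N.

(** Whether a chart function is a unit depends only on residues, so one formula can be fixed per
    colour. The colours of the orbit then evolve deterministically, and the composite over a period
    is one polynomial map, to which the idempotent argument applies in the coordinate of a disc. *)
Lemma good_orbit_zeros v0 : Good v0 -> exists x : nat -> 'I_n -> K,
  [/\ x 0%N = v0, forall i, Good (x i),
      forall i, exists2 l, (s l).@[x i] != 0 & x i.+1 = step l (x i) &
  forall Q N0 M h (S : seq nat), Q \is a mpolyOver n E -> (M <= N0)%N ->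
    uniq S -> size S = (2 * h)%N ->
    (forall k, k \in S -> (k <= M)%N /\ Q.@[x (orbit_period * (N0 + k).+1)%N] = 0) ->
    forall k, (k <= M)%N -> Q.@[x (orbit_period * (N0 + k).+1)%N] / p%:R ^+ h \in O].
Proof.
move=> Gv0; pose col (v : 'I_n -> K) := [ffun i => chi (v i)].
have colP v w : (forall i, v i \in E) -> (forall i, w i \in E) ->
    col v = col w <-> forall i, (v i - w i) / p%:R \in O.
  move=> vE wE; split=> [/ffunP e i|e].
    by apply/chiP => //; have := e i; rewrite !ffunE.
  by apply/ffunP => i; rewrite !ffunE; apply/chiP.
have /choice[iota iotaP] : forall c, exists l, forall v, Good v -> col v = c ->
    (s l).@[v] != 0 /\ (s l).@[v]^-1 \in O.
  move=> c; have [[v [Gv vc]]|nv] := pselect (exists v, Good v /\ col v = c); last first.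
    have [l _] := GoodI Gv0; exists l => v Gv vc; case: nv; by exists v.
  have [l [l0 lO]] := GoodI Gv; exists l => w Gw wc.
  have vw : forall i, (w i - v i) / p%:R \in O by apply/colP; rewrite ?vc //; exact: GoodE.
  have sw := meval_cong_modp pp EO (sE l) (GoodE Gv) vw.
  split; last exact: valring_unit_cong valO pK pO lO l0 sw.
  apply: contra pO => /eqP w0; rewrite w0 sub0r in sw.
  have -> : p%:R^-1 = - ((s l).@[v]^-1 * (- (s l).@[v] / p%:R)) by field; rewrite l0 pK.
  by rewrite rpredN rpredM.
pose nxt v := step (iota (col v)) v.
pose x i := iter i nxt v0.
have Gx i : Good (x i).
  elim: i => // i IHi; rewrite /x iterS; have [l0 lO] := iotaP _ _ IHi erefl.
  exact: GoodS.
exists x; split=> // [i|].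
  by exists (iota (col (x i))) => //; case: (iotaP _ _ (Gx i) erefl).
pose e i := col (x i).
have xE i j : x i j \in E by exact: GoodE.
have edet i j : e i = e j -> e i.+1 = e j.+1.
  move=> eij; apply/colP => // k; rewrite /x !iterS -/(x i) -/(x j) /nxt -/(e i) -/(e j) eij.
  have xij : forall i', (x i i' - x j i') / p%:R \in O by apply/colP.
  exact: (meval_cong_modp pp EO (gE _ k) (xE j) xij).
set M1 := (orbit_states)`!; set M2 := (affine_states B n)`!.
have M1_gt0 : (0 < M1)%N by exact: fact_gt0.
have M2_gt0 : (0 < M2)%N by exact: fact_gt0.
have eper t r : (0 < t)%N -> e (M1 * t + r)%N = e (M1 + r)%N.
  by case: t => // t _; rewrite mulnC; exact: eventually_periodic.
pose fix comp a m : n.-tuple {mpoly K[n]} :=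
  if m is m'.+1 then [tuple tnth (g (iota (e (a + m')%N))) i \mPo comp a m' | i < n]
  else [tuple 'X_i | i < n].
have compO a m i : tnth (comp a m) i \is a mpolyOver n E.
  elim: m i => [|m IHm] i /=; rewrite tnth_mktuple; first exact: mpolyOverX.
  exact: mpolyOver_comp.
have comp_x a m i : (tnth (comp a m) i).@[x a] = x (a + m)%N i.
  elim: m i => [|m IHm] i /=; rewrite tnth_mktuple; first by rewrite mevalXU addn0.
  rewrite comp_mpoly_meval addnS /x iterS -/(x _) /nxt /step; apply: meval_eq => j.
  exact: IHm.
have comp_eq a b m : (forall r, e (a + r)%N = e (b + r)%N) -> comp a m = comp b m.
  by move=> eab; elim: m => //= m ->; rewrite eab.
pose x0 := x (M1 * M2)%N; pose G := comp (M1 * M2)%N M1.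
have x0E i : x0 i \in E by exact: xE.
(* From time [M1] on the colours, hence the chosen formulas, have period [M1]; so [G], composed over
   one period, advances the point at every positive multiple of [M1]. *)
have xG t i : (0 < t)%N -> (tnth G i).@[x (M1 * t)%N] = x (M1 * t.+1)%N i.
  move=> t0; rewrite mulnSr -comp_x; congr (tnth _ i).@[_].
  by apply: comp_eq => r; rewrite !eper.
have modx t i : (0 < t)%N -> (x (M1 * t)%N i - x0 i) / p%:R \in O.
  move=> t0; move: i; apply/colP => //.
  have := eper t 0%N t0; have := eper M2 0%N M2_gt0; rewrite !addn0 => e2 e1.
  exact: etrans e1 (esym e2).
have /choice[b bP] : forall i, exists b : 'I_n -> K, (forall j, b j \in E) /\
    exists2 r, r \is a mpolyOver n O &
      tnth G i \mPo disc p x0 = ((tnth G i).@[x0])%:MP + p%:R *: \sum_j b j *: 'X_j + p%:R ^+ 2 *: r.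
  move=> i; have [b bE rP] := disc_taylor p EO x0E (compO (M1 * M2)%N M1 i).
  by exists b.
(* The return map in the coordinate [(x - x0) / p]. *)
pose H : n.-tuple {mpoly K[n]} := [tuple p%:R^-1 *: (tnth G i \mPo disc p x0 - (x0 i)%:MP) | i < n].
pose c i := ((tnth G i).@[x0] - x0 i) / p%:R.
have cO i : c i \in O by rewrite /c xG // modx.
(* The translation part has to be coloured, so the quotient by [p] must stay in [E], not only in
   [O]. *)
have cE i : c i \in E by rewrite Ediv ?cO // rpredB // /x0 xG.
have HE i : exists2 r, r \is a mpolyOver n O &
    tnth H i = affine (\matrix_(i, j) b i j) c i + p%:R *: r.
  have [_ [r rO e1]] := bP i; exists r => //; rewrite tnth_mktuple e1 /affine.
  under [X in _ = _ + X + _]eq_bigr do rewrite mxE.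
  have -> : (c i)%:MP = p%:R^-1 *: ((tnth G i).@[x0])%:MP - p%:R^-1 *: (x0 i)%:MP :> {mpoly K[n]}.
    by rewrite -scalerBr -mpolyCB -mul_mpolyC -mpolyCM mulrC.
  rewrite scalerBr !scalerDr !scalerA mulVf // scale1r expr2 mulKf //.
  by rewrite [LHS]addrAC [X in X + _]addrAC.
have HO i : tnth H i \is a mpolyOver n O.
  have [r rO ->] := HE i; rewrite rpredD ?mpolyOverZ ?rpred_nat //.
  by apply: (affineO EO) => // i' j; rewrite mxE; case: (bP i').
have Hmod i : modp O p (tnth H i) (affine (\matrix_(i, j) b i j) c i).
  have [r rO ->] := HE i.
  by rewrite /modp addrC addrA addNr add0r scalerA mulVf // scale1r.
have Hidem : forall i, modp O p (tnth (iter_comp H M2) i \mPo iter_comp H M2) (tnth (iter_comp H M2) i).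
  apply: (affine_idempotent EO chiP HO _ cE Hmod) => // i j.
  by rewrite mxE; case: (bP i).
pose Hf (v : 'I_n -> K) i := (tnth H i).@[v].
pose y t i := (x (M1 * (M2 + t))%N i - x0 i) / p%:R.
have yO t i : y t i \in O by apply: modx; rewrite addn_gt0 M2_gt0.
have xy t : (fun i => x0 i + p%:R * y t i) = x (M1 * (M2 + t))%N.
  by apply/funext => i; rewrite mulrC divfK // addrC subrK.
have yS t : Hf (y t) = y t.+1.
  apply/funext => i; rewrite /Hf tnth_mktuple mevalZ mevalB mevalC disc_meval xy.
  by rewrite xG ?addn_gt0 ?M2_gt0 // mulrC /y addnS.
have yD t m : iter m Hf (y t) = y (t + m)%N.
  by elim: m => [|m IHm]; rewrite ?addn0 // iterS IHm yS addnS.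
have yM j : iter j (fun v i => (tnth (iter_comp H M2) i).@[v]) (y 0%N) = y (M2 * j)%N.
  elim: j => [|j IHj]; first by rewrite muln0.
  rewrite iterS IHj; apply/funext => i; rewrite iter_comp_meval yD.
  by rewrite mulnS addnC.
move=> Q N0 M h S QE MN uS sS hS k kM.
have QxE k' : Q.@[x (orbit_period * (N0 + k').+1)%N] = (Q \mPo disc p x0).@[y (M2 * (N0 + k'))%N].
  (* The successor in the index stands for the time [M1 * M2] of the base point [x0]. *)
  by rewrite disc_meval xy /orbit_period -/M1 -/M2 -mulnS mulnA.
rewrite QxE -yM.
apply: (idempotent_zeros valO pp p2 pO _ Hidem _ (yO 0%N) MN uS sS) => //.
- by move=> i; exact: iter_compO.
- have [b' b'E [r rO ->]] := disc_taylor p EO x0E QE.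
  rewrite rpredD ?rpredD ?mpolyOverC ?mpolyOverZ ?rpredX ?rpred_nat //.
    exact: mpolyOver_meval (mpolyOverS EO QE) (fun i => EO (x0E i)).
  by apply: rpred_sum => i _; rewrite mpolyOverZ ?mpolyOverX ?EO.
by move=> k' /hS[k'M]; rewrite QxE -yM.
Qed.

End GoodOrbit.

(** * Hilbert basis theorem and Nullstellensatz *)

(** Each term is placed at a minimum of the tail beginning just after the previous one. *)
Lemma nondecreasing_subsequence (u : nat -> nat) :
  exists phi : nat -> nat, (forall k, phi k < phi k.+1)%N /\
    forall k, (u (phi k) <= u (phi k.+1))%N.
Proof.
have /choice[f fP] : forall N, exists j, (N <= j)%N /\ forall i, (N <= i)%N -> (u j <= u i)%N.
  move=> N; have exP : exists m, [exists i : 'I_m.+1, true] && `[< exists2 j, (N <= j)%N & u j = m >].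
    by exists (u N); apply/andP; split; [apply/existsP; exists ord0|apply/asboolP; exists N].
  have [m /andP[_ /asboolP[j Nj <-]] mmin] := ex_minnP exP.
  exists j; split=> // i Ni; apply: mmin; apply/andP; split; first by apply/existsP; exists ord0.
  by apply/asboolP; exists i.
pose phi k := iter k (fun j => f j.+1) (f 0%N).
exists phi; split=> k; first by case: (fP (phi k).+1).
have kk : (phi k < phi k.+1)%N by case: (fP (phi k).+1).
case: k kk => [|k] kk; first by have [_] := fP 0%N; apply.
have [_] := fP (phi k).+1; apply.
by apply: leq_trans (ltnW kk); case: (fP (phi k).+1).
Qed.

(** Subsequences are refined one exponent at a time until all exponents are nondecreasing. *)
Lemma dickson n (m : nat -> 'X_{1..n}) : exists i j, (i < j)%N /\ (m i <= m j)%MM.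
Proof.
have inc phi : (forall k, phi k < phi k.+1)%N -> forall i j, (i < j)%N -> (phi i < phi j)%N.
  move=> H i j; elim: j => // j IHj; rewrite ltnS leq_eqVlt => /orP[/eqP->//|/IHj].
  by move/ltn_trans; apply.
have mono (v : nat -> nat) : (forall k, v k <= v k.+1)%N -> forall i j, (i <= j)%N -> (v i <= v j)%N.
  move=> H i j; elim: j => [|j IHj]; first by rewrite leqn0 => /eqP->.
  by rewrite leq_eqVlt => /orP[/eqP->//|/IHj]; move/leq_trans; apply.
suff [phi [iphi mphi]] : exists phi : nat -> nat, (forall k, phi k < phi k.+1)%N /\
    forall i, i \in enum 'I_n -> forall k, (m (phi k) i <= m (phi k.+1) i)%N.
  exists (phi 0%N), (phi 1%N); split=> //.
  by apply/mnm_lepP => i; apply: mphi; rewrite mem_enum.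
elim: (enum _) => [|i s [phi [iphi mphi]]]; first by exists id.
have [psi [ipsi mpsi]] := nondecreasing_subsequence (fun k => m (phi k) i).
exists (phi \o psi); split=> [k|j]; first exact: (inc _ iphi _ _ (ipsi k)).
rewrite inE => /orP[/eqP->//|js] k /=.
by apply: (mono (fun k => m (phi k) j) (mphi j js)); exact: ltnW.
Qed.

Section Ideals.
Variables (K : fieldType) (n : nat).
Implicit Types (J S : set {mpoly K[n]}) (f g : {mpoly K[n]}).

Definition is_ideal J := [/\ J 0, forall f g, J f -> J g -> J (f + g) &
  forall c f, J f -> J (c * f)].

Definition ideal_gen S : set {mpoly K[n]} :=
  [set f | forall J, is_ideal J -> S `<=` J -> J f].

Lemma ideal_gen_ideal S : is_ideal (ideal_gen S).
Proof.
split=> [J [] //|f g hf hg J Ji SJ|c f hf J Ji SJ].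
  by case: (Ji) => _ + _; apply; [exact: hf|exact: hg].
by case: (Ji) => _ _; apply; exact: hf.
Qed.

Lemma sub_ideal_gen S : S `<=` ideal_gen S.
Proof. by move=> f Sf J _; apply. Qed.

Lemma ideal_genS S S' : S `<=` S' -> ideal_gen S `<=` ideal_gen S'.
Proof. by move=> SS' f hf J Ji S'J; apply: hf => // g /SS' /S'J. Qed.

Lemma ideal_opp J f : is_ideal J -> J f -> J (- f).
Proof. by case=> _ _ JM Jf; rewrite -mulN1r; exact: JM. Qed.

Lemma ideal_sub J f g : is_ideal J -> J f -> J g -> J (f - g).
Proof. by move=> Ji Jf Jg; case: (Ji) => _ + _; apply=> //; exact: ideal_opp. Qed.

Lemma ideal_sum J (T : Type) (r : seq T) (P : pred T) F :
  is_ideal J -> (forall i, P i -> J (F i)) -> J (\sum_(i <- r | P i) F i).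
Proof. by case=> J0 JD _ JF; apply: big_ind. Qed.

(** Hilbert's basis theorem. If no finite list sufficed, one could keep adding an element of [J]
    outside the ideal so far, with least leading monomial. By Dickson an earlier leading monomial
    divides a later one, and cancelling it yields a smaller element that is still outside. *)
Lemma ideal_fg J : is_ideal J ->
  exists2 s : seq {mpoly K[n]}, forall f, f \in s -> J f & J `<=` ideal_gen [set` s].
Proof.
move=> Ji; apply: contrapT => nfg.
have step (s : seq {mpoly K[n]}) : exists h, (forall f, f \in s -> J f) ->
    [/\ J h, ~ ideal_gen [set` s] h &
        forall f, J f -> ~ ideal_gen [set` s] f -> ~ (mlead f < mlead h)%O].
  have [sJ|nsJ] := pselect (forall f, f \in s -> J f); last by exists 0 => /nsJ.
  have [f0 [Jf0 nf0]] : exists f, J f /\ ~ ideal_gen [set` s] f.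
    apply: contrapT => nf; apply: nfg; exists s => // f Jf.
    by apply: contrapT => nsf; apply: nf; exists f.
  elim/mleadrect: f0 Jf0 nf0 => f IHf Jf nf.
  have [[g [Jg ng gf]]|nof] := pselect (exists g, [/\ J g, ~ ideal_gen [set` s] g & (mlead g < mlead f)%O]).
    exact: IHf gf Jg ng.
  by exists f => _; split=> // g Jg ng gf; apply: nof; exists g.
have [h hP] := choice step.
pose s k := iter k (fun s => rcons s (h s)) [::].
have sJ k f : f \in s k -> J f.
  elim: k f => // k IHk f; rewrite /s iterS mem_rcons inE => /orP[/eqP->|/IHk//].
  by case: (hP _ (IHk)).
have hs i j : (i < j)%N -> h (s i) \in s j.
  elim: j => // j IHj; rewrite ltnS leq_eqVlt /s iterS mem_rcons inE => /orP[/eqP->|/IHj->].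
    by rewrite eqxx.
  by rewrite orbT.
have [i [j [ij mij]]] := dickson (fun k => mlead (h (s k))).
have [Jhi nhi _] := hP _ (sJ i).
have [Jhj nhj minj] := hP _ (sJ j).
have h0 k : h (s k) != 0.
  have [_ nh _] := hP _ (sJ k); apply: contra_notN nh => /eqP->.
  by case: (ideal_gen_ideal [set` s k]).
pose c := (mleadc (h (s j))) / (mleadc (h (s i))).
pose q := c *: 'X_[mlead (h (s j)) - mlead (h (s i))].
pose f := h (s j) - q * h (s i).
have Iq : ideal_gen [set` s j] (q * h (s i)).
  by case: (ideal_gen_ideal [set` s j]) => _ _; apply; apply: sub_ideal_gen; exact: hs.
have Jf : J f by apply: ideal_sub => //; case: (Ji) => _ _; exact.
have nf : ~ ideal_gen [set` s j] f.
  move=> If; apply: nhj; rewrite -(subrK (q * h (s i)) (h (s j))).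
  by case: (ideal_gen_ideal [set` s j]) => _ + _; apply.
apply: (minj f Jf nf).
have c0 : c != 0 by rewrite mulf_neq0 ?invr_eq0 ?mleadc_eq0.
have q0 : q != 0 by rewrite scaler_eq0 negb_or c0 -msupp_eq0 msuppX.
have lq : mlead (q * h (s i)) = mlead (h (s j)).
  by rewrite mleadM // mleadZ // mleadXm submK.
have lf : (mlead f <= mlead (h (s j)))%O.
  by apply: le_trans (mleadB_le _ _) _; rewrite lq joinxx.
rewrite lt_neqAle lf andbT; apply/negP => /eqP e.
have f0 : f != 0.
  by apply: contra_notN nf => /eqP->; case: (ideal_gen_ideal [set` s j]).
have : f@_(mlead f) = 0.
  rewrite e /f mcoeffB -[X in _ - _@_X]lq.
  have -> : (q * h (s i))@_(mlead (q * h (s i))) = mleadc q * mleadc (h (s i)).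
    by rewrite mleadM // mleadcM.
  rewrite mleadZ // mleadXm mcoeffZ mcoeffX eqxx mulr1 /c divfK ?subrr //.
  by rewrite mleadc_eq0.
by move/eqP; rewrite mleadc_eq0 (negbTE f0).
Qed.

(** The finite list is drawn from [S] itself and not just from its ideal, so that its members keep
    the properties that define [S], such as homogeneity. *)
Lemma zeros_fg (S : set {mpoly K[n]}) :
  exists2 s : seq {mpoly K[n]}, forall f, f \in s -> S f &
    forall v, (forall f, f \in s -> f.@[v] = 0) -> forall f, S f -> f.@[v] = 0.
Proof.
have vanish v : is_ideal [set f : {mpoly K[n]} | f.@[v] = 0].
  split=> [|f g /= f0 g0|c f /= f0]; first exact: meval0.
    by rewrite mevalD f0 g0 addr0.
  by rewrite mevalM f0 mulr0.
have fin f : ideal_gen S f -> exists2 s : seq {mpoly K[n]},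
    forall g, g \in s -> S g & ideal_gen [set` s] f.
  pose J := [set f | exists2 s : seq {mpoly K[n]},
    forall g, g \in s -> S g & ideal_gen [set` s] f].
  move=> hf; apply: (hf J); last by move=> g Sg; exists [:: g] => [h|]; [rewrite inE => /eqP->|
    apply: sub_ideal_gen; exact: mem_head].
  split=> [|f1 f2 [s1 s1S h1] [s2 s2S h2]|c g [s sS h]].
  - by exists [::] => //; case: (ideal_gen_ideal [set` [::]]).
  - exists (s1 ++ s2) => [g|]; first by rewrite mem_cat => /orP[/s1S|/s2S].
    case: (ideal_gen_ideal [set` s1 ++ s2]) => _ + _; apply.
      by apply: ideal_genS h1 => g; rewrite /= mem_cat => ->.
    by apply: ideal_genS h2 => g; rewrite /= mem_cat => ->; rewrite orbT.
  - by exists s => //; case: (ideal_gen_ideal [set` s]) => _ _; apply.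
have [s sS Ss] := ideal_fg (ideal_gen_ideal S).
have [s' s'S ss'] : exists2 s' : seq {mpoly K[n]}, forall g, g \in s' -> S g &
    forall g, g \in s -> ideal_gen [set` s'] g.
  elim: s sS {Ss} => [|f s IHs] sS; first by exists [::].
  have [|s1 s1S h1] := IHs; first by move=> g gs; apply: sS; rewrite inE gs orbT.
  have [s2 s2S h2] := fin f (sS f (mem_head _ _)).
  exists (s1 ++ s2) => [g|g]; first by rewrite mem_cat => /orP[/s1S|/s2S].
  rewrite inE => /orP[/eqP->|/h1].
    by apply: (ideal_genS _ h2) => g'; rewrite /= mem_cat => ->; rewrite orbT.
  by apply: ideal_genS => g'; rewrite /= mem_cat => ->.
exists s' => // v s'v f Sf.
have sv g : g \in s -> g.@[v] = 0.
  by move=> /ss' hg; apply: (hg _ (vanish v)) => f' /s'v.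
exact: (Ss f (sub_ideal_gen Sf) _ (vanish v) sv).
Qed.

End Ideals.

(** * Nullstellensatz over an uncountable algebraically closed field *)

Section Nullstellensatz.
Variables (K : closedFieldType) (n : nat).
Hypothesis uncountableK : ~ countable [set: K].
Implicit Types (J : set {mpoly K[n]}).

Lemma ideal_point J (v : 'I_n -> K) f :
  is_ideal J -> (forall i, J ('X_i - (v i)%:MP)) -> J (f - (f.@[v])%:MP).
Proof.
move=> Ji Jv; have [J0 JD JM] := Ji.
pose good f := J (f - (f.@[v])%:MP).
have goodC c : good c%:MP by rewrite /good mevalC subrr.
have goodD a b : good a -> good b -> good (a + b).
  by move=> ga gb; rewrite /good mevalD mpolyCD opprD addrACA; exact: JD.
have goodM a b : good a -> good b -> good (a * b).
  move=> ga gb; rewrite /good mevalM mpolyCM.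
  have -> : a * b - (a.@[v])%:MP * (b.@[v])%:MP =
    b * (a - (a.@[v])%:MP) + (a.@[v])%:MP * (b - (b.@[v])%:MP) by ring.
  by apply: JD; exact: JM.
rewrite -/(good f) [f]mpolyE; elim/big_ind: _ => [|a b|m _]; [exact: (goodC 0)|exact: goodD|].
rewrite -mul_mpolyC; apply: (goodM _ _); first exact: goodC.
rewrite mpolyXE_id; elim/big_ind: _ => [|a b|i _]; [exact: (goodC 1)|exact: goodM|].
elim: (m i) => [|k IHk]; first exact: (goodC 1).
by rewrite exprS; apply: (goodM _ _) => //; rewrite /good mevalXU; exact: Jv.
Qed.

Lemma infinite_fiber (T : choiceType) (f : K -> T) :
  countable [set: T] -> exists t, infinite_set [set c | f c = t].
Proof.
move=> cT; apply: contrapT => fin; apply: uncountableK.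
have -> : [set: K] = \bigcup_(t in [set: T]) [set c | f c = t].
  by apply/seteqP; split=> // c _; exists (f c).
apply: bigcup_countable => // t _; apply: finite_set_countable.
by apply: contrapT => ?; apply: fin; exists t.
Qed.

Lemma mpoly_dependence D (u : 'I_(#|{: 'X_{1..n < D}}|.+1) -> {mpoly K[n]}) :
  (forall k, (msize (u k) <= D)%N) ->
  exists2 b : 'I_(#|{: 'X_{1..n < D}}|.+1) -> K, exists k, b k != 0 & \sum_k b k *: u k = 0.
Proof.
move=> uD; have FT : divring_closed (predT : {pred K}) by split.
have [F FE] := divring_closed_pack FT.
have [|b [_ b0 bE]] := @linear_dependence K F _ _
    (fun k (j : 'I_#|{: 'X_{1..n < D}}|) => (u k)@_(enum_val j)) (leqnn _).
  by move=> i j; rewrite FE.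
exists b => //; apply/mpolyP => m; rewrite raddf_sum mcoeff0 /=.
under eq_bigr do rewrite mcoeffZ.
have [mD|Dm] := ltnP (mdeg m) D.
  have -> : m = enum_val (enum_rank (BMultinom mD)) by rewrite enum_rankK.
  exact: bE.
rewrite big1 // => k _; rewrite memN_msupp_eq0 ?mulr0 //.
by apply: msize_mdeg_ge; exact: leq_trans (uD k) Dm.
Qed.

Section EliminateVariable.
Variables (J : set {mpoly K[n]}) (s : {mpoly K[n]}) (i : 'I_n).
Hypothesis Ji : is_ideal J.

Let pev (W : {poly K}) : {mpoly K[n]} := (map_poly (@mpolyC n K) W).['X_i].

(** After inverting [s], every ['X_i - c] is a unit modulo [J], so such factors can be cancelled one
    by one. *)
Lemma ideal_prod_roots M (rs : seq K) (P : {mpoly K[n]}) :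
  (forall c, exists m u, J (s ^+ m - u * ('X_i - c%:MP))) ->
  J (s ^+ M * ((\prod_(r <- rs) ('X_i - r%:MP)) * P)) -> exists M', J (s ^+ M' * P).
Proof.
move=> inv; have [J0 JD JM] := Ji.
elim: rs M P => [|r rs IHrs] M P; first by rewrite big_nil mul1r; exists M.
rewrite big_cons => h; have [m [u hu]] := inv r.
apply: (IHrs (M + m)%N).
set A := \prod_(_ <- _) _ in h *.
have -> : s ^+ (M + m) * (A * P) =
    u * (s ^+ M * (('X_i - r%:MP) * A * P)) +
    s ^+ M * A * P * (s ^+ m - u * ('X_i - r%:MP)) by rewrite exprD; ring.
by apply: JD; exact: JM.
Qed.

(** Otherwise every ['X_i - c] has an inverse [u c] modulo [J] up to a power of [s]. As [K] is
    uncountable, infinitely many [c] share that power and the size of [u c]; these inverses lie in a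
    finite-dimensional space and are linearly dependent. Clearing denominators puts a power of [s]
    times a nonzero polynomial in ['X_i] into [J]; it splits, and its factors cancel. *)
Lemma ideal_no_power_point :
  (forall m, ~ J (s ^+ m)) -> exists c, forall m u, ~ J (s ^+ m - u * ('X_i - c%:MP)).
Proof.
move=> nJ; apply: contrapT => nc; have [J0 JD JM] := Ji.
have inv : forall c, exists m u, J (s ^+ m - u * ('X_i - c%:MP)).
  move=> c; apply: contrapT => nmu; apply: nc; exists c => m u h.
  by apply: nmu; exists m, u.
have /choice[m /choice[u mu]] := inv.
have [[M D] infMD] := @infinite_fiber (nat * nat)%type (fun c => (m c, msize (u c))) (countableP _).
set d := #|{: 'X_{1..n < D}}|.
have [A sA cA] := infinite_set_fset d.+1 infMD.
pose r (k : 'I_d.+1) := nth 0 (finmap.enum_fset A) k.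
have rA k : (m (r k), msize (u (r k))) = (M, D).
  by apply: sA; rewrite /= /r; apply: mem_nth; exact: leq_trans (ltn_ord k) cA.
have rinj : injective r.
  move=> k l /eqP; rewrite nth_uniq ?finmap.fset_uniq ?(leq_trans (ltn_ord _) cA) //.
  by move/eqP/val_inj.
have [|b [k0 bk0] bu] := @mpoly_dependence D (fun k => u (r k)).
  by move=> k; case: (rA k) => _ ->.
(* The numerator of the sum of the [b k / (X - r k)]; at the node [r k0] only one term survives. *)
pose W : {poly K} := \sum_k b k *: \prod_(l | l != k) ('X - (r l)%:P).
have W0 : W != 0.
  apply: contra_neq bk0 => W0; have : W.[r k0] = 0 by rewrite W0 horner0.
  rewrite /W horner_sum (bigD1 k0) //= [X in _ + X]big1 ?addr0 => [|k kk0].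
    rewrite hornerZ => /eqP; rewrite mulf_eq0 => /orP[/eqP//|].
    rewrite horner_prod prodf_seq_eq0 => /hasP[l _ /andP[lk]].
    by rewrite hornerXsubC subr_eq0 (inj_eq rinj) eq_sym (negbTE lk).
  rewrite hornerZ horner_prod (bigD1 k0) 1?eq_sym //= hornerXsubC subrr mul0r.
  by rewrite mulr0.
have pevX c : pev ('X - c%:P) = 'X_i - c%:MP.
  by rewrite /pev rmorphB /= map_polyX map_polyC !hornerE.
have pev_prod (T : Type) (rs : seq T) P (F : T -> {poly K}) :
    pev (\prod_(j <- rs | P j) F j) = \prod_(j <- rs | P j) pev (F j).
  by rewrite /pev rmorph_prod horner_prod.
have pevZ c P : pev (c *: P) = c *: pev P.
  by rewrite /pev map_polyZ hornerZ mul_mpolyC.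
have JW : J (s ^+ M * pev W).
  have -> : s ^+ M * pev W = \sum_k (b k *: \prod_(l | l != k) ('X_i - (r l)%:MP)) *
       (s ^+ M - u (r k) * ('X_i - (r k)%:MP)).
    have -> : pev W = \sum_k b k *: \prod_(l | l != k) ('X_i - (r l)%:MP).
      rewrite /pev rmorph_sum horner_sum; apply: eq_bigr => k _.
      rewrite -/(pev _) pevZ pev_prod; congr (_ *: _).
      by apply: eq_bigr => l _; rewrite pevX.
    under [RHS]eq_bigr do rewrite mulrBr.
    rewrite sumrB -mulr_suml mulrC -[LHS]subr0; congr (_ - _).
    transitivity ((\prod_l ('X_i - (r l)%:MP)) * \sum_k b k *: u (r k)).
      by rewrite bu mulr0.
    rewrite mulr_sumr; apply: eq_bigr => k _.
    by rewrite (bigD1 k) //= -scalerAl -scalerAr; congr (_ *: _); ring.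
  apply: ideal_sum => // k _; apply: JM.
  by have [<- _] := rA k; exact: mu.
have [rs WE] := closed_field_poly_normal W.
have lW : lead_coef W != 0 by rewrite lead_coef_eq0.
have {}JW : J (s ^+ M * ((\prod_(c <- rs) ('X_i - c%:MP)) * 1)).
  have -> : s ^+ M * ((\prod_(c <- rs) ('X_i - c%:MP)) * 1) =
      ((lead_coef W)^-1)%:MP * (s ^+ M * pev W).
    rewrite [in pev W]WE pevZ pev_prod mulr1 mul_mpolyC -scalerAr scalerA mulVf // scale1r.
    by congr (_ * _); apply: eq_bigr => c _; rewrite pevX.
  exact: JM.
have [M'] := ideal_prod_roots inv JW.
by rewrite mulr1; exact: nJ.
Qed.

End EliminateVariable.

(** The variables are specialized one at a time while all powers of [s] stay outside the ideal. At
    the end the ideal is that of a point, a zero of [J] where [s] does not vanish. Tracking powers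
    of [s] replaces the extra variable of Rabinowitsch. *)
Lemma nullstellensatz J s : is_ideal J ->
  (forall v, (forall f, J f -> f.@[v] = 0) -> s.@[v] = 0) ->
  exists M, J (s ^+ M).
Proof.
move=> Ji sJ; apply: contrapT => nJ.
suff [v [J' [J'i JJ' nJ' J'v]]] : exists (v : 'I_n -> K) (J' : set {mpoly K[n]}),
    [/\ is_ideal J', J `<=` J', forall m, ~ J' (s ^+ m) &
        forall i, i \in enum 'I_n -> J' ('X_i - (v i)%:MP)].
  have {}J'v i : J' ('X_i - (v i)%:MP) by apply: J'v; rewrite mem_enum.
  have [J'0 J'D J'M] := J'i.
  have zero f : J' f -> f.@[v] = 0.
    (* A nonzero value would be an invertible constant in [J'], which excludes 1 as the power of [s]
       with exponent 0. *)
    move=> J'f; apply: contrapT => /eqP fv; apply: (nJ' 0%N).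
    rewrite expr0; have -> : 1 = ((f.@[v])^-1)%:MP * (f - (f - (f.@[v])%:MP)) :> {mpoly K[n]}.
      by rewrite subKr -mpolyCM mulVf.
    by apply: J'M; apply: ideal_sub => //; exact: ideal_point.
  apply: (nJ' 1%N); rewrite expr1; have := ideal_point s J'i J'v.
  by rewrite sJ ?mpolyC0 ?subr0 // => f /JJ'; exact: zero.
elim: (enum _) (enum_uniq 'I_n) => [_|i r IHr /= /andP[ir ur]].
  by exists (fun=> 0), J; split=> // m Jm; apply: nJ; exists m.
have [v [J' [J'i JJ' nJ' J'v]]] := IHr ur.
have [c cP] := ideal_no_power_point i J'i nJ'.
have [J'0 J'D J'M] := J'i.
exists (fun j => if j == i then c else v j),
  [set f | exists u, J' (f - u * ('X_i - c%:MP))]; split.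
- split=> [|f g [u hu] [w hw]|g f [u hu]].
  + by exists 0; rewrite mul0r subr0.
  + by exists (u + w); rewrite mulrDl opprD addrACA; exact: J'D.
  + by exists (g * u); rewrite -mulrA -mulrBr; exact: J'M.
- by move=> f /JJ' Jf; exists 0; rewrite mul0r subr0.
- by move=> m [u]; exact: cP.
move=> j; rewrite inE; case: eqP => [->|_ /= jr].
  by exists 1; rewrite mul1r subrr.
by exists 0; rewrite mul0r subr0; exact: J'v.
Qed.

End Nullstellensatz.

(** Cantor's nested intervals: step [k] avoids the real with code [k], so the supremum of the left
    ends would be avoided at the step of its own code. *)
Lemma realType_uncountable (R : realType) : ~ countable [set: R].
Proof.
move/countable_injP => [code codeI].
have {codeI}inj : injective code by move=> x y; apply: codeI; rewrite inE.
pose pt k := xget (0 : R) [set x | code x = k].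
have ptE x : pt (code x) = x.
  by rewrite /pt; case: xgetP => [y _ /= /inj //|/(_ x)]; case.
(* The outer quarter on the side of the midpoint away from [r]; a quarter rather than a half, so
   that [r] at the midpoint is avoided too. *)
pose cut (ab : R * R) (r : R) : R * R :=
  if r <= (ab.1 + ab.2) / 2%:R then ((ab.1 + ab.2 * 3%:R) / 4%:R, ab.2)
  else (ab.1, (ab.1 * 3%:R + ab.2) / 4%:R).
have cutP ab r : ab.1 < ab.2 -> [/\ ab.1 <= (cut ab r).1, (cut ab r).1 < (cut ab r).2,
    (cut ab r).2 <= ab.2 & ~~ ((cut ab r).1 <= r <= (cut ab r).2)].
  case: ab => a b /= ab; rewrite /cut /=.
  have [rm|rm] := leP r ((a + b) / 2%:R) => /=.
    by split; [lra|lra|lra|apply/negP; case/andP => h1 h2; lra].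
  by split; [lra|lra|lra|apply/negP; case/andP => h1 h2; lra].
pose fix I k : R * R := if k is k'.+1 then cut (I k') (pt k') else (0, 1).
have I_lt k : (I k).1 < (I k).2.
  by elim: k => [|k IHk] /=; [exact: ltr01|case: (cutP _ (pt k) IHk)].
have I_mono k l : (k <= l)%N -> (I k).1 <= (I l).1 /\ (I l).2 <= (I k).2.
  move=> kl; rewrite -(subnKC kl); elim: (l - k)%N => [|m [IH1 IH2]]; first by rewrite addn0.
  rewrite addnS /=; have [h1 _ h2 _] := cutP _ (pt (k + m)%N) (I_lt (k + m)%N).
  by split; [exact: le_trans IH1 h1|exact: le_trans h2 IH2].
pose A := [set x | exists k, x = (I k).1].
have A_ub k : ubound A (I k).2.
  move=> _ [l ->]; have [kl|/ltnW lk] := leqP k l.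
    by have [_ h] := I_mono _ _ kl; exact: le_trans (ltW (I_lt l)) h.
  by have [h _] := I_mono _ _ lk; exact: le_trans h (ltW (I_lt k)).
have A_sup : has_sup A by split; [exists (I 0%N).1; exists 0%N|exists (I 0%N).2; exact: A_ub].
have [_ _ _ /negP] := cutP _ (pt (code (sup A))) (I_lt (code (sup A))); apply.
rewrite -/(I (code (sup A)).+1) ptE; apply/andP; split.
  by apply: sup_upper_bound => //; exists (code (sup A)).+1.
by apply: ge_sup; [exists (I 0%N).1; exists 0%N|exact: A_ub].
Qed.

(** * Charts of a quasiprojective variety *)

Section ProjectivePoints.
Variables (K : fieldType) (n : nat).
Implicit Types (v w : 'rV[K]_n.+1) (x y : proj K n).

Lemma homog_coord_exists x : exists v, homog_coord v x.
Proof.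
exists (vpick (val x)); split; first exact: memv_pick.
by rewrite vpick0 -dimv_eq0; move: (valP x) => /= /eqP->.
Qed.

Lemma homog_coord_line v x : homog_coord v x -> val x = <[v]>%VS.
Proof.
move=> [vx v0]; apply/esym/eqP; rewrite eqEdim; apply/andP; split.
  by rewrite -memvE.
by rewrite dim_vline v0; move: (valP x) => /= /eqP->.
Qed.

Lemma homog_coord_prop v w x : homog_coord v x -> homog_coord w x ->
  exists2 c, c != 0 & w = c *: v.
Proof.
move=> /homog_coord_line vx [wx w0]; move: wx; rewrite vx => /vlineP[c wc].
by exists c => //; apply: contra_neq w0 => c0; rewrite wc c0 scale0r.
Qed.

Lemma homog_coordZ c v x : c != 0 -> homog_coord v x -> homog_coord (c *: v) x.
Proof.
by move=> c0 [vx v0]; split; [rewrite memvZ|rewrite scaler_eq0 negb_or c0].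
Qed.

Lemma homog_coord_point v : v != 0 -> exists x, homog_coord v x.
Proof.
move=> v0; have dv : \dim <[v]>%VS == 1%N by rewrite dim_vline v0.
by exists (exist _ <[v]>%VS dv); split=> //=; exact: memv_line.
Qed.

Lemma ev_homogZ d (f : {mpoly K[n.+1]}) c v : f \is d.-homog ->
  ev f (c *: v) = c ^+ d * ev f v.
Proof.
move=> /dhomogP fd; rewrite /ev !mevalE mulr_sumr !big_seq; apply: eq_bigr => m mf.
rewrite mulrCA; congr (_ * _); rewrite -(fd m mf) /= mdegE -prodrXr -big_split /=.
by apply: eq_bigr => i _; rewrite mxE exprMn.
Qed.

Lemma ev_homog_coord d (f : {mpoly K[n.+1]}) v w x : f \is d.-homog ->
  homog_coord v x -> homog_coord w x -> ev f v != 0 -> ev f w != 0.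
Proof.
move=> fd vx wx fv; have [c c0 ->] := homog_coord_prop vx wx.
by rewrite (ev_homogZ _ _ fd) mulf_neq0 ?expf_neq0.
Qed.

Lemma homog_coord_neq0 v x : homog_coord v x -> exists i, v 0 i != 0.
Proof.
move=> [_ v0]; apply: contrapT => nv; case/eqP: v0; apply/rowP => i; rewrite mxE.
by apply: contrapT => /eqP vi; apply: nv; exists i.
Qed.

Lemma zero_locusNP (S : set {mpoly K[n.+1]}) x :
  (forall f, S f -> exists d, f \is d.-homog) -> ~ zero_locus S x ->
  exists2 f, S f & forall v, homog_coord v x -> ev f v != 0.
Proof.
move=> Sh nSx; apply: contrapT => nf; apply: nSx => f v Sf vx.
apply: contrapT => /eqP fv; apply: nf; exists f => // w wx.
by have [d fd] := Sh _ Sf; exact: ev_homog_coord fd vx wx fv.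
Qed.

End ProjectivePoints.

Section LocalFormulas.
Variables (K : fieldType) (n : nat) (X : set (proj K n)).
Implicit Types x y : X.

Lemma open_in_basic (W : set X) x : open_in W -> W x ->
  exists d (s : {mpoly K[n.+1]}), [/\ s \is d.-homog,
    forall v, homog_coord v (val x) -> ev s v != 0 &
    forall y v, homog_coord v (val y) -> ev s v != 0 -> W y].
Proof.
move=> [A [S [Sh AS] WA]] Wx.
have nSx : ~ zero_locus S (val x).
  move=> Sx; have : (~` W) x by rewrite WA /= AS.
  exact.
have [s Ss sx] := zero_locusNP Sh nSx; have [d sd] := Sh _ Ss.
exists d, s; split=> // y v vy sv; apply: contrapT => nWy.
have : (~` W) y by [].
by rewrite WA /= AS => /(_ s v Ss vy) s0; rewrite s0 eqxx in sv.
Qed.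

(** Some coordinate [j] of [phi x] is nonzero, and the ratios of the coordinates to it are regular
    where it does not vanish. Their pullbacks are quotients [a i / b i] near [x], and clearing
    denominators gives homogeneous coordinates of the image. *)
Lemma morphism_formula (phi : X -> X) x : morphism phi ->
  exists d (s : {mpoly K[n.+1]}) (g : 'I_n.+1 -> {mpoly K[n.+1]}),
  [/\ s \is d.-homog, forall v, homog_coord v (val x) -> ev s v != 0 &
    forall y v, homog_coord v (val y) -> ev s v != 0 ->
      homog_coord (\row_i ev (g i) v) (val (phi y))].
Proof.
move=> [_ phi_reg].
have /choice[r rP] : forall y, exists v, homog_coord v (val y) by move=> y; exact: homog_coord_exists.
have [j rj] := homog_coord_neq0 (rP (phi x)).
have ev_X i v : ev 'X_i v = v 0 i by rewrite /ev mevalXU.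
have X1 i : ('X_i : {mpoly K[n.+1]}) \is 1.-homog by rewrite dhomogX /= mdeg1.
pose U := [set y : X | r y 0 j != 0].
have Uv y v : homog_coord v (val y) -> U y -> v 0 j != 0.
  by move=> vy; rewrite /U /= -!ev_X; apply: ev_homog_coord (X1 j) (rP y) vy.
have Uopen : open_in U.
  exists (zero_locus [set 'X_j]).
    exists [set 'X_j]; split=> // f ->; by exists 1%N.
  apply/seteqP; split=> y /=.
    move=> nUy f v -> vy; apply: contrapT => /eqP fv; apply: nUy.
    rewrite /U /= -ev_X; exact: ev_homog_coord (X1 j) vy (rP y) fv.
  by move=> /(_ _ (r y) erefl (rP y)) /eqP; rewrite ev_X /U /= => ->.
pose f i (y : X) := r y 0 i / r y 0 j.
have fv i y v : homog_coord v (val y) -> U y -> f i y = v 0 i / v 0 j.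
  move=> vy Uy; have [c c0 ->] := homog_coord_prop (rP y) vy.
  by rewrite !mxE -mulf_div divff ?mul1r.
have freg i : regular_on U (f i).
  move=> y Uy; exists U, 1%N, 'X_i, 'X_j; split=> // z v Uz vz.
  by rewrite !ev_X (fv _ _ _ vz Uz); split=> //; exact: Uv vz Uz.
have Ux : (phi @^-1` U) x by [].
have /choice[W /choice[e /choice[a /choice[b hab]]]] : forall i,
   exists (W : set X) (d : nat) (g h : {mpoly K[n.+1]}),
      [/\ open_in W, W x, W `<=` phi @^-1` U, g \is d.-homog /\ h \is d.-homog &
          forall y v, W y -> homog_coord v (val y) ->
            ev h v != 0 /\ (f i \o phi) y = ev g v / ev h v].
  by move=> i; exact: phi_reg Uopen (freg i) _ Ux.
have /choice[d /choice[s sP]] : forall i, exists d (s : {mpoly K[n.+1]}), [/\ s \is d.-homog,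
    forall v, homog_coord v (val x) -> ev s v != 0 &
    forall y v, homog_coord v (val y) -> ev s v != 0 -> W i y].
  by move=> i; have [Wo Wx _ _ _] := hab i; exact: open_in_basic.
have evprod (I : finType) (P : pred I) F v : ev (\prod_(i | P i) F i) v = \prod_(i | P i) ev (F i) v.
  by rewrite /ev rmorph_prod.
have evM p q v : ev (p * q) v = ev p v * ev q v by rewrite /ev mevalM.
exists (\sum_i d i)%N, (\prod_i s i), (fun i => a i * \prod_(k | k != i) b k); split.
- have : \prod_(i <- enum 'I_n.+1) s i \is (\sum_(i <- enum 'I_n.+1) d i).-homog.
    elim: (enum _) => [|i l IHl]; first by rewrite !big_nil dhomog1.
    by rewrite !big_cons dhomogM //; case: (sP i).
  by rewrite !big_enum.
- move=> v vx; rewrite evprod; apply/prodf_neq0 => i _.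
  by case: (sP i) => _ + _; apply.
move=> y v vy; rewrite evprod => /prodf_neq0 sv.
have Wy i : W i y by case: (sP i) => _ _; apply; [exact: vy|exact: sv].
have Uy : U (phi y) by have [_ _ + _ _] := hab j; apply; exact: Wy.
have hb i : ev (b i) v != 0 /\ f i (phi y) = ev (a i) v / ev (b i) v.
  by case: (hab i) => _ _ _ _; apply.
(* [ev (a i) v / ev (b i) v] is the ratio of the coordinates [i] and [j] of the image, whence this
   common factor. *)
have -> : \row_i ev (a i * \prod_(k | k != i) b k) v =
    ((\prod_k ev (b k) v) / r (phi y) 0 j) *: r (phi y).
  apply/rowP => i; rewrite !mxE.
  have [bi fi] := hb i; rewrite mulrAC -mulrA -/(f i (phi y)) fi.
  rewrite evM evprod [X in _ = X * _](bigD1 i) //=.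
  by field.
apply: homog_coordZ => //; rewrite mulf_neq0 ?invr_eq0 //.
by apply/prodf_neq0 => k _; case: (hb k).
Qed.

End LocalFormulas.

(** Coordinates as a function rather than a row, the form in which [meval] and substitution take
    their argument. *)
Definition rep (K : fieldType) n (w : 'I_n.+1 -> K) (x : proj K n) : Prop :=
  homog_coord (\row_i w i) x.

Lemma ev_row (K : fieldType) n (f : {mpoly K[n.+1]}) (w : 'I_n.+1 -> K) :
  ev f (\row_i w i) = f.@[w].
Proof. by apply: meval_eq => i; rewrite mxE. Qed.

Lemma ideal_gen_setU (K : fieldType) n (S : set {mpoly K[n]}) m (h : 'I_m -> {mpoly K[n]}) f :
  ideal_gen (S `|` range h) f ->
  exists f0 (c : 'I_m -> {mpoly K[n]}), ideal_gen S f0 /\ f = f0 + \sum_l c l * h l.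
Proof.
pose J := [set f | exists f0 (c : 'I_m -> {mpoly K[n]}),
  ideal_gen S f0 /\ f = f0 + \sum_l c l * h l].
have [I0 ID IM] := ideal_gen_ideal S.
move=> hf; apply: (hf J).
  split=> [|f1 f2 [g1 [c1 [I1 ->]]] [g2 [c2 [I2 ->]]]|q f1 [g1 [c1 [I1 ->]]]].
  - exists 0, (fun=> 0); split=> //; rewrite big1 ?addr0 // => l _.
    by rewrite mul0r.
  - exists (g1 + g2), (fun l => c1 l + c2 l); split; first exact: ID.
    rewrite addrACA -big_split /=; congr (_ + _); apply: eq_bigr => l _.
    by rewrite mulrDl.
  - exists (q * g1), (fun l => q * c1 l); split; first exact: IM.
    rewrite mulrDr mulr_sumr; congr (_ + _); apply: eq_bigr => l _.
    by rewrite mulrA.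
move=> g [Sg|[l _ <-]].
  exists g, (fun=> 0); split; first exact: sub_ideal_gen.
  by rewrite big1 ?addr0 // => l _; rewrite mul0r.
exists 0, (fun l' => (l' == l)%:R); split=> //.
rewrite add0r (bigD1 l) //= eqxx mul1r big1 ?addr0 // => l' /negbTE->.
by rewrite mul0r.
Qed.

Section Atlas.
Variables (K : closedFieldType) (n : nat).
Hypothesis uncountableK : ~ countable [set: K].
Variables (X : set (proj K n)) (hX : quasiprojective X).
Variables (Phi Phi' : X -> X) (hPhi : automorphism Phi Phi').

(** The last clauses prepare the reduction. The factor ['X_k] makes coordinate [k] a unit wherever
    the chart function is one. The identities for powers of [s l] certify that, when [s l] has a
    unit value in a valuation ring containing the coefficients and coordinates, some chart function
    is a unit at the image point as well. *)
Lemma atlas : exists m (s : 'I_m -> {mpoly K[n.+1]})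
    (g g' : 'I_m -> n.+1.-tuple {mpoly K[n.+1]}),
  [/\ forall (x : X) w, rep w (val x) -> exists l, (s l).@[w] != 0,
      forall (x : X) w l, rep w (val x) -> (s l).@[w] != 0 ->
        rep (fun i => (tnth (g l) i).@[w]) (val (Phi x)) /\
        rep (fun i => (tnth (g' l) i).@[w]) (val (Phi' x)),
      forall l, exists k r, s l = 'X_k * r &
      (forall l, exists M (c : 'I_m -> {mpoly K[n.+1]}), forall (x : X) w, rep w (val x) ->
        (s l).@[w] ^+ M = \sum_l' (c l').@[w] * (s l').@[fun i => (tnth (g l) i).@[w]]) /\
      (forall l, exists M (c : 'I_m -> {mpoly K[n.+1]}), forall (x : X) w, rep w (val x) ->
        (s l).@[w] ^+ M = \sum_l' (c l').@[w] * (s l').@[fun i => (tnth (g' l) i).@[w]])].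
Proof.
have [mPhi mPhi' _ _] := hPhi.
have [A [B [[SA [SAh AE]] [SB [SBh BE]] XE]]] := hX.
have XAB z : X z <-> zero_locus SA z /\ ~ zero_locus SB z by rewrite XE AE BE.
pose chart (s : {mpoly K[n.+1]}) (gg : n.+1.-tuple {mpoly K[n.+1]} * n.+1.-tuple {mpoly K[n.+1]}) :=
  [/\ exists k r, s = 'X_k * r,
   forall (x : X) w, rep w (val x) -> s.@[w] != 0 ->
        rep (fun i => (tnth gg.1 i).@[w]) (val (Phi x)) /\
        rep (fun i => (tnth gg.2 i).@[w]) (val (Phi' x)) &
   forall w, (forall f, SA f -> f.@[w] = 0) -> s.@[w] != 0 -> exists x : X, rep w (val x)].
have repZ d (f : {mpoly K[n.+1]}) v w (x : X) : f \is d.-homog -> rep v (val x) ->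
    rep w (val x) -> f.@[v] != 0 -> f.@[w] != 0.
  by move=> fd vx wx; rewrite -!ev_row; exact: ev_homog_coord fd vx wx.
have SAx (x : X) w f : rep w (val x) -> SA f -> f.@[w] = 0.
  move=> wx Sf; have /XAB[/(_ f _ Sf wx)] : X (val x) by exact: set_mem (valP x).
  by rewrite ev_row.
have covered (x : X) w : rep w (val x) -> exists s, (exists gg, chart s gg) /\ s.@[w] != 0.
  move=> wx.
  have [d1 [s1 [g1 [s1h s1x s1P]]]] := morphism_formula x mPhi.
  have [d2 [s2 [g2 [s2h s2x s2P]]]] := morphism_formula x mPhi'.
  have [b Sb bx] : exists2 f, SB f & forall v, homog_coord v (val x) -> ev f v != 0.
    apply: zero_locusNP => //.
    by have /XAB[] : X (val x) by exact: set_mem (valP x).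
  have [k wk] := homog_coord_neq0 wx; rewrite mxE in wk.
  (* [s1] and [s2] make the formulas for [Phi] and its inverse valid; ['X_k] and [b] ensure that a
     zero of [SA] where the product is nonzero represents a point, and one outside the removed
     closed set. *)
  exists ('X_k * (s1 * s2 * b)); split; last first.
    rewrite !mevalM mevalXU !mulf_neq0 //.
    - by have := s1x _ wx; rewrite ev_row.
    - by have := s2x _ wx; rewrite ev_row.
    - by have := bx _ wx; rewrite ev_row.
  exists ([tuple g1 i | i < n.+1], [tuple g2 i | i < n.+1]); split.
  - by exists k, (s1 * s2 * b).
  - move=> y v vy; rewrite !mevalM !mulf_eq0 !negb_or -!andbA => /and4P[_ s1v s2v _].
    split.
      have := s1P y _ vy; rewrite ev_row => /(_ s1v); congr (homog_coord _ _).
      by apply/rowP => i; rewrite !mxE tnth_mktuple ev_row.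
    have := s2P y _ vy; rewrite ev_row => /(_ s2v); congr (homog_coord _ _).
    by apply/rowP => i; rewrite !mxE tnth_mktuple ev_row.
  - move=> v SAv; rewrite !mevalM !mulf_eq0 !negb_or -!andbA => /and4P[vk _ _ bv].
    have v0 : \row_i v i != 0.
      by apply: contra_neq vk => /rowP/(_ k); rewrite !mxE mevalXU.
    have [y vy] := homog_coord_point v0.
    have Xy : X y.
      apply/XAB; split=> [f u Sf uy|/(_ b _ Sb vy)]; last first.
        by rewrite ev_row => b0; rewrite b0 eqxx in bv.
      apply: contrapT => /eqP fu; have [d fd] := SAh _ Sf.
      by have := ev_homog_coord fd uy vy fu; rewrite ev_row SAv ?eqxx.
    by exists (exist _ y (mem_set Xy)).
have [ss ssP ss0] := zeros_fg [set s | exists gg, chart s gg].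
pose s (l : 'I_(size ss)) := nth 0 ss l.
have /choice[gg ggP] : forall l, exists gg, chart (s l) gg.
  by move=> l; apply: ssP; exact: mem_nth.
have cov (x : X) w : rep w (val x) -> exists l, (s l).@[w] != 0.
  move=> wx; have [s0 [s0c s0w]] := covered x w wx.
  apply: contrapT => ns; case/eqP: s0w; apply: (ss0 w _ s0 s0c) => f fs.
  apply: contrapT => /eqP fw; apply: ns.
  have fi : (index f ss < size ss)%N by rewrite index_mem.
  by exists (Ordinal fi); rewrite /s nth_index.
have certificate (h : 'I_(size ss) -> n.+1.-tuple {mpoly K[n.+1]}) (phi : X -> X) :
  (forall (x : X) w l, rep w (val x) -> (s l).@[w] != 0 ->
     rep (fun i => (tnth (h l) i).@[w]) (val (phi x))) ->
  forall l, exists M (c : 'I_(size ss) -> {mpoly K[n.+1]}), forall (x : X) w, rep w (val x) ->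
        (s l).@[w] ^+ M = \sum_l' (c l').@[w] * (s l').@[fun i => (tnth (h l) i).@[w]].
  move=> hphi l; pose T l' := s l' \mPo h l.
  (* At a common zero of [SA] and of all chart functions at the image, [s l] vanishes: otherwise the
     zero would be a point of [X] whose image lies in no chart. *)
  have [w Jw|M] := nullstellensatz uncountableK (s := s l) (ideal_gen_ideal (SA `|` range T)).
    apply: contrapT => /eqP sw.
    have [_ _ onX] := ggP l; have [|x wx] := onX w _ sw.
      by move=> f Sf; apply: Jw; apply: sub_ideal_gen; left.
    have [l'] := cov _ _ (hphi _ _ _ wx sw); apply/negP; rewrite negbK; apply/eqP.
    rewrite -comp_mpoly_meval; apply: Jw; apply: sub_ideal_gen; right.
    by exists l'.
  move=> /ideal_gen_setU[f0 [c [If0 e]]]; exists M, c => x w wx.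
  have f0w : f0.@[w] = 0.
    apply: (If0 [set f | f.@[w] = 0]) => [|f Sf]; last exact: (SAx x w f wx Sf).
    split=> [|f1 f2 /= h1 h2|q f1 /= h1]; first exact: meval0.
      by rewrite mevalD h1 h2 addr0.
    by rewrite mevalM h1 mulr0.
  rewrite -rmorphXn /= e mevalD f0w add0r raddf_sum; apply: eq_bigr => l' _.
  by rewrite /= mevalM comp_mpoly_meval.
exists (size ss), s, (fun l => (gg l).1), (fun l => (gg l).2); split=> //.
- by move=> x w l wx sw; have [_ h _] := ggP l; exact: h wx sw.
- by move=> l; case: (ggP l).
split; [apply: (certificate _ Phi)|apply: (certificate _ Phi')] => x w l wx sw.
  by have [_ h _] := ggP l; case: (h x w wx sw).
by have [_ h _] := ggP l; case: (h x w wx sw).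
Qed.

End Atlas.

(** * Return times *)

Lemma iterz_unique (T : Type) (f g : T -> T) (y : int -> T) z :
  cancel f g -> (forall z, y (z + 1) = f (y z)) -> iterz f g z (y 0) = y z.
Proof.
move=> fK yS; case: z => m /=.
  elim: m => [|m IHm] //=; rewrite IHm -yS; congr y.
  by rewrite -PoszD addn1.
have yg m' : g (y (- m'%:Z)) = y (- m'.+1%:Z).
  by rewrite -[in RHS](fK (y _)) -yS; congr (g (y _)); lia.
rewrite NegzE -iterS; elim: m.+1 => [|k IHk]; first by rewrite oppr0.
by rewrite iterS IHk yg.
Qed.

Lemma iterzS (T : Type) (f g : T -> T) z x : cancel g f ->
  iterz f g (z + 1) x = f (iterz f g z x).
Proof.
move=> gK; case: z => m /=; first by rewrite addn1.
rewrite gK; case: m => [|m] //.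
by have -> : Negz m.+1 + 1 = Negz m by lia.
Qed.

Lemma iterz_iter (T : Type) (f g : T -> T) k l z x : cancel f g -> cancel g f ->
  iterz (iter k f) (iter k g) z (iter l f x) = iterz f g (l%:Z + k%:Z * z) x.
Proof.
move=> fK gK.
have iterK j : cancel (iter j f) (iter j g).
  by elim: j => // j IHj y; rewrite [iter j.+1 f y]iterS iterSr fK IHj.
have shift j w : iterz f g (w + j%:Z) x = iter j f (iterz f g w x).
  elim: j => [|j IHj]; first by rewrite addr0.
  by rewrite iterS -IHj -iterzS //; congr iterz; lia.
pose y w := iterz f g (l%:Z + k%:Z * w) x.
have -> : iter l f x = y 0 by rewrite /y mulr0 addr0.
rewrite (iterz_unique _ (iterK k)) // => w.
by rewrite /y -shift; congr iterz; lia.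
Qed.

(** Zero and the elements with inverse outside [O] make up the maximal ideal, so a sum outside it
    has a factor [v i] outside it. *)
Lemma valring_unit_sum (K : fieldType) (O : subringClosed K) m (u v : 'I_m -> K) :
  (forall x, x \in O \/ x^-1 \in O) -> (forall i, u i \in O) ->
  \sum_i u i * v i != 0 -> (\sum_i u i * v i)^-1 \in O ->
  exists i, v i != 0 /\ (v i)^-1 \in O.
Proof.
move=> valO uO s0 sO; apply: contrapT => nv.
pose nonunit x := x = 0 \/ x^-1 \notin O.
suff [s0'|] : nonunit (\sum_i u i * v i).
- by rewrite s0' eqxx in s0.
- by rewrite sO.
elim/big_ind: _ => [|x y xm ym|i _]; first by left.
- have [xy0|xy0] := eqVneq (x + y) 0; [by left|right].
  apply/negP => xyO.
  have aux a b : a + b = x + y -> nonunit b -> a / b \in O -> b = 0.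
    move=> abE [//|/negP nb] abO; apply: contrapT => /eqP b0; apply: nb.
    have -> : b^-1 = (1 + a / b) * (x + y)^-1 by rewrite -abE; field; rewrite ?b0 ?abE ?xy0.
    by rewrite rpredM ?rpredD ?rpred1.
  have auxE a b : a + b = x + y -> b = 0 -> nonunit a -> False.
    move=> abE b0; rewrite b0 addr0 in abE; rewrite abE => -[xy|/negP]; last by [].
    by rewrite xy eqxx in xy0.
  have [xdy|] := valO (x / y).
    by have y0 := aux x y erefl ym xdy; exact: auxE erefl y0 xm.
  rewrite invf_div => ydx; have x0 := aux y x (addrC _ _) xm ydx.
  exact: auxE (addrC _ _) x0 ym.
have [uv0|uv0] := eqVneq (u i * v i) 0; [by left|right].
move: uv0; rewrite mulf_eq0 negb_or => /andP[u0 v0].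
apply/negP => uvO; apply: nv; exists i; split=> //.
have -> : (v i)^-1 = u i * (u i * v i)^-1 by field; rewrite u0 v0.
exact: rpredM.
Qed.

Definition mcoeffs (K : nzRingType) n (f : {mpoly K[n]}) : seq K := [seq f@_m | m <- msupp f].

Lemma mpolyOver_mcoeffs (K : nzRingType) n (f : {mpoly K[n]}) (S : subringClosed K) :
  {subset mcoeffs f <= S} -> f \is a mpolyOver n S.
Proof.
move=> fS; apply/mpolyOverP => m; have [mf|/memN_msupp_eq0->] := boolP (m \in msupp f).
  by apply: fS; exact: map_f.
exact: rpred0.
Qed.

Lemma subring_gen_meval (K : numFieldType) a n (f : {mpoly K[n]}) (v : 'I_n -> K) :
  {subset mcoeffs f <= a} -> (forall i, subring_gen a (v i)) -> subring_gen a f.@[v].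
Proof.
move=> fa va S aS; apply: mpolyOver_meval => [|i]; last exact: va.
by apply: mpolyOver_mcoeffs => c /fa /aS.
Qed.

Lemma absz_shift (t : int) (T : nat) : (`|t| <= T)%N ->
  `|(t + T%:Z)%R|%N%:Z = t + T%:Z /\ (`|(t + T%:Z)%R| <= 2 * T)%N.
Proof. by lia. Qed.

Section ReturnTimes.
Variables (K : numClosedFieldType) (n : nat).
Hypothesis uncountableK : ~ countable [set: K].
Variables (X : set (proj K n)) (hX : quasiprojective X).
Variables (Phi Phi' : X -> X) (hPhi : automorphism Phi Phi').
Variables (alpha : X) (V : set X) (hV : closed_in V).

(** [k] precedes [z0], so one modulus serves all classes. If some equation of [V] has a nonzero
    value [f] at time [z0], a ring [O] is chosen for this [f], and enough zeros along the
    progression make [f] divisible by a power of [p] that [O] rules out. *)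
Lemma return_times_dichotomy : exists2 k : nat, (0 < k)%N & forall z0 : int,
  infinite_set [set z | (k%:Z %| z - z0)%Z /\ V (iterz Phi Phi' z alpha)] ->
  V (iterz Phi Phi' z0 alpha).
Proof.
have [_ _ PhiK Phi'K] := hPhi.
pose xz z := iterz Phi Phi' z alpha.
have xzS z : xz (z + 1) = Phi (xz z) by exact: iterzS.
have xzP z : xz (z - 1) = Phi' (xz z).
  by rewrite -(PhiK (xz (z - 1))) -xzS subrK.
have [m [s [g [g' [cov formula sX [cert cert']]]]]] := atlas uncountableK hX hPhi.
have [AV [SV [SVh AVE]] VE] := hV.
have [qs qsS qs0] := zeros_fg SV.
have Vq (x : X) w q : rep w (val x) -> V x -> q \in qs -> q.@[w] = 0.
  move=> wx; rewrite VE /= AVE => Vx /qsS Sq.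
  by have := Vx q _ Sq wx; rewrite ev_row.
have qV (x : X) w : rep w (val x) -> (forall q, q \in qs -> q.@[w] = 0) -> V x.
  move=> wx w0; rewrite VE /= AVE => f v Sf vx; apply: contrapT => /eqP fv.
  have [d fd] := SVh _ Sf; have := ev_homog_coord fd vx wx fv.
  by rewrite ev_row (qs0 _ w0) ?eqxx.
have /choice[kk /choice[r sr]] := sX.
have /choice[Mc /choice[c cP]] := cert.
have /choice[Mc' /choice[c' cP']] := cert'.
have [v0 v0x] : exists w, rep w (val alpha).
  have [v vx] := homog_coord_exists (val alpha); exists (fun i => v 0 i).
  by rewrite /rep (_ : \row_i v 0 i = v) //; apply/rowP => i; rewrite mxE.
have [l0 sl0] := cov _ _ v0x.
pose polys : seq {mpoly K[n.+1]} := qs ++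
  flatten [seq [:: s l, r l & [seq tnth (g l) i | i <- enum 'I_n.+1]
    ++ [seq tnth (g' l) i | i <- enum 'I_n.+1]
    ++ [seq c l l' | l' <- enum 'I_m] ++ [seq c' l l' | l' <- enum 'I_m]] | l <- enum 'I_m].
(* Adjoining the inverse of the first chart value makes the starting point good for every [O] that
   contains [a]. *)
pose a := (s l0).@[v0]^-1 :: [seq v0 i | i <- enum 'I_n.+1] ++ flatten [seq mcoeffs f | f <- polys].
have pa f : f \in polys -> {subset mcoeffs f <= a}.
  move=> fp x xf; rewrite inE mem_cat; apply/orP; right; apply/orP; right.
  by apply/flattenP; exists (mcoeffs f) => //; exact: map_f.
have lp l f : f \in [:: s l, r l & [seq tnth (g l) i | i <- enum 'I_n.+1]
    ++ [seq tnth (g' l) i | i <- enum 'I_n.+1]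
    ++ [seq c l l' | l' <- enum 'I_m] ++ [seq c' l l' | l' <- enum 'I_m]] ->
    {subset mcoeffs f <= a}.
  move=> fl; apply: pa; rewrite mem_cat; apply/orP; right; apply/flattenP.
  by eexists; last exact: fl; apply: map_f; rewrite mem_enum.
have sa l : {subset mcoeffs (s l) <= a} by apply: (lp l); rewrite inE eqxx.
have ra l : {subset mcoeffs (r l) <= a} by apply: (lp l); rewrite !inE eqxx orbT.
have ga l i : {subset mcoeffs (tnth (g l) i) <= a}.
  by apply: (lp l); rewrite !inE !mem_cat map_f ?mem_enum // !orbT.
have ga' l i : {subset mcoeffs (tnth (g' l) i) <= a}.
  by apply: (lp l); rewrite !inE !mem_cat (map_f (fun i => tnth (g' l) i)) ?mem_enum // !orbT.
have ca l l' : {subset mcoeffs (c l l') <= a}.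
  by apply: (lp l); rewrite !inE !mem_cat (map_f (c l)) ?mem_enum // !orbT.
have ca' l l' : {subset mcoeffs (c' l l') <= a}.
  by apply: (lp l); rewrite !inE !mem_cat (map_f (c' l)) ?mem_enum // !orbT.
have qa q : q \in qs -> {subset mcoeffs q <= a}.
  by move=> qq; apply: pa; rewrite mem_cat qq.
have v0a i : v0 i \in a by rewrite inE mem_cat map_f ?mem_enum ?orbT.
have int_ind (P : int -> Prop) : P 0 -> (forall z, P z -> P (z + 1)) ->
    (forall z, P z -> P (z - 1)) -> forall z, P z.
  move=> P0 PS PP; elim/int_rect => // k Pk; first by rewrite -addn1 PoszD; exact: PS.
  by rewrite -addn1 PoszD opprD; exact: PP.
have [B [L [p [pp p2 aL pL red]]]] := good_reduction a.
exists (orbit_period B n.+1); first by rewrite muln_gt0 !fact_gt0.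
set k := orbit_period B n.+1 => z0 Zinf; apply: contrapT => nV.
(* The value [f] must be known before [O], while good coordinates depend on [O]. So coordinates [w0]
   are first found in the ring generated by [a], and compared at the end with good ones through a
   scalar. *)
have [w0 [w0x w0a]] : exists w, rep w (val (xz z0)) /\ forall i, subring_gen a (w i).
  elim/int_ind: z0 {Zinf nV} => [|z [w [wz wa]]|z [w [wz wa]]].
  - by exists v0; split=> // i S; apply; exact: v0a.
  - have [l sl] := cov _ _ wz; have [h _] := formula _ _ _ wz sl.
    by rewrite xzS; exists (fun i => (tnth (g l) i).@[w]); split=> // i; exact: subring_gen_meval.
  - have [l sl] := cov _ _ wz; have [_ h] := formula _ _ _ wz sl.
    by rewrite xzP; exists (fun i => (tnth (g' l) i).@[w]); split=> // i; exact: subring_gen_meval.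
have [q [qqs qw0]] : exists q, q \in qs /\ q.@[w0] != 0.
  apply: contrapT => nq; apply: nV; apply: (qV _ w0 w0x) => q qqs.
  by apply: contrapT => /eqP qw; apply: nq; exists q.
have fa : subring_gen a q.@[w0] by apply: subring_gen_meval => //; exact: qa.
have [O [chi [aO valO pO chiP [j fj]]]] := red _ fa qw0.
have pK : p%:R != 0 :> K by rewrite pnatr_eq0 -lt0n prime_gt0.
have [E EE] : exists E : subringClosed K, E =i [predI O & L].
  apply: subring_closed_pack; split=> [|x y|x y]; rewrite !inE /=; first by rewrite !rpred1.
    by move=> /andP[xO xL] /andP[yO yL]; rewrite !rpredB.
  by move=> /andP[xO xL] /andP[yO yL]; rewrite !rpredM.
have EO : {subset E <= O} by move=> x; rewrite EE => /andP[].
have aE : {subset a <= E} by move=> x xa; rewrite EE inE /= aO ?aL.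
have Ediv x : x \in E -> x / p%:R \in O -> x / p%:R \in E.
  by rewrite !EE !inE /= => /andP[_ xL] -> /=; rewrite rpredM.
have chiE x y : x \in E -> y \in E -> chi x = chi y <-> (x - y) / p%:R \in O.
  by rewrite !EE => /andP[xO xL] /andP[yO yL]; exact: chiP.
have polyE f : {subset mcoeffs f <= a} -> f \is a mpolyOver n.+1 E.
  by move=> fE; apply: mpolyOver_mcoeffs => x /fE /aE.
pose Good w := [/\ forall i, w i \in E, exists x : X, rep w (val x) &
  exists l, (s l).@[w] != 0 /\ (s l).@[w]^-1 \in O].
(* The certificates of the atlas carry goodness along [Phi] and along its inverse alike, hence along
   the whole orbit. *)
have transport (h : 'I_m -> n.+1.-tuple {mpoly K[n.+1]}) (M : 'I_m -> nat)
    (C : 'I_m -> 'I_m -> {mpoly K[n.+1]})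
    (phi : X -> X) :
    (forall l i, {subset mcoeffs (tnth (h l) i) <= a}) ->
    (forall l l', {subset mcoeffs (C l l') <= a}) ->
    (forall (x : X) w l, rep w (val x) -> (s l).@[w] != 0 ->
        rep (fun i => (tnth (h l) i).@[w]) (val (phi x))) ->
    (forall l (x : X) w, rep w (val x) -> (s l).@[w] ^+ M l =
        \sum_l' (C l l').@[w] * (s l').@[fun i => (tnth (h l) i).@[w]]) ->
    forall w l, Good w -> (s l).@[w] != 0 -> (s l).@[w]^-1 \in O ->
      Good (fun i => (tnth (h l) i).@[w]).
  move=> hE CE hphi certh w l [wE [x wx] _] sl slO.
  have hwE i : (tnth (h l) i).@[w] \in E by apply: mpolyOver_meval => //; exact: polyE.
  split=> //; first by exists (phi x); exact: hphi.
  have := certh l x w wx => e.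
  apply: (valring_unit_sum valO (u := fun l' => (C l l').@[w])) => [l'||].
  - by apply: EO; apply: mpolyOver_meval => //; exact: polyE.
  - by rewrite -e expf_neq0.
  - by rewrite -e -exprVn rpredX.
have GoodS w l : Good w -> (s l).@[w] != 0 -> (s l).@[w]^-1 \in O ->
    Good (fun i => (tnth (g l) i).@[w]).
  by apply: (transport g Mc c Phi) => // x w' l' wx sl;
    case: (formula _ _ _ wx sl).
have GoodS' w l : Good w -> (s l).@[w] != 0 -> (s l).@[w]^-1 \in O ->
    Good (fun i => (tnth (g' l) i).@[w]).
  by apply: (transport g' Mc' c' Phi') => // x w' l' wx sl;
    case: (formula _ _ _ wx sl).
have Good_rep z : exists w, Good w /\ rep w (val (xz z)).
  elim/int_ind: z => [|z [w [Gw wz]]|z [w [Gw wz]]].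
  - exists v0; split=> //; split=> [i||]; [exact/aE/v0a|by exists alpha|].
    by exists l0; split=> //; apply: aO; exact: mem_head.
  - have [_ _ [l [sl slO]]] := Gw; have [h _] := formula _ _ _ wz sl.
    by rewrite xzS; exists (fun i => (tnth (g l) i).@[w]); split=> //; exact: GoodS.
  - have [_ _ [l [sl slO]]] := Gw; have [_ h] := formula _ _ _ wz sl.
    by rewrite xzP; exists (fun i => (tnth (g' l) i).@[w]); split=> //; exact: GoodS'.
(* Twice as many zeros as the exponent [j] to be contradicted, the factor 2 being the price of the
   factorials. *)
have [A sA cA] := infinite_set_fset (2 * j)%N Zinf.
pose zs := take (2 * j) (finmap.enum_fset A).
have szs : size zs = (2 * j)%N by rewrite size_takel.
have uzs : uniq zs by rewrite take_uniq ?finmap.fset_uniq.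
have zsP z : z \in zs -> (k%:Z %| z - z0)%Z /\ V (xz z).
  by move=> /mem_take zA; exact: sA.
have k0 : k%:Z != 0 by rewrite -lt0n muln_gt0 !fact_gt0.
pose t z := ((z - z0) %/ k%:Z)%Z.
have tE z : z \in zs -> z = z0 + k%:Z * t z.
  by move=> /zsP[kz _]; rewrite /t mulrC divzK // addrC subrK.
pose T := (\sum_(z <- zs) `|t z|)%N.
have tT z : z \in zs -> (`|t z| <= T)%N.
  by move=> zz; rewrite /T (big_rem z zz) /= leq_addr.
pose M := (2 * T)%N.
(* The times [z0 + k * t] with [t] between [-T] and [T] become the indices [t + T], up to
   [M = 2 * T]. The extra shift by [M] provides [N0 = M] preliminary steps, and the 1 accounts for
   the base point. *)
pose e0 := z0 - k%:Z * (T + M + 1)%N%:Z.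
have [u0 [Gu0 u0x]] := Good_rep e0.
have [|||x [x0 Gx xS main]] := @good_orbit_zeros K O E p B chi valO pp p2 pO EO Ediv chiE
  n.+1 'I_m s g (fun l => polyE _ (sa l)) (fun l i => polyE _ (ga l i)) Good _ _ _ u0 Gu0.
- by move=> w [].
- by move=> w [].
- exact: GoodS.
have xrep i : rep (x i) (val (xz (e0 + i%:Z))).
  elim: i => [|i IHi]; first by rewrite x0 addr0.
  have [l sl ->] := xS i; rewrite -(addn1 i) PoszD addrA xzS.
  by case: (formula _ _ _ IHi sl).
pose idx z := `|(t z + T%:Z)%R|%N.
have idxE z : z \in zs -> (idx z)%:Z = t z + T%:Z.
  by move=> /tT /absz_shift[].
have orb i (y : int) : i%:Z = y + T%:Z -> e0 + (k * (M + i).+1)%N%:Z = z0 + k%:Z * y.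
  move=> iE; rewrite /e0 -(addn1 (M + i)) PoszM !PoszD iE; ring.
have fin : q.@[x (k * (M + T).+1)%N] / p%:R ^+ j \in O.
  apply: (main q M M j [seq idx z | z <- zs]) => //.
  - by apply: polyE; exact: qa.
  - rewrite map_inj_in_uniq // => z z' zz zz' e.
    rewrite (tE z) // (tE z') //; congr (_ + _ * _).
    by apply: (addIr T%:Z); rewrite -!idxE // e.
  - by rewrite size_map.
  - move=> _ /mapP[z zz ->]; split; first by case: (absz_shift (tT z zz)).
    have zx := xrep (k * (M + idx z).+1)%N; rewrite (orb _ (t z)) ?idxE // -tE // in zx.
    by apply: (Vq _ _ _ zx) => //; case: (zsP z zz).
  - by rewrite /M leq_pmull.
have := xrep (k * (M + T).+1)%N; rewrite (orb T 0) ?add0r // mulr0 addr0.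
move: fin (Gx (k * (M + T).+1)%N); move: (x _) => y fin [yE _ [l [sl slO]]] yx.
(* Both vectors represent the point at time [z0]. The scalar is integral because a coordinate of
   [y], dividing a unit chart value, is a unit; homogeneity then carries divisibility from [y] to
   [w0]. *)
have [lam lam0 w0y] := homog_coord_prop yx w0x.
have yk : y (kk l) != 0 by move: sl; rewrite sr mevalM mevalXU mulf_eq0 negb_or => /andP[].
have ykO : (y (kk l))^-1 \in O.
  have rl : (r l).@[y] != 0 by move: sl; rewrite sr mevalM mulf_eq0 negb_or => /andP[].
  have -> : (y (kk l))^-1 = (r l).@[y] * (s l).@[y]^-1.
    by rewrite sr mevalM mevalXU; field; rewrite yk rl.
  by rewrite rpredM // EO // mpolyOver_meval //; exact: polyE.
have w0E i : w0 i \in O by apply: w0a.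
have lamO : lam \in O.
  have -> : lam = w0 (kk l) * (y (kk l))^-1.
    by have /rowP/(_ (kk l)) := w0y; rewrite !mxE => ->; rewrite mulfK.
  by rewrite rpredM.
case/negP: fj; have [d qd] := SVh _ (qsS _ qqs).
by rewrite -ev_row w0y (ev_homogZ _ _ qd) ev_row -mulrA rpredM ?rpredX.
Qed.

End ReturnTimes.

(** * Sorting the orbit by residue classes of times *)

Lemma complex_uncountable (R : realType) : ~ countable [set: R[i]].
Proof.
move/countable_injP => [f fI]; apply: (@realType_uncountable R).
apply/countable_injP; exists (fun x => f (x%:C)%C) => x y _ _ fxy.
by have [] := fI _ _ (mem_set I) (mem_set I) fxy.
Qed.

(** Representatives run from 1 to [k] instead of from 0, as the exponents in the conclusion have to
    be positive. *)
Lemma residue_class_representative (k : nat) (z : int) : (0 < k)%N ->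
  exists l : nat, [/\ (0 < l)%N, (l <= k)%N & (k%:Z %| z - l%:Z)%Z].
Proof.
move=> k0; have kZ : k%:Z != 0 by rewrite -lt0n.
exists (`|((z - 1) %% k%:Z)%Z|%N.+1); split=> //.
  by have := modz_ge0 (z - 1) kZ; have := ltz_mod (z - 1) kZ; lia.
rewrite -addn1 PoszD gez0_abs ?modz_ge0 // opprD addrCA addrC -addrA.
rewrite addrC -addrA; apply/dvdzP; exists ((z - 1) %/ k%:Z)%Z.
have := divz_eq (z - 1) k%:Z; move: ((z - 1) %/ k)%Z ((z - 1) %% k)%Z => q r e.
by move: e; rewrite /=; move/eqP; rewrite -subr_eq => /eqP <-; ring.
Qed.

Theorem theorem5p1 (R : realType) (n : nat) (X : set (proj R[i] n))
    (hX : quasiprojective X) (Phi Phi' : X -> X)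
    (hPhi : automorphism Phi Phi') (alpha : X) (V : set X)
    (hV : closed_in V) :
  exists (F : set X) (J : set (nat * nat)),
    [/\ finite_set F,
        finite_set J,
        (forall k l : nat, J (k, l) -> (0 < k)%N /\ (0 < l)%N) &
        V `&` full_orbit Phi Phi' alpha =
        F `|` \bigcup_(kl in J)
                full_orbit (iter kl.1 Phi) (iter kl.1 Phi')
                           (iter kl.2 Phi alpha)].
Proof.
have [_ _ PhiK Phi'K] := hPhi.
have [k k0 dich] := return_times_dichotomy (@complex_uncountable R) hX hPhi alpha hV.
pose xz z := iterz Phi Phi' z alpha.
pose Z (l : nat) := [set z | (k%:Z %| z - l%:Z)%Z /\ V (xz z)].
pose full (l : nat) := forall z, (k%:Z %| z - l%:Z)%Z -> V (xz z).
have Zfin l : ~ full l -> finite_set (Z l).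
  move=> nfl; apply: contrapT => Zinf; apply: nfl => z kz; apply: dich.
  apply: sub_infinite_set Zinf => z' [kz' Vz']; split=> //.
  have -> : z' - z = (z' - l%:Z) - (z - l%:Z) by ring.
  exact: rpredB.
(* A class of times that is not full meets [V] only finitely often and contributes to the finite
   set; a full class is one orbit of the iterate of order [k]. *)
exists (\bigcup_(l in [set l | (0 < l <= k)%N /\ ~ full l]) (xz @` Z l)),
  [set kl | kl.1 = k /\ (0 < kl.2 <= k)%N /\ full kl.2]; split.
- apply: bigcup_finite => [|l [_ nfl]]; last exact/finite_image/Zfin.
  by apply: sub_finite_set (finite_II k.+1) => l [/andP[_ lk] _].
- have : finite_set ([set k] `*` `I_k.+1) by apply: finite_setX; [exact: finite_set1|exact: finite_II].
  by apply: sub_finite_set => -[k' l] /= [-> [/andP[_ lk] _]].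
- by move=> k' l /= [-> [/andP[l0 _] _]].
apply/seteqP; split=> [x [Vx [z _ zx]]|x].
  rewrite -{x}zx in Vx *.
  have [l [l0 lk kz]] := residue_class_representative z k0.
  have [fl|nfl] := pselect (full l).
    right; exists (k, l); first by split=> //=; rewrite l0 lk.
    have /dvdzP[q zq] := kz; exists q => //=; rewrite iterz_iter //.
    by congr iterz; rewrite mulrC -zq addrC subrK.
  by left; exists l; [rewrite /= l0 lk|exists z].
case=> [[l _ [z [_ Vz] <-]]|[[k' l] /= [-> [_ fl]] [z _ <-]]].
  by split=> //; exists z.
rewrite iterz_iter //; split; last by eexists.
by apply: fl; rewrite addrC addKr dvdz_mulr.
Qed.
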